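(* Let $M\subseteq\mathbb{R}^d$ be a $C^k$ hypersurface with $k\ge2$. Moreover, let $\operatorname{reach}(M)>0$ and $\varepsilon\in(0,\operatorname{reach}(M))$. If there exists $K\in(0,\infty)$ such that $\sup_{\xi\in M}\|D^jn(\xi)\|\le K$ for every $j\in\{2,\dots,k-1\}$, then $D^jp$ is bounded on $M^\varepsilon$ for every $j\in\{2,\dots,k-1\}$.
   Context: Submanifolds are nonempty. A set $M\subseteq\mathbb{R}^d$ is an $m$-dimensional $C^k$ submanifold of $\mathbb{R}^d$ if for every $\xi\in M$ there are open sets $U,V\subseteq\mathbb{R}^d$ with $\xi\in U$ and a $C^k$ diffeomorphism $\Psi:V\to U$ such that for all $y\in V$: $\Psi(y)\in M\iff y_{m+1}=\dots=y_d=0$. A $C^k$ hypersurface is a $(d-1)$-dimensional $C^k$ submanifold. $T_\xi(M)$ denotes the tangent space (a linear subspace of $\mathbb{R}^d$). $d(x,M)=\inf_{\xi\in M}\|x-\xi\|$ (Euclidean norm), $M^\varepsilon:=\{x\in\mathbb{R}^d:d(x,M)<\varepsilon\}$. $\operatorname{unpp}(M)$ is the set of $x\in\mathbb{R}^d$ for which there is exactly one $\xi\in M$ with $\|x-\xi\|=d(x,M)$; this $\xi$ is denoted $p(x)$. $\operatorname{reach}(M):=\sup\{\varepsilon\in(0,\infty):M^\varepsilon\subseteq\operatorname{unpp}(M)\}\in[0,\infty]$, with the supremum of the empty set being $0$. Here $n$ denotes a local unit normal field: a continuous map $n:V\to\mathbb{R}^d$ on a relatively open $V\subseteq M$ with $\|n(\eta)\|=1$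 and $n(\eta)\perp T_\eta(M)$ for all $\eta\in V$. On a connected relatively open set there are at most two of these, differing only by sign, and they are $C^{k-1}$; hence for $\xi\in M$ the number $\|D^jn(\xi)\|$, computed with any local unit normal field defined near $\xi$, does not depend on the choice, so $\sup_{\xi\in M}\|D^jn(\xi)\|$ makes sense even when $M$ is not orientable. $D^jn$ denotes the $j$-th iterated derivative along $M$: $Dn(\xi)$ is the derivative $T_\xi(M)\to\mathbb{R}^d$, extended to $\mathbb{R}^d$ by precomposition with the orthogonal projection $P_{T_\xi(M)}$, and $D^{j+1}n(\xi)$ is obtained in the same way from the map $\eta\mapsto D^jn(\eta)$ with values in the $j$-linear maps $(\mathbb{R}^d)^j\to\mathbb{R}^d$. $D^jp$ is the usual $j$-th derivative on the open set $M^\varepsilon$. Norms are operator norms of multilinear maps. *)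

(* Defs.v *)
From HB Require Import structures.
From mathcomp Require Export all_boot all_order all_algebra.
From mathcomp Require Export all_classical all_reals all_analysis.
Import Order.TTheory GRing.Theory Num.Theory.
Export numFieldNormedType.Exports.

Set Implicit Arguments.
Unset Strict Implicit.
Unset Printing Implicit Defensive.

Local Open Scope classical_set_scope.
Local Open Scope ring_scope.

(* R^d is 'rV[R]_d. The library norm `|x| on row vectors is the sup norm. It
   has the same open sets, limits and derivatives as the Euclidean norm, so it
   is only used through those; enorm is used for distances, unit vectors and
   operator norms. *)
Section Euclidean.
Context {R : realType} {d : nat}.
Implicit Types (x u v : 'rV[R]_d) (M T : set 'rV[R]_d).

Definition dotv u v : R := \sum_i u 0 i * v 0 i.

Definition enorm v : R := Num.sqrt (dotv v v).

Definition setdist x M : R := inf [set enorm (x - xi) | xi in M].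

Definition tube M (e : R) : set 'rV[R]_d := [set x | setdist x M < e].

Definition nearest M x : set 'rV[R]_d :=
  [set xi | M xi /\ enorm (x - xi) = setdist x M].

Definition unpp M : set 'rV[R]_d := [set x | exists! xi, nearest M x xi].

(* The nearest point map p; its value is only meaningful on unpp M. *)
Definition nearest_point M x : 'rV[R]_d := get (nearest M x).

(* The element 0 makes the supremum of the empty set equal to 0. *)
Definition reach M : \bar R :=
  ereal_sup ([set 0%E] `|`
             [set e%:E | e in [set e : R | 0 < e /\ tube M e `<=` unpp M]]).

(* Orthogonal projection onto a linear subspace T. *)
Definition oproj T v : 'rV[R]_d :=
  get [set w | T w /\ forall u, T u -> dotv (v - w) u = 0].

(* Operator norm of a j-linear map, given by its values on j-tuples. *)
Definition opnorm (j : nat) (L : j.-tuple 'rV[R]_d -> 'rV[R]_d) : \bar R :=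
  ereal_sup [set (enorm (L vs))%:E |
             vs in [set vs | forall i, enorm (tnth vs i) <= 1]].

End Euclidean.

Section Smooth.
Context {R : realType} {V W : normedModType R}.
Implicit Types (f : V -> W) (U : set V).

(* iterD f [:: v1; ...; vj] x is D^j f(x)(v1, ..., vj). The derivative of the
   multilinear-map-valued D^j f is taken after evaluation at fixed vectors;
   for V finite-dimensional this is differentiability of D^j f itself, and
   D^(j+1) f(x)(v0, v1, ..., vj) = D(D^j f)(x)(v0) evaluated at (v1, ..., vj). *)
Fixpoint iterD f (vs : seq V) : V -> W :=
  if vs is v :: vs' then fun x => 'd (iterD f vs') x v else f.

Definition times_differentiable (j : nat) U f : Prop :=
  forall vs : seq V, (size vs < j)%N ->
    forall x, U x -> differentiable (iterD f vs) x.

(* Class C^k on an open set U, for V finite-dimensional. *)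
Definition Ck (k : nat) U f : Prop :=
  times_differentiable k U f /\
  forall vs : seq V, size vs = k ->
    forall x, U x -> {for x, continuous (iterD f vs)}.

End Smooth.

Section Submanifold.
Context {R : realType} {d : nat}.
Implicit Types (M : set 'rV[R]_d) (xi : 'rV[R]_d).

Definition Ck_diffeo (k : nat) (V U : set 'rV[R]_d)
    (Psi : 'rV[R]_d -> 'rV[R]_d) : Prop :=
  [/\ set_bij V U Psi, Ck k V Psi &
      exists Phi, {in V, cancel Psi Phi} /\ Ck k U Phi].

(* Coordinates are numbered from 0, so y_(m+1), ..., y_d are the y 0 i with
   m <= i. *)
Definition submanifold (m k : nat) M : Prop :=
  M !=set0 /\
  forall xi, M xi -> exists (U V : set 'rV[R]_d) (Psi : 'rV[R]_d -> 'rV[R]_d),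
    [/\ open U, open V, U xi, Ck_diffeo k V U Psi &
        forall y, V y ->
          (M (Psi y) <-> forall i : 'I_d, (m <= i)%N -> y 0 i = 0)].

(* 0 < d because d.-1 is truncated. *)
Definition hypersurface (k : nat) M : Prop := (0 < d)%N /\ submanifold d.-1 k M.

(* Velocities at xi of C^1 curves in M through xi. *)
Definition tangent M xi : set 'rV[R]_d :=
  [set v | exists (e : R) (c : R -> 'rV[R]_d),
    [/\ 0 < e, Ck 1 (ball (0 : R) e) c, c 0 = xi,
        forall t, ball (0 : R) e t -> M (c t) & derive1 c 0 = v]].

(* L is the derivative at xi of f along M, T_xi(M) -> R^d, extended to R^d by
   precomposition with the orthogonal projection onto T_xi(M). Only the values
   of f on M near xi matter. *)
Definition is_tderiv M (f : 'rV[R]_d -> 'rV[R]_d) xi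
    (L : {linear 'rV[R]_d -> 'rV[R]_d}) : Prop :=
  (forall v, L v = L (oproj (tangent M xi) v)) /\
  forall e : R, 0 < e -> \forall eta \near within M (nbhs xi),
    enorm (f eta - f xi - L (eta - xi)) <= e * enorm (eta - xi).

Definition tderiv M (f : 'rV[R]_d -> 'rV[R]_d) xi :
    {linear 'rV[R]_d -> 'rV[R]_d} :=
  get [set L | is_tderiv M f xi L].

(* Same convention as iterD. *)
Fixpoint iter_tderiv M (f : 'rV[R]_d -> 'rV[R]_d) (vs : seq 'rV[R]_d) :
    'rV[R]_d -> 'rV[R]_d :=
  if vs is v :: vs' then fun xi => tderiv M (iter_tderiv M f vs') xi v else f.

(* The field is a total function of which only the values on V are used. *)
Definition unit_normal_field M (V : set 'rV[R]_d)
    (n : 'rV[R]_d -> 'rV[R]_d) : Prop :=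
  [/\ exists2 O : set 'rV[R]_d, open O & V = M `&` O,
      {within V, continuous n},
      forall eta, V eta -> enorm (n eta) = 1 &
      forall eta, V eta -> forall v, tangent M eta v -> dotv (n eta) v = 0].

(* sup_(xi in M) ||D^j n(xi)||, over all local unit normal fields n defined
   near xi. *)
Definition sup_normal_deriv M (j : nat) : \bar R :=
  ereal_sup [set a | exists xi V n,
    [/\ M xi, unit_normal_field M V n, V xi &
        a = opnorm (fun vs : j.-tuple 'rV[R]_d => iter_tderiv M n vs xi)]].

(* D^j f exists on U and its operator norm is bounded there. *)
Definition bounded_deriv (j : nat) (U : set 'rV[R]_d)
    (f : 'rV[R]_d -> 'rV[R]_d) : Prop :=
  times_differentiable j U f /\
  exists C : R, forall x, U x ->
    (opnorm (fun vs : j.-tuple 'rV[R]_d => iterD f vs x) <= C%:E)%E.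

End Submanifold.

(* Main.v *)
(* Let eps < r with the r-tube inside unpp M.  Along a normal ray from M the distance
   to M grows at unit speed up to r: having gradient of norm 1 off M, it attains
   its maximum over a small ball around a point of the ray further along the ray.
   So both balls of radius eps tangent to M at a point of M avoid M.  This bounds
   the first derivative of the normal and makes p Lipschitz on the eps-tube, hence
   1 + t A is invertible there, with A = Dn o p and x = p x + t n(p x).
   Linearizing this equation shows that p is differentiable with
   (1 + t A) Dp = 1 - n n^T, so p is as smooth as n.  Moreover (1 + t A)^-1 =
   Dp + n n^T, so differentiating once more expresses D^2 p as a polynomial in Dp,
   n, t, A and the second derivative of n; the derivative of (D^i n) o p is
   (D^(i+1) n) o p applied to Dp.  All these quantities are bounded, and
   induction on the order bounds D^j p. *)
From HB Require Import structures.
Require Import Defs.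
From mathcomp Require Import ring lra.
Import Order.TTheory GRing.Theory Num.Theory.
Local Open Scope classical_set_scope.
Local Open Scope ring_scope.
Set Implicit Arguments.
Unset Strict Implicit.
Unset Printing Implicit Defensive.

(** [M] need not be compact or orientable, and no bound on $Dn$ is assumed. So every constant has to
    come from [d], [r], [eps] and [K], and normals exist only on patches. The same differentiation
    rules are run twice. The first run carries no bounds and only shows that derivatives exist;
    there $(1+tA)^{-1}$ may be computed by Cramer's rule. The second run carries bounds uniform over
    all patches and admits no inverses, since nothing controls them a priori. The identity
    $(1+tA)^{-1}=Dp+nn^T$ removes the inverse: $Dp$ is bounded by the Lipschitz constant of [p] and
    $n$ is a unit vector. That constant is $(r+\varepsilon)/(r-\varepsilon)$, which is why some room
    between [eps] and the reach is needed. No order is lost: $n$ is $C^{k-1}$ and $D^2p$ involves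
    two derivatives of $n$, so $D^jp$ involves $D^in$ only for $i\le j\le k-1$. *)

Section EuclideanNorm.
Context {R : realType} {d : nat}.
Implicit Types (x u v w : 'rV[R]_d) (a e : R).

(** * Inner product and Euclidean norm *)

Lemma dotvC u v : dotv u v = dotv v u.
Proof. by apply: eq_bigr => i _; rewrite mulrC. Qed.

Lemma dotvDl u v w : dotv (u + v) w = dotv u w + dotv v w.
Proof. by rewrite -big_split; apply: eq_bigr => i _; rewrite mxE mulrDl. Qed.

Lemma dotvZl a u v : dotv (a *: u) v = a * dotv u v.
Proof. by rewrite /dotv mulr_sumr; apply: eq_bigr => i _; rewrite mxE mulrA. Qed.

Lemma dotvNl u v : dotv (- u) v = - dotv u v.
Proof. by rewrite -scaleN1r dotvZl mulN1r. Qed.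

Lemma dotvBl u v w : dotv (u - v) w = dotv u w - dotv v w.
Proof. by rewrite dotvDl dotvNl. Qed.

Lemma dotv0l v : dotv 0 v = 0.
Proof. by rewrite -(scale0r 0) dotvZl mul0r. Qed.

Lemma dotvDr u v w : dotv w (u + v) = dotv w u + dotv w v.
Proof. by rewrite dotvC dotvDl !(dotvC w). Qed.

Lemma dotvZr a u v : dotv u (a *: v) = a * dotv u v.
Proof. by rewrite dotvC dotvZl dotvC. Qed.

Lemma dotvNr u v : dotv u (- v) = - dotv u v.
Proof. by rewrite dotvC dotvNl dotvC. Qed.

Lemma dotvBr u v w : dotv w (u - v) = dotv w u - dotv w v.
Proof. by rewrite dotvDr dotvNr. Qed.

Lemma dotv0r v : dotv v 0 = 0.
Proof. by rewrite dotvC dotv0l. Qed.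

Definition dotvE := (dotvDl, dotvDr, dotvNl, dotvNr, dotvZl, dotvZr).

Lemma dotv_ge0 v : 0 <= dotv v v.
Proof. by apply: sumr_ge0 => i _; rewrite -expr2 sqr_ge0. Qed.

Lemma sqr_enorm v : enorm v ^+ 2 = dotv v v.
Proof. by rewrite sqr_sqrtr // dotv_ge0. Qed.

Lemma enorm_ge0 v : 0 <= enorm v.
Proof. exact: sqrtr_ge0. Qed.

Lemma ler_coord_enorm v i : `|v 0 i| <= enorm v.
Proof.
rewrite -sqrtr_sqr ler_sqrt ?dotv_ge0 // /dotv (bigD1 i) //= expr2 lerDl.
by apply: sumr_ge0 => j _; rewrite -expr2 sqr_ge0.
Qed.

Lemma ler_norm_enorm v : `|v| <= enorm v.
Proof.
rewrite /Num.Def.normr /= mx_normrE; apply: bigmax_le; first exact: enorm_ge0.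
by move=> [i j] _ /=; rewrite ord1 ler_coord_enorm.
Qed.

Lemma ler_coord_norm v i : `|v 0 i| <= `|v|.
Proof.
by rewrite {2}/Num.Def.normr /= mx_normrE (le_bigmax _ _ (0, i)).
Qed.

(** The factor [d.+1] instead of the sharp $\sqrt d$ avoids a root and is positive even for [d = 0],
    so that it can be divided by. *)
Lemma ler_enorm_norm v : enorm v <= d.+1%:R * `|v|.
Proof.
rewrite -(@ler_pXn2r _ 2) ?nnegrE ?enorm_ge0 ?mulr_ge0 // sqr_enorm.
apply: (@le_trans _ _ (\sum_(i < d) `|v| ^+ 2)).
  apply: ler_sum => i _; rewrite -expr2 -real_normK ?num_real //.
  by rewrite ler_pXn2r ?nnegrE // ler_coord_norm.
rewrite sumr_const card_ord exprMn -[leLHS]mulr_natl ler_wpM2r ?sqr_ge0 //.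
by rewrite -natrX ler_nat expnS (leq_trans (leqnSn d)) // leq_pmulr.
Qed.

Lemma enorm_eq0 v : (enorm v == 0) = (v == 0).
Proof.
apply/idP/eqP => [/eqP v0|->]; last by rewrite /enorm dotv0l sqrtr0.
by apply/eqP; rewrite -normr_le0 -v0 ler_norm_enorm.
Qed.

Lemma enorm0 : enorm (0 : 'rV[R]_d) = 0.
Proof. by apply/eqP; rewrite enorm_eq0. Qed.

Lemma enormZ a v : enorm (a *: v) = `|a| * enorm v.
Proof.
by rewrite /enorm dotvZl dotvZr mulrA -expr2 sqrtrM ?sqr_ge0 // sqrtr_sqr.
Qed.

Lemma enorm_polar v : v != 0 -> exists2 u, enorm u = 1 & v = enorm v *: u.
Proof.
rewrite -enorm_eq0 => v0; exists ((enorm v)^-1 *: v); last by rewrite scalerA mulfV // scale1r.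
by rewrite enormZ ger0_norm ?invr_ge0 ?enorm_ge0 // mulVf.
Qed.

Lemma enormN v : enorm (- v) = enorm v.
Proof. by rewrite -scaleN1r enormZ normrN1 mul1r. Qed.

Lemma enormC u v : enorm (u - v) = enorm (v - u).
Proof. by rewrite -enormN opprB. Qed.

Lemma ler_wsqr a e : 0 <= a -> a <= e -> a ^+ 2 <= e ^+ 2.
Proof. by move=> a0 ae; rewrite ler_pXn2r // nnegrE // (le_trans a0). Qed.

Lemma CauchySchwarz_sqr u v : dotv u v ^+ 2 <= dotv u u * dotv v v.
Proof.
have [->|v0] := eqVneq v 0; first by rewrite !dotv0r expr0n mulr0.
have vv : 0 < dotv v v by rewrite -sqr_enorm exprn_gt0 // lt_def enorm_eq0 v0 enorm_ge0.
(* This square expands to [b * (a * b - c ^+ 2)], with [a], [b], [c] as named below. *)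
have := dotv_ge0 (dotv v v *: u - dotv u v *: v).
rewrite !dotvE (dotvC v u).
set a := dotv u u; set b := dotv v v in vv *; set c := dotv u v => h.
have : 0 <= b * (a * b - c ^+ 2) by lra.
by rewrite pmulr_rge0 // subr_ge0.
Qed.

Lemma CauchySchwarz u v : `|dotv u v| <= enorm u * enorm v.
Proof.
rewrite -(@ler_pXn2r _ 2) ?nnegrE ?mulr_ge0 ?enorm_ge0 //.
by rewrite real_normK ?num_real // exprMn !sqr_enorm CauchySchwarz_sqr.
Qed.

Lemma CauchySchwarz_le u v : dotv u v <= enorm u * enorm v.
Proof. exact: le_trans (ler_norm _) (CauchySchwarz u v). Qed.

Lemma ler_enormD u v : enorm (u + v) <= enorm u + enorm v.
Proof.
rewrite -(@ler_pXn2r _ 2) ?nnegrE ?addr_ge0 ?enorm_ge0 //.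
rewrite sqr_enorm sqrrD !sqr_enorm !dotvE (dotvC v u).
have := CauchySchwarz_le u v; lra.
Qed.

Lemma ler_enormB u v : enorm (u - v) <= enorm u + enorm v.
Proof. by rewrite -(enormN v) ler_enormD. Qed.

Lemma ler_enorm_sum n (F : 'I_n -> 'rV[R]_d) : enorm (\sum_b F b) <= \sum_b enorm (F b).
Proof.
elim/big_ind2: _ => [|a b a' b' ab ab'|//]; first by rewrite enorm0.
by rewrite (le_trans (ler_enormD _ _)) // lerD.
Qed.

Lemma ler_enorm_dist u v : enorm u - enorm v <= enorm (u - v).
Proof. by rewrite lerBlDr (le_trans _ (ler_enormD _ _)) // subrK. Qed.

Lemma enorm_tri w u v : enorm (u - v) <= enorm (u - w) + enorm (w - v).
Proof. by rewrite (le_trans _ (ler_enormD _ _)) // addrA subrK. Qed.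

Lemma dotv_delta v i : dotv v (delta_mx 0 i) = v 0 i.
Proof.
rewrite /dotv (bigD1 i) //= mxE !eqxx mulr1 big1 ?addr0 // => j ji.
by rewrite mxE (negbTE ji) andbF mulr0.
Qed.

Lemma enorm_delta i : enorm (delta_mx 0 i : 'rV[R]_d) = 1.
Proof. by rewrite /enorm dotv_delta mxE !eqxx sqrtr1. Qed.

(** The topology comes from the sup norm; this lets all later estimates use Euclidean balls. *)
Lemma nbhs_enormP x (P : set 'rV[R]_d) :
  nbhs x P <-> exists2 e, 0 < e & forall y, enorm (y - x) < e -> P y.
Proof.
split=> [/nbhs_ballP[e /= e0 eP]|[e e0 eP]].
  exists e => // y yx; apply: eP; rewrite -ball_normE /= distrC.
  exact: le_lt_trans (ler_norm_enorm _) yx.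
apply/nbhs_ballP; exists (e / d.+1%:R) => /=; first by rewrite divr_gt0.
move=> y; rewrite -ball_normE /= distrC ltr_pdivlMr // mulrC => yx.
exact: eP (le_lt_trans (ler_enorm_norm _) yx).
Qed.

Lemma open_enorm (U : set 'rV[R]_d) x : open U -> U x ->
  exists2 e, 0 < e & forall y, enorm (y - x) < e -> U y.
Proof. by move=> oU Ux; apply/nbhs_enormP/open_nbhs_nbhs. Qed.

Lemma nonexpansive_continuous (f : 'rV[R]_d -> R) :
  (forall x y, f x <= f y + enorm (x - y)) -> continuous f.
Proof.
move=> fL x A /nbhs_ballP[e /= e0 eA]; apply/nbhs_enormP; exists e => // y yx.
apply: eA; rewrite /ball /= ltr_norml; have := fL x y.
have := fL y x; rewrite (enormC x y); lra.
Qed.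

Lemma enorm_sub_continuous x : continuous (fun y : 'rV[R]_d => enorm (y - x)).
Proof.
by apply: nonexpansive_continuous => y z; rewrite [leRHS]addrC enorm_tri.
Qed.

Lemma closed_sublevel (T : topologicalType) (f : T -> R) a :
  continuous f -> closed [set y | f y <= a].
Proof. by move=> /continuous_closedP/(_ _ (@closed_le R a)). Qed.

Lemma closed_superlevel (T : topologicalType) (f : T -> R) a :
  continuous f -> closed [set y | a <= f y].
Proof. by move=> /continuous_closedP/(_ _ (@closed_ge R a)). Qed.

(** * Differentiability as first-order approximation in the Euclidean norm *)

Section Differential.
Context {W : normedModType R}.
Implicit Types (f : 'rV[R]_d -> W).

Lemma diff_approx f x : differentiable f x -> forall e, 0 < e ->
  exists2 rho, 0 < rho & forall y, enorm (y - x) < rho ->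
    `|f y - f x - 'd f x (y - x)| <= e * enorm (y - x).
Proof.
move=> /diff_locallyP[_ /eqaddoP fo] e e0.
have /nbhs_enormP[rho rho0 H] := fo e e0.
exists rho => // y yx; have := H (y - x); rewrite subr0 => /(_ yx).
rewrite /= !fctE /= subrK opprD addrA => /le_trans; apply.
by rewrite ler_wpM2l ?(ltW e0) ?ler_norm_enorm.
Qed.

(** Converse of [diff_approx]. In finite dimension a linear [L] is automatically continuous, so a
    candidate derivative needs only the estimate. *)
Lemma approx_diff f x (L : {linear 'rV[R]_d -> W}) :
  (forall e, 0 < e -> exists2 rho, 0 < rho & forall y, enorm (y - x) < rho ->
    `|f y - f x - L (y - x)| <= e * enorm (y - x)) ->
  differentiable f x /\ ('d f x = L :> (_ -> _)).
Proof.
move=> H.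
have Lc : continuous L.
  apply: bounded_linear_continuous.
  apply/linear_boundedP.
  exists (\sum_(i < d) `|L (delta_mx 0 i)|); split=> [|k /ltW kL v]; first exact: num_real.
  rewrite [v in L v]row_sum_delta linear_sum.
  apply: le_trans (ler_norm_sum _ _ _) _.
  apply: (@le_trans _ _ (\sum_(i < d) `|v| * `|L (delta_mx 0 i)|)).
    by apply: ler_sum => i _; rewrite linearZ normrZ ler_wpM2r // ler_coord_norm.
  by rewrite -mulr_sumr mulrC ler_wpM2r.
have fo : f \o shift x = cst (f x) + L +o_ (0 : 'rV[R]_d) id.
  apply/eqaddoP => e e0.
  have [rho rho0 Hr] := H (e / d.+1%:R) (divr_gt0 e0 (ltr0Sn _ _)).
  apply/nbhs_enormP; exists rho => // y; rewrite subr0 => yr.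
  have := Hr (y + x); rewrite addrK => /(_ yr).
  rewrite /= !fctE /= opprD addrA => /le_trans; apply.
  by rewrite mulrAC -mulrA ler_wpM2l ?(ltW e0) // ler_pdivrMr // mulrC ler_enorm_norm.
have dE : 'd f x = L :> (_ -> _) by apply: diff_unique.
by split=> //; apply/diff_locallyP; rewrite dE.
Qed.

Lemma near_eq_diff f g x : (\near x, f x = g x) -> differentiable f x ->
  differentiable g x /\ ('d g x = 'd f x :> (_ -> _)).
Proof.
move=> fg df; apply: approx_diff => e e0.
have [rho rho0 H] := diff_approx df e0.
have /nbhs_enormP[rho' rho'0 fg'] := fg.
exists (Num.min rho rho'); first by rewrite lt_min rho0.
move=> y; rewrite lt_min => /andP[y1 y2].
by rewrite -!fg' ?H // subrr enorm0.
Qed.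

End Differential.
End EuclideanNorm.

Lemma diff_addE (R : realType) (V W : normedModType R) (f g : V -> W) x v :
  differentiable f x -> differentiable g x ->
  'd (fun y => f y + g y) x v = 'd f x v + 'd g x v.
Proof. by move=> df dg; rewrite -[fun y => _]/(f + g) (diffD df dg). Qed.

Lemma diff_subE (R : realType) (V W : normedModType R) (f g : V -> W) x v :
  differentiable f x -> differentiable g x ->
  'd (fun y => f y - g y) x v = 'd f x v - 'd g x v.
Proof. by move=> df dg; rewrite -[fun y => _]/(f - g) (diffB df dg). Qed.

Lemma diff_mulE (R : realType) (V : normedModType R) (f g : V -> R) x v :
  differentiable f x -> differentiable g x ->
  'd (fun y => f y * g y) x v = f x * 'd g x v + g x * 'd f x v.
Proof. by move=> df dg; rewrite -[fun y => _]/(f * g) (diffM df dg). Qed.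

Lemma diff_compE (R : realType) (U V W : normedModType R) (f : U -> V) (g : V -> W) x v :
  differentiable f x -> differentiable g (f x) ->
  'd (fun y => g (f y)) x v = 'd g (f x) ('d f x v).
Proof. by move=> df dg; rewrite -[fun y => _]/(g \o f) (diff_comp df dg). Qed.

Lemma diff_invE (R : realType) (V : normedModType R) (f : V -> R) x v :
  differentiable f x -> f x != 0 ->
  'd (fun y => (f y)^-1) x v = - (f x) ^- 2 * 'd f x v.
Proof. by move=> df f0; rewrite (diffV df f0). Qed.

Lemma linear_row_delta (R : realType) d (W : lmodType R) (L : {linear 'rV[R]_d -> W}) v :
  L v = \sum_b v 0 b *: L (delta_mx 0 b).
Proof.
by rewrite {1}[v]row_sum_delta linear_sum; apply: eq_bigr => b _; rewrite linearZ.
Qed.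

Lemma differentiable_entry (R : realType) m (V : normedModType R) (p : V -> 'rV[R]_m) x b :
  differentiable p x -> differentiable (fun y => p y 0 b) x.
Proof.
move=> dp; apply: (@differentiable_comp _ _ _ _ p (fun z : 'rV[R]_m => z 0 b)) => //.
exact: differentiable_coord.
Qed.

Lemma differentiable_rowP (R : realType) m (V : normedModType R) (p : V -> 'rV[R]_m) x :
  (forall b, differentiable (fun y => p y 0 b) x) ->
  differentiable p x.
Proof.
move=> dp; have -> : p = \sum_b (fun y => p y 0 b *: delta_mx 0 b).
  by apply/funext => y; rewrite fct_sumE [LHS]row_sum_delta.
by apply: differentiable_sum => b; apply: differentiableZl.
Qed.

Lemma diff_coord (R : realType) m (V : normedModType R) (p : V -> 'rV[R]_m) x v b :
    differentiable p x ->
  'd (fun y => p y 0 b) x v = 'd p x v 0 b.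
Proof.
move=> dp; pose h := fun z : 'rV[R]_m => z 0 b.
have dh := @differentiable_coord R 1 m (p x) 0 b.
rewrite (@diff_compE _ _ _ _ p h) //.
have hlin : linear h by move=> a u w; rewrite /h !mxE.
pose hM := GRing.isLinear.Build _ _ _ _ _ hlin.
pose L : {linear _ -> _} := HB.pack h hM.
by rewrite (@diff_lin _ _ _ L) //; exact: coord_continuous.
Qed.

(** * Functions whose derivatives stay in a class closed under sums and products *)

Section SmoothClass.
Context {R : realType} {d : nat} {I : Type}.
Variables (O : I -> set 'rV[R]_d) (B : (I -> 'rV[R]_d -> R) -> Prop).
Implicit Types (f g : I -> 'rV[R]_d -> R) (j : nat).

(** These are the closure properties that the sum and Leibniz rules consume. Inverses are left out
    on purpose: uniform boundedness is not stable under them. *)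
Record bound_class : Prop := BoundClass {
  bound_open : forall i, open (O i);
  bound_ext : forall f g, (forall i x, O i x -> f i x = g i x) -> B f -> B g;
  bound_cst : forall c, B (fun _ _ => c);
  bound_add : forall f g, B f -> B g -> B (fun i x => f i x + g i x);
  bound_mul : forall f g, B f -> B g -> B (fun i x => f i x * g i x) }.

(* The unit normal exists only locally, so a function built from it is a family
   over patches O i; B bounds such a family, uniformly in i when quantitative. *)
Fixpoint smooth j f : Prop :=
  B f /\ if j is j'.+1 then
    (forall i x, O i x -> differentiable (f i) x) /\
    forall v, smooth j' (fun i x => 'd (f i) x v)
  else True.

Hypothesis BC : bound_class.

Lemma smooth_bound j f : smooth j f -> B f.
Proof. by case: j => [|j] []. Qed.

Lemma smooth_ext j f g : (forall i x, O i x -> f i x = g i x) ->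
  smooth j f -> smooth j g.
Proof.
elim: j f g => [|j IH] f g fg [Bf Sf]; split; try exact: bound_ext fg Bf.
  by [].
have fgd i x : O i x ->
    differentiable (g i) x /\ ('d (g i) x = 'd (f i) x :> (_ -> _)).
  move=> Ox; apply: near_eq_diff; last exact: Sf.1.
  have : nbhs x (O i) by apply: open_nbhs_nbhs; split=> //; apply: bound_open.
  by apply: filterS => y /fg.
split=> [i x /fgd[]//|v].
by apply: IH (Sf.2 v) => i x Ox /=; rewrite (fgd i x Ox).2.
Qed.

Lemma smoothW j f : smooth j.+1 f -> smooth j f.
Proof.
elim: j f => [|j IH] f [Bf Sf]; split=> //.
by split=> [|v]; [exact: Sf.1|apply: IH; exact: Sf.2].
Qed.

Lemma smooth_leq j j' f : (j' <= j)%N -> smooth j f -> smooth j' f.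
Proof.
move=> /subnK <-; elim: (j - j')%N => [|n IH]; rewrite ?add0n ?addSn // => /smoothW.
exact: IH.
Qed.

Lemma smooth_diff j f : (0 < j)%N -> smooth j f ->
  forall i x, O i x -> differentiable (f i) x.
Proof. by case: j => // j _ [_ []]. Qed.

Lemma smoothD j f v : smooth j.+1 f -> smooth j (fun i x => 'd (f i) x v).
Proof. by move=> [_ [_]]; apply. Qed.

Lemma smooth_cst j c : smooth j (fun _ _ => c).
Proof.
elim: j c => [|j IH] c; split; try exact: bound_cst; first by [].
split=> [i x _|v]; first exact: differentiable_cst.
by apply: smooth_ext (IH 0) => i x _; rewrite diff_cst.
Qed.

Lemma smooth_add j f g : smooth j f -> smooth j g ->
  smooth j (fun i x => f i x + g i x).
Proof.
elim: j f g => [|j IH] f g [Bf Sf] [Bg Sg]; split; try exact: bound_add.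
  by [].
split=> [i x Ox|v]; first by apply: differentiableD; [apply: Sf.1|apply: Sg.1].
apply: smooth_ext (IH _ _ (Sf.2 v) (Sg.2 v)) => i x Ox /=.
by rewrite diff_addE //; [exact: Sf.1|exact: Sg.1].
Qed.

Lemma smooth_mul j f g : smooth j f -> smooth j g ->
  smooth j (fun i x => f i x * g i x).
Proof.
elim: j f g => [|j IH] f g sf sg; have [Bf Sf] := sf; have [Bg Sg] := sg.
  by split=> //; apply: bound_mul.
split; first exact: bound_mul.
split=> [i x Ox|v]; first by apply: differentiableM; [apply: Sf.1|apply: Sg.1].
apply: (@smooth_ext _ (fun i x => f i x * 'd (g i) x v + g i x * 'd (f i) x v)).
  by move=> i x Ox; rewrite diff_mulE //; [exact: Sf.1|exact: Sg.1].
by apply: smooth_add; apply: IH; [exact: smoothW|exact: Sg.2|exact: smoothW|exact: Sf.2].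
Qed.

Lemma smooth_opp j f : smooth j f -> smooth j (fun i x => - f i x).
Proof.
move=> sf; apply: smooth_ext (smooth_mul (smooth_cst j (-1)) sf) => i x _.
by rewrite mulN1r.
Qed.

Lemma smooth_sub j f g : smooth j f -> smooth j g ->
  smooth j (fun i x => f i x - g i x).
Proof. by move=> sf sg; apply: smooth_add => //; apply: smooth_opp. Qed.

Lemma smooth_sum (T : Type) (s : seq T) (P : pred T) j (F : T -> I -> 'rV[R]_d -> R) :
  (forall t, smooth j (F t)) -> smooth j (fun i x => \sum_(t <- s | P t) F t i x).
Proof.
move=> sF; elim: s => [|t s IH].
  by apply: smooth_ext (smooth_cst j 0) => i x _; rewrite big_nil.
have [Pt|Pt] := boolP (P t).
  by apply: smooth_ext (smooth_add (sF t) IH) => i x _; rewrite big_cons Pt.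
by apply: smooth_ext IH => i x _; rewrite big_cons (negbTE Pt).
Qed.

Lemma smooth_prod (T : Type) (s : seq T) (P : pred T) j (F : T -> I -> 'rV[R]_d -> R) :
  (forall t, smooth j (F t)) -> smooth j (fun i x => \prod_(t <- s | P t) F t i x).
Proof.
move=> sF; elim: s => [|t s IH].
  by apply: smooth_ext (smooth_cst j 1) => i x _; rewrite big_nil.
have [Pt|Pt] := boolP (P t).
  by apply: smooth_ext (smooth_mul (sF t) IH) => i x _; rewrite big_cons Pt.
by apply: smooth_ext IH => i x _; rewrite big_cons (negbTE Pt).
Qed.

Lemma smooth_det n j (A : I -> 'rV[R]_d -> 'M[R]_n) :
  (forall a b, smooth j (fun i x => A i x a b)) -> smooth j (fun i x => \det (A i x)).
Proof.
move=> sA; apply: smooth_sum => s; apply: smooth_mul; first exact: smooth_cst.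
by apply: smooth_prod => a.
Qed.

Lemma smooth_mulmx n j (A C : I -> 'rV[R]_d -> 'M[R]_n) :
  (forall a b, smooth j (fun i x => A i x a b)) ->
  (forall a b, smooth j (fun i x => C i x a b)) ->
  forall a b, smooth j (fun i x => (A i x *m C i x) a b).
Proof.
move=> sA sC a b.
apply: (@smooth_ext _ (fun i x => \sum_c A i x a c * C i x c b)).
  by move=> i x _; rewrite mxE.
by apply: smooth_sum => c; apply: smooth_mul.
Qed.

End SmoothClass.

(** * Existence of derivatives without bounds: roots, inverses, inverse matrices *)

Section SmoothTrue.
Context {R : realType} {d : nat} {I : Type}.
Variables (O : I -> set 'rV[R]_d).
Hypothesis oO : forall i, open (O i).
Implicit Types (f g : I -> 'rV[R]_d -> R) (j : nat).

(** With this class [smooth] says only that the derivatives exist, so inverses are allowed. *)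
Definition nobound (_ : I -> 'rV[R]_d -> R) := True.

Lemma nobound_class : bound_class O nobound.
Proof. by []. Qed.

Let NC := nobound_class.

Lemma diff_rsqrt (W : normedModType R) (f : W -> R) x : differentiable f x -> 0 < f x ->
  differentiable (fun y => (Num.sqrt (f y))^-1) x /\
  forall v, 'd (fun y => (Num.sqrt (f y))^-1) x v =
    - 2^-1 * (Num.sqrt (f x))^-1 ^+ 3 * 'd f x v.
Proof.
move=> df fx0; set s := Num.sqrt (f x).
have s0 : 0 < s by rewrite sqrtr_gt0.
have dsq : differentiable (Num.sqrt : R -> R) (f x).
  apply/derivable1_diffP; have := is_derive1_sqrt fx0; case=> //.
have dc : differentiable (fun y => Num.sqrt (f y)) x by apply: differentiable_comp.
have n0 : Num.sqrt (f x) != 0 by rewrite gt_eqF.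
split=> [|v]; first exact: differentiableV.
have E : forall h, 'd (Num.sqrt : R -> R) (f x) h = h * (2 * s)^-1.
  by move=> h; rewrite diff1E // derive1E derive_sqrt.
apply: (etrans (diff_invE v dc n0)).
apply: (etrans (congr1 _ (diff_compE v df dsq))).
have key (a b : R) : a != 0 -> - a ^- 2 * (b * (2 * a)^-1) = - 2^-1 * a^-1 ^+ 3 * b.
  by move=> a0; field.
by apply: (etrans (congr1 _ (E _))); exact: key.
Qed.

(** The function $g=f^{-1/2}$ satisfies $dg=-\frac12g^3\,df$, a polynomial in [g] and $df$, so the
    induction on the order closes. For $g=f^{-1}$ below the equation is $dg=-g^2\,df$. *)
Lemma smooth_rsqrt j f : (forall i x, O i x -> 0 < f i x) -> smooth O nobound j f ->
  smooth O nobound j (fun i x => (Num.sqrt (f i x))^-1).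
Proof.
move=> f0; elim: j => [//|j IH] sf; have [_ [df sdf]] := sf.
split=> //; split=> [i x Ox|v].
  by have [] := diff_rsqrt (df i x Ox) (f0 i x Ox).
pose g : I -> 'rV[R]_d -> R := fun i x => (Num.sqrt (f i x))^-1.
have sg : smooth O nobound j g by apply: IH; apply: smoothW sf.
apply: (@smooth_ext _ _ _ _ _ NC j (fun i (x : 'rV[R]_d) => - 2^-1 * (g i x * (g i x * g i x))
    * 'd (f i) x v)).
  move=> i x Ox; apply/esym/(etrans ((diff_rsqrt (df i x Ox) (f0 i x Ox)).2 v)).
  by rewrite !exprS expr0 mulr1.
apply: (smooth_mul NC); last exact: sdf.
apply: (smooth_mul NC); first exact: (smooth_cst NC).
by apply: (smooth_mul NC) => //; apply: (smooth_mul NC).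
Qed.

Lemma smooth_inv j f : (forall i x, O i x -> f i x != 0) -> smooth O nobound j f ->
  smooth O nobound j (fun i x => (f i x)^-1).
Proof.
move=> f0; elim: j => [//|j IH] sf; have [_ [df sdf]] := sf.
split=> //; split=> [i x Ox|v]; first by apply: differentiableV; [apply: df|apply: f0].
pose g : I -> 'rV[R]_d -> R := fun i x => (f i x)^-1.
have sg : smooth O nobound j g by apply: IH; apply: smoothW sf.
apply: (@smooth_ext _ _ _ _ _ NC j (fun i (x : 'rV[R]_d) => -1 * (g i x * g i x) * 'd (f i) x v)).
  move=> i x Ox; rewrite (diff_invE v (df i x Ox) (f0 i x Ox)).
  by rewrite mulN1r -exprVn expr2.
apply: (smooth_mul NC); last exact: sdf.
apply: (smooth_mul NC); first exact: (smooth_cst NC).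
exact: (smooth_mul NC).
Qed.

(** Cramer's rule: each entry is a cofactor divided by the determinant. *)
Lemma smooth_invmx n j (A : I -> 'rV[R]_d -> 'M[R]_n) :
  (forall i x, O i x -> A i x \in unitmx) ->
  (forall a b, smooth O nobound j (fun i x => A i x a b)) ->
  forall a b, smooth O nobound j (fun i x => invmx (A i x) a b).
Proof.
move=> uA sA a b.
apply: (@smooth_ext _ _ _ _ _ NC j (fun i (x : 'rV[R]_d) => (\det (A i x))^-1 *
   ((-1) ^+ (b + a) * \det (row' b (col' a (A i x)))))).
  by move=> i x Ox; rewrite /invmx uA // mxE mxE.
apply: (smooth_mul NC) => //.
  apply: smooth_inv; last exact: (smooth_det NC).
  by move=> i x Ox; have := uA i x Ox; rewrite unitmxE unitfE.
apply: (smooth_mul NC) => //; first exact: (smooth_cst NC).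
apply: (smooth_det NC) => // a' b'.
apply: (@smooth_ext _ _ _ _ _ NC j (fun i (x : 'rV[R]_d) => A i x (lift b a') (lift a b'))) => //.
by move=> i x _; rewrite !mxE.
Qed.

End SmoothTrue.

Section SmoothComp.
Context {R : realType} {d : nat} {I : Type}.
Variables (O W : I -> set 'rV[R]_d).
Hypothesis oO : forall i, open (O i).
Implicit Types (f : I -> 'rV[R]_d -> R) (p : I -> 'rV[R]_d -> 'rV[R]_d) (j : nat).

(** A derivative of the composite is a sum of products of a derivative of a coordinate of [p] with a
    partial derivative of [f] composed with [p]. The induction therefore replaces [f] by its partial
    derivatives and keeps [p]. *)
Lemma smooth_comp j f p :
  (forall i x, O i x -> W i (p i x)) ->
  (forall b, smooth O nobound j (fun i x => p i x 0 b)) ->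
  smooth W nobound j f -> smooth O nobound j (fun i x => f i (p i x)).
Proof.
move=> OW; elim: j f => [//|j IH] f sp sf.
have dp i x : O i x -> differentiable (p i) x.
  by move=> Ox; apply: differentiable_rowP => b; apply: (smooth_diff _ (sp b)).
have df := smooth_diff (ltn0Sn j) sf.
have NC := nobound_class oO.
split=> //; split=> [i x Ox|v].
  by apply: (@differentiable_comp _ _ _ _ (p i) (f i)); [apply: dp|apply: df; apply: OW].
apply: (@smooth_ext _ _ _ _ _ NC j (fun i (x : 'rV[R]_d) => \sum_b 'd (fun y => p i y 0 b) x v
    * 'd (f i) (p i x) (delta_mx 0 b))).
  move=> i x Ox; apply/esym.
  apply: (etrans (@diff_compE _ _ _ _ (p i) (f i) x v (dp i x Ox) (df i _ (OW _ _ Ox)))).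
  apply: (etrans (linear_row_delta _ _)); apply: eq_bigr => b _.
  by congr (_ * _); apply/esym/diff_coord/dp.
apply: (smooth_sum NC) => // b; apply: (smooth_mul NC) => //; first exact: smoothD.
apply: (IH (fun i x => 'd (f i) x (delta_mx 0 b))); last exact: smoothD.
by move=> b'; apply: smoothW; apply: sp.
Qed.

End SmoothComp.

(** * Distance and nearest points in a tube of unique projection *)

Section Reach.
Context {R : realType} {d : nat}.
Variable (M : set 'rV[R]_d).
Hypothesis M0 : M !=set0.
Implicit Types (x y xi eta u : 'rV[R]_d) (e s : R).

Local Notation delta x := (setdist x M).
Local Notation p := (nearest_point M).

Lemma setdist_lb x c : (forall xi, M xi -> c <= enorm (x - xi)) -> c <= delta x.
Proof.
move=> H; apply: lb_le_inf => [|_ [xi Mxi <-]]; last exact: H.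
by have [xi Mxi] := M0; exists (enorm (x - xi)), xi.
Qed.

Lemma setdist_ge0 x : 0 <= delta x.
Proof. by apply: setdist_lb => xi _; exact: enorm_ge0. Qed.

Lemma setdist_le x xi : M xi -> delta x <= enorm (x - xi).
Proof.
move=> Mxi; apply: ge_inf; last by exists xi.
by exists 0 => _ [eta _ <-]; exact: enorm_ge0.
Qed.

Lemma setdist_lip x y : delta x <= delta y + enorm (x - y).
Proof.
rewrite -lerBlDr; apply: setdist_lb => xi Mxi.
rewrite lerBlDr (le_trans (setdist_le x Mxi)) // [leRHS]addrC.
exact: enorm_tri.
Qed.

Lemma setdist_continuous : continuous (fun x => delta x).
Proof. by apply: nonexpansive_continuous; exact: setdist_lip. Qed.

Lemma setdist_mem x : M x -> delta x = 0.
Proof.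
by move=> Mx; apply/eqP; rewrite eq_le setdist_ge0 (le_trans (setdist_le x Mx)) // subrr enorm0.
Qed.

Lemma open_tube e : open (tube M e).
Proof.
rewrite openE => x; rewrite /tube /= => xe; apply/nbhs_enormP.
exists (e - delta x) => [|y]; first by rewrite subr_gt0.
rewrite /tube /=; have := setdist_lip y x; lra.
Qed.

Lemma nearest_pointP x : unpp M x -> M (p x) /\ enorm (x - p x) = delta x.
Proof. by move=> [xi [nxi _]]; apply: (@getPex _ (nearest M x)); exists xi. Qed.

Lemma nearest_point_unique x xi : unpp M x -> M xi -> enorm (x - xi) <= delta x ->
  p x = xi.
Proof.
move=> ux Mxi xix; have nxi : nearest M x xi.
  by split=> //; apply/eqP; rewrite eq_le xix setdist_le.
have [zeta [_ uz]] := ux.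
by rewrite -(uz _ nxi) -(uz _ (nearest_pointP ux)).
Qed.

Lemma enorm_compact x s : compact [set y : 'rV[R]_d | enorm (y - x) <= s].
Proof.
apply: bounded_closed_compact.
  exists (s + enorm x); split; first exact: num_real.
  move=> k k0 y /= yx; apply: le_trans (ler_norm_enorm _) _.
  rewrite ltW // (le_lt_trans _ k0) // -[y](subrK x).
  by rewrite (le_trans (ler_enormD _ _)) // lerD2r.
by apply: closed_sublevel; exact: enorm_sub_continuous.
Qed.

Variable r : R.
Hypotheses (r0 : 0 < r) (rM : tube M r `<=` unpp M).

Lemma nearest_pointM x : tube M r x -> M (p x).
Proof. by move=> /rM /nearest_pointP[]. Qed.

Lemma nearest_point_dist x : tube M r x -> enorm (x - p x) = delta x.
Proof. by move=> /rM /nearest_pointP[]. Qed.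

Lemma tube_mem x : M x -> tube M r x.
Proof. by move=> Mx; rewrite /tube /= setdist_mem. Qed.

Lemma nearest_point_id x : M x -> p x = x.
Proof.
move=> Mx; apply: nearest_point_unique => //; first by apply/rM/tube_mem.
by rewrite subrr enorm0 setdist_ge0.
Qed.

(** Such a point lies in the tube, hence has a nearest point in [M], which is at distance 0. This
    makes [M] closed. *)
Lemma setdist0 x : delta x = 0 -> M x.
Proof.
move=> x0; have tx : tube M r x by rewrite /tube /= x0.
have /eqP := nearest_point_dist tx; rewrite x0 enorm_eq0 subr_eq0 => /eqP ->.
exact: nearest_pointM.
Qed.

Lemma closed_reach : closed M.
Proof.
have -> : M = [set x | delta x <= 0].
  apply/seteqP; split=> x /= => [Mx|x0]; first by rewrite setdist_mem.
  by apply: setdist0; apply/eqP; rewrite eq_le x0 setdist_ge0.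
by apply: closed_sublevel; exact: setdist_continuous.
Qed.

(** By compactness and uniqueness of [p x], the points of [M] that are at least [e] away from [p x]
    keep a distance [m > delta x] from [x]. But [p y] is within [delta x + 2 * enorm (y - x)] of
    [x], which is below [m] for [y] close to [x]. *)
Lemma nearest_point_continuous x e : tube M r x -> 0 < e ->
  exists2 rho, 0 < rho & forall y, enorm (y - x) < rho -> tube M r y ->
    enorm (p y - p x) < e.
Proof.
move=> tx e0.
(* The radius [delta x + 2] is large enough to contain [p y] whenever [enorm (y - x) < 1]. *)
pose K := [set eta | [/\ M eta, enorm (eta - x) <= delta x + 2 & e <= enorm (eta - p x)]].
have cK : compact K.
  apply: (@subclosed_compact _ _ [set y | enorm (y - x) <= delta x + 2]).
  - have -> : K = M `&` ([set y | enorm (y - x) <= delta x + 2] `&`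
        [set y | e <= enorm (y - p x)]).
      by apply/seteqP; split=> y; [case|case=> ? []].
    apply: closedI; first exact: closed_reach.
    apply: closedI; first exact: compact_closed (@enorm_compact _ _).
    by apply: closed_superlevel; exact: enorm_sub_continuous.
  - exact: enorm_compact.
  - by move=> y [].
have [m mx Km] : exists2 m, delta x < m & forall eta, K eta -> m <= enorm (eta - x).
  have [->|/set0P K0] := eqVneq K set0.
    by exists (delta x + 1); rewrite ?ltrDl.
  have [|c] := @EVT_min_rV R d (fun y => enorm (y - x)) K K0 cK.
    by apply: continuous_subspaceT; exact: enorm_sub_continuous.
  rewrite inE => -[Mc _ ec] cmin; exists (enorm (c - x)); last first.
    by move=> eta Keta; apply: cmin; rewrite inE.
  rewrite ltNge; apply/negP => cx; move: ec.
  have -> : p x = c by apply: nearest_point_unique (rM tx) Mc _; rewrite enormC.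
  by rewrite subrr enorm0 leNgt e0.
exists (Num.min 1 ((m - delta x) / 2)).
  by rewrite lt_min ltr01 divr_gt0 ?subr_gt0.
move=> y; rewrite lt_min => /andP[y1 y2] ty.
rewrite ltNge; apply/negP => epy.
have pyx : enorm (p y - x) <= delta x + 2 * enorm (y - x).
  have := enorm_tri y (p y) x; rewrite (enormC (p y) y) nearest_point_dist //.
  have := setdist_lip y x; lra.
have : m <= enorm (p y - x).
  by apply: Km; split=> //; [exact: nearest_pointM|lra].
lra.
Qed.

(* Off M the distance has gradient (x - p x) / delta x of norm 1, by continuity of p. *)
Lemma setdist_growth y c rho : tube M r y -> 0 < delta y -> 0 <= c -> c < 1 -> 0 < rho ->
  exists z h, [/\ 0 < h, h < rho, enorm (z - y) <= h & delta y + c * h < delta z].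
Proof.
move=> ty D0 c0 c1 rho0; set D := delta y in D0 *.
(* Tolerance for the movement of the nearest point. It keeps the squared distance of [z] from [M] at
   least $D^2+(1+c)hD+h^2$, which exceeds $(D+ch)^2$. *)
have e0 : 0 < (1 - c) * D / 2 by rewrite divr_gt0 // mulr_gt0 // subr_gt0.
have [rho1 rho10 H1] := nearest_point_continuous ty e0.
have [rho2 rho20 H2] := open_enorm (@open_tube r) ty.
pose m := Num.min rho (Num.min rho1 rho2).
have m0 : 0 < m by rewrite !lt_min rho0 rho10.
pose h := m / 2; have h0 : 0 < h by rewrite divr_gt0.
have hm : h < m by rewrite /h; lra.
have [hr [h1 h2]] : h < rho /\ h < rho1 /\ h < rho2.
  by move: hm; rewrite !lt_min => /andP[-> /andP[-> ->]].
have [|u u1 yu] := @enorm_polar _ _ (y - p y).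
  by rewrite -enorm_eq0 nearest_point_dist // gt_eqF.
rewrite nearest_point_dist // -/D in yu.
exists (y + h *: u), h.
have zy : enorm (y + h *: u - y) = h by rewrite addrC addKr enormZ u1 mulr1 ger0_norm ?ltW.
split=> //; first by rewrite zy.
set z := y + h *: u.
have tz : tube M r z by apply: H2; rewrite zy.
have pz : enorm (p z - p y) < (1 - c) * D / 2 by apply: H1; rewrite ?zy.
rewrite ltNge; apply/negP => zle.
have zge0 := setdist_ge0 z.
have zz : delta z ^+ 2 <= (D + c * h) ^+ 2.
  exact: ler_wsqr.
have := zz; rewrite -(nearest_point_dist tz) sqr_enorm.
have -> : z - p z = (y - p z) + h *: u by rewrite addrAC.
have [w wE] : exists w, y - p z = w by exists (y - p z).
rewrite wE.
rewrite !dotvE -(sqr_enorm u) u1 (dotvC u) => zz'.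
have yz : D ^+ 2 <= dotv w w.
  rewrite -sqr_enorm -wE; apply: ler_wsqr; first exact: ltW.
  by apply: setdist_le; exact: nearest_pointM.
have uy : D - (1 - c) * D / 2 <= dotv w u.
  have -> : w = D *: u - (p z - p y) by rewrite -yu -wE opprB addrA subrK.
  have := CauchySchwarz_le (p z - p y) u; rewrite u1.
  by rewrite [dotv (_ - (_ - _)) u]dotvBl dotvZl -sqr_enorm u1; lra.
have hc : 0 <= (1 - c ^+ 2) * h ^+ 2.
  by rewrite mulr_ge0 ?sqr_ge0 // subr_ge0 expr_le1 // ltW.
have h3 : 0 < h * ((1 - c) * D) by rewrite mulr_gt0 // mulr_gt0 // subr_gt0.
have h4 : h * (D - (1 - c) * D / 2) <= h * dotv w u by rewrite ler_pM2l.
nra.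
Qed.

(* Maximizing delta - c |. - x1| over a small ball with c < 1 forces the maximum
   onto the sphere; with c -> 1 the maximizer of delta must continue the ray. *)
Lemma ray_extend xi u sg : M xi -> enorm u = 1 -> 0 < sg -> sg < r ->
  delta (xi + sg *: u) = sg ->
  exists2 s, 0 < s & delta (xi + (sg + s) *: u) = sg + s.
Proof.
move=> Mxi u1 sg0 sgr dsg; set x1 := xi + sg *: u in dsg.
(* The ball of radius [s] about [x1] stays off [M] and inside the [r]-tube, as [setdist_growth]
   requires. *)
pose s := Num.min sg (r - sg) / 2.
have m0 : 0 < Num.min sg (r - sg) by rewrite lt_min sg0 subr_gt0.
have s0 : 0 < s by rewrite divr_gt0.
have [s1 s2] : s < sg /\ s < r - sg.
  have : s < Num.min sg (r - sg) by rewrite /s; lra.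
  by rewrite lt_min => /andP[].
exists s => //.
pose K := [set y : 'rV[R]_d | enorm (y - x1) <= s].
have K0 : K !=set0 by exists x1; rewrite /K /= subrr enorm0 ltW.
have Kc : compact K := @enorm_compact x1 s.
have ncont := @enorm_sub_continuous R d x1.
have [|ym] := EVT_max_rV K0 Kc (f := fun y => delta y).
  by apply: continuous_subspaceT; exact: setdist_continuous.
rewrite inE => Kym ymax.
have grow c : 0 <= c -> c < 1 -> sg + c * s <= delta ym.
  move=> c0 c1.
  have [|y] := EVT_max_rV K0 Kc (f := fun y => delta y - c * enorm (y - x1)).
    apply: continuous_subspaceT => y.
    exact: (cvgB (setdist_continuous (x := y)) (cvgM (cvg_cst c) (ncont y))).
  rewrite inE => Ky ymx.
  have yx1 : sg <= delta y - c * enorm (y - x1).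
    have := ymx x1; rewrite inE /K /= subrr enorm0 mulr0 subr0 dsg; apply; exact: ltW.
  have ty : tube M r y.
    by rewrite /tube /=; have := setdist_lip y x1; move: Ky; rewrite /K /=; lra.
  have dy0 : 0 < delta y.
    by have := setdist_lip x1 y; move: Ky; rewrite /K /= (enormC x1); lra.
  have [lt|ge] := ltP (enorm (y - x1)) s.
    have lt0 : 0 < s - enorm (y - x1) by rewrite subr_gt0.
    have [z [h [h0 hs zy dz]]] := setdist_growth ty dy0 c0 c1 lt0.
    have zx := enorm_tri y z x1.
    have : delta z - c * enorm (z - x1) <= delta y - c * enorm (y - x1).
      by apply: ymx; rewrite inE /K /=; lra.
    have : c * enorm (z - x1) <= c * (enorm (y - x1) + h) by rewrite ler_wpM2l //; lra.
    lra.
  have : delta y <= delta ym by apply: ymax; rewrite inE.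
  have : c * s <= c * enorm (y - x1) by rewrite ler_wpM2l.
  lra.
have dym : sg + s <= delta ym.
  have g0 := grow 0 (lexx _) ltr01.
  rewrite leNgt; apply/negP => lt.
  (* This [c] is the midpoint between 1 and the ratio [(delta ym - sg) / s], which [lt] puts below
     1; [grow] at this [c] exceeds [delta ym]. *)
  have c0 : 0 <= (delta ym - sg) / s / 2 + 2^-1.
    by rewrite addr_ge0 // divr_ge0 // divr_ge0 ?(ltW s0) //; lra.
  have c1 : (delta ym - sg) / s / 2 + 2^-1 < 1.
    have : (delta ym - sg) / s < 1 by rewrite ltr_pdivrMr // mul1r; lra.
    lra.
  have := grow _ c0 c1.
  have -> : ((delta ym - sg) / s / 2 + 2^-1) * s = (delta ym - sg) / 2 + s / 2 by field;
      rewrite gt_eqF.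
  lra.
(* Equality case of the triangle inequality: [ym] is within [s] of [x1], yet at distance at least
   [sg + s] from [xi]. *)
have ymE : ym = xi + (sg + s) *: u.
  have [w wE] : exists w, ym - x1 = w by exists (ym - x1).
  have yw : ym - xi = w + sg *: u by rewrite -wE /x1 opprD addrA addrNK.
  have w2 : dotv w w <= s ^+ 2.
    by rewrite -sqr_enorm -wE; apply: ler_wsqr; rewrite ?enorm_ge0.
  have : (sg + s) ^+ 2 <= dotv (ym - xi) (ym - xi).
    rewrite -sqr_enorm; apply: ler_wsqr; first by rewrite addr_ge0 // ltW.
    by rewrite (le_trans dym) // setdist_le.
  rewrite yw !dotvE -(sqr_enorm u) u1 (dotvC u) => h1.
  have h2 : sg * s <= sg * dotv w u by lra.
  rewrite ler_pM2l // in h2.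
  have h3 : s * s <= s * dotv w u by rewrite ler_pM2l.
  have : enorm (w - s *: u) ^+ 2 <= 0.
    by rewrite sqr_enorm !dotvE -(sqr_enorm u) u1 (dotvC u); lra.
  rewrite exprn_even_le0 //= enorm_eq0 subr_eq0 => /eqP ws.
  by rewrite -[ym](subrK xi) yw ws -scalerDl addrC [s + _]addrC.
apply/eqP; rewrite eq_le -ymE dym andbT ymE (le_trans (setdist_le _ Mxi)) //.
by rewrite addrC addKr enormZ u1 mulr1 ger0_norm // addr_ge0 ?ltW.
Qed.

Lemma ray_dist_le xi u s : M xi -> enorm u = 1 -> 0 <= s -> delta (xi + s *: u) <= s.
Proof.
move=> Mxi u1 s0; rewrite (le_trans (setdist_le _ Mxi)) //.
by rewrite addrC addKr enormZ u1 mulr1 ger0_norm.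
Qed.

Lemma ray_lip xi u s t : enorm u = 1 -> s <= t ->
  delta (xi + t *: u) <= delta (xi + s *: u) + (t - s) /\
  delta (xi + s *: u) <= delta (xi + t *: u) + (t - s).
Proof.
move=> u1 st.
have E : enorm (xi + t *: u - (xi + s *: u)) = t - s.
  rewrite opprD addrACA subrr add0r -scalerBl enormZ u1 mulr1 ger0_norm //.
  by rewrite subr_ge0.
by split; rewrite -E; [|rewrite enormC]; exact: setdist_lip.
Qed.

(** Continuation argument. The distance grows at most at unit speed, so once it falls short of the
    parameter at [s0] it does so ever after; the good parameters thus have a supremum [T <= s0]. By
    the Lipschitz property [T] is good itself, and [ray_extend] goes beyond it. *)
Lemma ray_dist xi u sg : M xi -> enorm u = 1 -> 0 < sg -> sg < r ->
  delta (xi + sg *: u) = sg ->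
  forall s, 0 <= s -> s < r -> delta (xi + s *: u) = s.
Proof.
move=> Mxi u1 sg0 sgr dsg s0 s00 s0r; apply/eqP; rewrite eq_le ray_dist_le //=.
rewrite leNgt; apply/negP => lt0.
pose S := [set s | 0 <= s /\ s <= delta (xi + s *: u)].
have Sub : ubound S s0.
  move=> s [s1 s2]; rewrite leNgt; apply/negP => s0s.
  have [_] := ray_lip xi u1 (ltW s0s); have [] := ray_lip xi u1 (ltW s0s); lra.
have hS : has_sup S by split; [exists sg; split; [exact: ltW|rewrite dsg]|exists s0].
pose T := sup S.
have sgT : sg <= T.
  by apply: sup_upper_bound => //; split; [exact: ltW|rewrite dsg].
have Ts0 : T <= s0 by apply: sup_le_ub => //; have [] := hS.
have dT : delta (xi + T *: u) = T.
  apply/eqP; rewrite eq_le ray_dist_le //=; last exact: le_trans (ltW sg0) sgT.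
  rewrite leNgt; apply/negP => lt.
  have e0 : 0 < (T - delta (xi + T *: u)) / 2 by rewrite divr_gt0 // subr_gt0.
  have [a [a0 aS] aT] := sup_adherent e0 hS.
  have aT' : a <= T by apply: sup_upper_bound.
  have [_] := ray_lip xi u1 aT'; rewrite -/T in aT *; lra.
have T0 : 0 < T by rewrite (lt_le_trans sg0).
have Tr : T < r by rewrite (le_lt_trans Ts0).
have [s s1 ds] := ray_extend Mxi u1 T0 Tr dT.
have : T + s <= T.
  by apply: sup_upper_bound => //; split; rewrite ?ds // ltW // addr_gt0.
lra.
Qed.

(** The open ball of radius [s] about [xi + s *: u] misses [M]: expand $\|su-(\eta-\xi)\|^2\ge
    s^2$. *)
Lemma ray_curvature xi u s eta : M xi -> enorm u = 1 ->
  delta (xi + s *: u) = s -> 0 <= s -> M eta ->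
  2 * s * dotv u (eta - xi) <= enorm (eta - xi) ^+ 2.
Proof.
move=> Mxi u1 ds s0 Meta.
have : s ^+ 2 <= enorm (xi + s *: u - eta) ^+ 2.
  by apply: ler_wsqr => //; rewrite -{1}ds setdist_le.
have -> : xi + s *: u - eta = s *: u - (eta - xi) by rewrite opprB addrCA addrA.
move: (eta - xi) => w.
by rewrite !sqr_enorm !dotvE -(sqr_enorm u) u1 (dotvC w u); lra.
Qed.

(** Federer's inequality: [ray_curvature] in the direction of [x - p x], multiplied by [delta x]. In
    this form it also covers [x] in [M], where the direction is undefined. *)
Lemma nearest_point_curvature x s eta : tube M r x -> 0 <= s -> s < r -> M eta ->
  2 * s * dotv (x - p x) (eta - p x) <= delta x * enorm (eta - p x) ^+ 2.
Proof.
move=> tx s0 sr Meta.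
have [x0|x0] := eqVneq (delta x) 0.
  have /eqP := nearest_point_dist tx; rewrite x0 enorm_eq0 => /eqP ->.
  by rewrite dotv0l mulr0 mul0r.
have D0 : 0 < delta x by rewrite lt_def x0 setdist_ge0.
have [|u u1 xu] := @enorm_polar _ _ (x - p x).
  by rewrite -enorm_eq0 nearest_point_dist.
rewrite nearest_point_dist // in xu.
have dx : delta (p x + delta x *: u) = delta x by rewrite -xu addrC subrK.
have Mpx := nearest_pointM tx.
have := ray_curvature Mpx u1 (ray_dist Mpx u1 D0 tx dx s0 sr) s0 Meta.
by rewrite xu dotvZl mulrCA ler_pM2l.
Qed.

(** Adding the two curvature inequalities between [p x] and [p y] gives
    $(2s-2\varepsilon)\|P\|^2\le2s\,h\cdot P$ with $P=p(x)-p(y)$ and $h=x-y$; Cauchy-Schwarz does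
    the rest. *)
Lemma nearest_point_lipschitz eps x y : 0 < eps -> eps < r ->
  tube M eps x -> tube M eps y ->
  (r - eps) * enorm (p x - p y) <= (r + eps) * enorm (x - y).
Proof.
move=> e0 er tx ty.
have [tx' ty'] : tube M r x /\ tube M r y by rewrite /tube /= !(lt_trans _ er).
(* Any [s] strictly between [eps] and [r] would give a Lipschitz bound; the midpoint turns
   $2s-2\varepsilon$ and $2s$ into [r - eps] and [r + eps]. *)
pose s := (r + eps) / 2.
have [s0 sr] : 0 <= s /\ s < r by rewrite /s; lra.
have H1 := nearest_point_curvature tx' s0 sr (nearest_pointM ty').
have H2 := nearest_point_curvature ty' s0 sr (nearest_pointM tx').
have [P PE] : exists P, p x - p y = P by exists (p x - p y).
have [h hE] : exists h, x - y = h by exists (x - y).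
have E1 : p y - p x = - P by rewrite -PE opprB.
rewrite E1 enormN dotvNr in H1; rewrite PE in H2 *; rewrite hE.
have E2 : x - p x = (y - p y) + (h - P).
  by rewrite -hE -PE; apply/rowP => i; rewrite !mxE; ring.
rewrite E2 dotvDl [dotv (h - P) P]dotvBl -(sqr_enorm P) in H1.
have n2 : 0 <= enorm P ^+ 2 by rewrite exprn_ge0 ?enorm_ge0.
have k1 : delta x * enorm P ^+ 2 <= eps * enorm P ^+ 2 by rewrite ler_wpM2r // ltW.
have k2 : delta y * enorm P ^+ 2 <= eps * enorm P ^+ 2 by rewrite ler_wpM2r // ltW.
have CS := CauchySchwarz_le h P.
have k3 : (r + eps) * dotv h P <= (r + eps) * (enorm h * enorm P).
  by rewrite ler_wpM2l // addr_ge0 ?(ltW r0) ?(ltW e0).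
have : enorm P * ((r - eps) * enorm P) <= enorm P * ((r + eps) * enorm h).
  by rewrite /s in H1 H2; nra.
have [->|P0] := eqVneq (enorm P) 0.
  by move=> _; rewrite mulr0 mulr_ge0 ?enorm_ge0 // addr_ge0 ?(ltW r0) ?(ltW e0).
by rewrite ler_pM2l // lt_def P0 enorm_ge0.
Qed.

End Reach.

(** The head of the list is the last derivative taken. Splitting off the end exposes the first one,
    so that inductions can replace [f] by its derivative. *)
Lemma iterD_rcons (R : realType) (V W : normedModType R) (f : V -> W) (vs : seq V) (v : V) :
  iterD f (rcons vs v) = iterD (fun x => 'd f x v) vs.
Proof.
elim: vs => [//|w vs IH]; rewrite rcons_cons.
by apply/funext => x; rewrite -[LHS]/('d (iterD f (rcons vs v)) x w) IH.
Qed.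

Lemma times_differentiableS (R : realType) (V W : normedModType R) (f : V -> W) j (U : set V) :
  times_differentiable j.+1 U f <->
  (forall x, U x -> differentiable f x) /\
  (forall v, times_differentiable j U (fun x => 'd f x v)).
Proof.
split=> [H|[H1 H2]].
  split=> [|v vs vsj]; first exact: (H [::]).
  by rewrite -iterD_rcons; apply: H; rewrite size_rcons.
case/lastP => [|vs v]; first by move=> _; exact: H1.
by rewrite size_rcons iterD_rcons => vsj; exact: H2.
Qed.

Lemma near_eq_continuous (T U : topologicalType) (f g : T -> U) x :
  (\near x, f x = g x) -> {for x, continuous f} -> {for x, continuous g}.
Proof.
move=> fg cf; have E : f x = g x by exact: nbhs_singleton fg.
have {}cf : f @ x --> g x by rewrite -E.
by apply: cvg_trans cf; apply: near_eq_cvg; apply: filterS fg => y ->.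
Qed.

(** * Local unit normals obtained from charts *)

Section Charts.
Context {R : realType} {d : nat}.
Implicit Types (M U V W : set 'rV[R]_d) (x y xi eta v w : 'rV[R]_d).

Definition smooth1 U j (f : 'rV[R]_d -> R) :=
  smooth (fun _ : unit => U) (@nobound R d unit) j (fun _ => f).

Lemma smooth1_diff U j (f : 'rV[R]_d -> R) : (0 < j)%N -> smooth1 U j f ->
  forall x, U x -> differentiable f x.
Proof. by move=> j0 sf x Ux; exact: (smooth_diff j0 sf (i := tt)). Qed.

Lemma smooth1D U j (f : 'rV[R]_d -> R) v : smooth1 U j.+1 f ->
  smooth1 U j (fun x => 'd f x v).
Proof. exact: smoothD. Qed.

Lemma times_differentiable_smooth U j (f : 'rV[R]_d -> 'rV[R]_d) : open U ->
  times_differentiable j U f -> forall b, smooth1 U j (fun x => f x 0 b).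
Proof.
move=> oU; have NC : bound_class (fun _ : unit => U) nobound by apply: nobound_class.
elim: j f => [//|j IH] f /times_differentiableS[df Df] b.
split=> //; split=> [_ x Ux|v].
  by apply: differentiable_entry; exact: df.
apply: (smooth_ext NC _ (IH _ (Df v) b)) => _ x Ux.
by apply/esym/diff_coord/df.
Qed.

Lemma differentiable_lipschitz_at (f : 'rV[R]_d -> R) x : differentiable f x ->
  exists C rho, [/\ 0 <= C, 0 < rho & forall y, enorm (y - x) < rho ->
    `|f y - f x| <= C * enorm (y - x)].
Proof.
move=> df; have [rho rho0 H] := diff_approx df ltr01.
have [k k0 Hk] := linear_lipschitz (diff_continuous df).
exists (k + 1), rho; split=> //; first by rewrite addr_ge0 // ltW.
move=> y yx; rewrite -[f y - f x](subrK ('d f x (y - x))) mulrDl addrC.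
apply: le_trans (ler_normD _ _) _; apply: lerD; last exact: H.
apply: le_trans (Hk _) _; rewrite ler_wpM2l ?ler_norm_enorm //; exact: ltW.
Qed.

Lemma differentiable_affine (w y : 'rV[R]_d) (t : R) :
  differentiable (fun t : R => t *: w + y) t /\
  forall s, 'd (fun t : R => t *: w + y) t s = s *: w.
Proof.
have H : is_diff t (fun t : R => t *: w + y) (fun s => s *: w).
  by apply: is_diff_eq; rewrite addr0.
by split=> [|s]; [exact: ex_diff|rewrite diff_val].
Qed.

Lemma segment_mvt (f : 'rV[R]_d -> R) x (v : 'rV[R]_d) :
  (forall t : R, 0 <= t <= 1 -> differentiable f (t *: v + x)) ->
  exists2 t : R, 0 <= t <= 1 & f (v + x) - f x = 'd f (t *: v + x) v.
Proof.
move=> df.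
have dg (t : R) : 0 <= t <= 1 -> is_derive t 1 (fun t : R => f (t *: v + x)) ('d f (t *: v + x) v).
  move=> t01; have [da Ea] := differentiable_affine v x t.
  have dg : differentiable (fun t : R => f (t *: v + x)) t.
    by apply: (@differentiable_comp _ _ _ _ (fun t : R => t *: v + x) f) => //; exact: df.
  apply: DeriveDef; first exact: diff_derivable.
  rewrite deriveE //; apply: (etrans (diff_compE _ da (df _ t01))).
  by rewrite Ea scale1r.
have [t t01|t|t t01] := @MVT R (fun t : R => f (t *: v + x)) (fun t : R => 'd f (t *: v + x) v)
    0 1 ltr01.
- by apply: dg; move: t01; rewrite in_itv /= => /andP[/ltW -> /ltW ->].
- apply: continuous_in_subspaceT => s; rewrite inE /= in_itv /= => s01.
  apply: differentiable_continuous; apply/derivable1_diffP.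
  by have [] := dg s s01.
rewrite scale1r scale0r add0r subr0 mulr1 => ->; exists t => //.
by move: t01; rewrite in_itv /= => /andP[/ltW -> /ltW ->].
Qed.

(** Near [xi], [M] leaves the hyperplane orthogonal to [nu] only to second order. For a unit vector
    [nu] this makes small balls tangent to that hyperplane at [xi] avoid [M], on both sides; the
    reach then enlarges them. *)
Definition quadratic_touch M xi nu := exists C rho, [/\ 0 <= C, 0 < rho &
  forall eta, M eta -> enorm (eta - xi) < rho ->
    `|dotv nu (eta - xi)| <= C * enorm (eta - xi) ^+ 2].

Definition gradv (f : 'rV[R]_d -> R) x : 'rV[R]_d := \row_b 'd f x (delta_mx 0 b).

Lemma dotv_gradv f x v : dotv (gradv f x) v = 'd f x v.
Proof.
apply: esym; apply: (etrans (linear_row_delta ('d f x) v)).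
by apply: eq_bigr => b _; rewrite mxE mulrC.
Qed.

(** By the mean value theorem $Df$ kills [eta - xi] at some point of the segment from [xi] to [eta],
    and $Df$ at that point differs from $Df(\xi)$ by $O(\|\eta-\xi\|)$. *)
Lemma level_set_touch M W (f : 'rV[R]_d -> R) xi : open W -> smooth1 W 2 f -> W xi -> M xi ->
  (forall x, W x -> M x -> f x = 0) -> quadratic_touch M xi (gradv f xi).
Proof.
move=> oW; rewrite /smooth1 => sf Wxi Mxi f0; have df := smooth_diff (ltn0Sn 1) sf.
have d2 b : differentiable (fun x => 'd f x (delta_mx 0 b)) xi.
  exact: (smooth_diff (ltn0Sn 0) (smoothD (j := 1) (delta_mx 0 b) sf) (i := tt) Wxi).
have /fin_all_exists[C HC] : forall b, exists C, exists2 rho, 0 <= C /\ 0 < rho &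
   forall y, enorm (y - xi) < rho ->
    `|'d f y (delta_mx 0 b) - 'd f xi (delta_mx 0 b)| <= C * enorm (y - xi).
  move=> b; have [C [rho [C0 rho0 H]]] := differentiable_lipschitz_at (d2 b).
  by exists C, rho.
have [rho0 rho00 HW] := open_enorm oW Wxi.
have [rho rhoP Hrho] : exists2 rho, 0 < rho & forall b y, enorm (y - xi) < rho ->
    `|'d f y (delta_mx 0 b) - 'd f xi (delta_mx 0 b)| <= C b * enorm (y - xi).
  have : \forall y \near xi, forall b : 'I_d, `|'d f y (delta_mx 0 b) - 'd f xi (delta_mx 0 b)|
      <= C b * enorm (y - xi).
    apply: (@filter_forall _ 'I_d (fun b y => `|'d f y (delta_mx 0 b) - 'd f xi (delta_mx 0 b)|
        <= C b * enorm (y - xi)) (nbhs xi) (nbhs_filter xi)) => b; have [rho [_ rho1] H] := HC b.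

    by apply/nbhs_enormP; exists rho.
  by move=> /nbhs_enormP[rho rho1 H]; exists rho => // b y /H.
exists (\sum_b C b), (Num.min rho0 rho); split.
- by apply: sumr_ge0 => b _; have [? []] := HC b.
- by rewrite lt_min rho00.
move=> eta Meta; rewrite lt_min => /andP[e1 e2].
have [v vE] : exists v, eta - xi = v by exists (eta - xi).
have seg (t : R) : 0 <= t <= 1 -> enorm (t *: v + xi - xi) <= enorm v.
  by move=> /andP[t0 t1]; rewrite addrK enormZ ger0_norm // ler_piMl ?enorm_ge0.
have [|t t01] := @segment_mvt f xi v.
  move=> t /seg; rewrite -vE => tv; apply: (df tt); apply: HW.
  exact: le_lt_trans tv e1.
have -> : v + xi = eta by rewrite -vE subrK.
rewrite !f0 //; last by apply: HW.
rewrite subrr => E0; rewrite vE dotv_gradv.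
pose A b := 'd f (t *: v + xi) (delta_mx 0 b).
pose B b := 'd f xi (delta_mx 0 b).
have E1 : \sum_b v 0 b * A b = 0 := etrans (esym (linear_row_delta ('d f (t *: v + xi)) v))
    (esym E0).
have E2 : 'd f xi v = \sum_b v 0 b * B b := linear_row_delta ('d f xi) v.
have -> : 'd f xi v = - \sum_b v 0 b * (A b - B b).
  apply: (etrans E2); apply: (canRL (@opprK _)); rewrite -[LHS]sub0r -[X in X - _]E1 -sumrB.
  by apply: eq_bigr => b _; rewrite mulrBr.
rewrite normrN (le_trans (ler_norm_sum _ _ _)) // mulr_suml ler_sum // => b _.
rewrite normrM expr2 mulrCA ler_pM ?ler_coord_enorm //.
have {}e2 : enorm (t *: v + xi - xi) < rho by rewrite (le_lt_trans (seg t t01)) // -vE.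
rewrite (le_trans (Hrho b _ e2)) // ler_wpM2l ?seg //.
by have [? []] := HC b.
Qed.

(* nu is defined on an ambient neighbourhood; only its values on M are normals. *)
Record local_normal M j xi0 W (nu : 'rV[R]_d -> 'rV[R]_d) : Prop := LocalNormal {
  normal_open : open W;
  normal_mem : W xi0;
  normal_smooth : forall b, smooth1 W j (fun x => nu x 0 b);
  normal_unit : forall x, W x -> enorm (nu x) = 1;
  normal_tangent : forall xi v, M xi -> W xi -> dotv (nu xi) v = 0 -> tangent M xi v;
  normal_touch : forall xi, M xi -> W xi -> quadratic_touch M xi (nu xi) }.

(** Chart images of segments supply the $C^1$ curves that the definition of [tangent] asks for. *)
Lemma Ck_line k V (Psi : 'rV[R]_d -> 'rV[R]_d) y w (e : R) : open V -> (1 < k)%N -> Ck k V Psi ->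
  (forall t, ball (0 : R) e t -> V (t *: w + y)) ->
  Ck 1 (ball (0 : R) e) (fun t : R => Psi (t *: w + y)) /\ forall t s, ball (0 : R) e t ->
    'd (fun t : R => Psi (t *: w + y)) t s = 'd Psi (t *: w + y) (s *: w).
Proof.
move=> oV k1 [dPsi _] eV; have dP z : V z -> differentiable Psi z.
  by apply: (dPsi [::]); apply: ltn_trans k1.
have dc t : ball (0 : R) e t -> differentiable (fun t : R => Psi (t *: w + y)) t.
  move=> te; have [da _] := differentiable_affine w y t.
  apply: (@differentiable_comp _ _ _ _ (fun t : R => t *: w + y) Psi) => //.
  by apply: dP; apply: eV.
have dE t s : ball (0 : R) e t ->
    'd (fun t : R => Psi (t *: w + y)) t s = 'd Psi (t *: w + y) (s *: w).
  move=> te; have [da Ea] := differentiable_affine w y t.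
  by apply: (etrans (diff_compE _ da (dP _ (eV _ te)))); rewrite Ea.
split=> //; split=> [[|//] _ t|[|s []] // _ t te]; first exact: dc.
apply: (@near_eq_continuous _ _ (fun t : R => iterD Psi [:: s *: w] (t *: w + y))).
  have : nbhs t (ball (0 : R) e) by apply: open_nbhs_nbhs; split=> //; exact: ball_open.
  by apply: filterS => u ue; exact: (esym (dE u s ue)).
have [da _] := differentiable_affine w y t.
apply: (@continuous_comp _ _ _ (fun t : R => t *: w + y) (iterD Psi [:: s *: w])).
  exact: differentiable_continuous.
by apply: differentiable_continuous; apply: dPsi => //; exact: eV.
Qed.

(** [M] is locally the zero set of [phi], the last coordinate of the inverse chart, and the normal
    is the normalized gradient of [phi]. Taking the gradient costs one order, hence [k.-1]. *)
Lemma hypersurface_local_normal M k xi0 : (2 <= k)%N -> hypersurface k M -> M xi0 ->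
  exists W nu, local_normal M k.-1 xi0 W nu.
Proof.
move=> k2 [d0 [_ HM]] Mxi0.
have [U [V [Psi [oU oV Uxi0 [bij CPsi [Phi [PhiK CPhi]]] Mflat]]]] := HM _ Mxi0.
have lt_d : (d.-1 < d)%N by rewrite prednK.
pose i0 : 'I_d := Ordinal lt_d.
pose phi x := Phi x 0 i0.
have NC : bound_class (fun _ : unit => U) nobound by apply: nobound_class.
have PK y : V y -> Phi (Psi y) = y by move=> Vy; apply: PhiK; rewrite inE.
have UV x : U x -> V (Phi x) /\ Psi (Phi x) = x.
  by have [_ _ surj] := bij; move=> /surj[y Vy <-]; rewrite PK.
have VU y : V y -> U (Psi y) by have [fn _ _] := bij; move=> Vy; apply: fn.
have Mphi x : U x -> M x <-> phi x = 0.
  move=> /UV[Vx <-]; rewrite Mflat // /phi PK //; split=> [|H i ii]; first exact.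
  suff -> : i = i0 by [].
  by apply/val_inj/eqP; rewrite /= eqn_leq ii -ltnS prednK ?ltn_ord.
have sphi : smooth1 U k phi by apply: times_differentiable_smooth => //; case: CPhi.
have dPsi y : V y -> differentiable Psi y by move=> Vy; apply: (CPsi.1 [::]) => //; exact:
    ltn_trans k2.
have dPhi x : U x -> differentiable Phi x by move=> Ux; apply: (CPhi.1 [::]) => //; exact:
    ltn_trans k2.
have dphi x : U x -> differentiable phi x.
  by move=> Ux; apply: (smooth1_diff _ sphi Ux); apply: ltn_trans k2.
have PhiPsi x v : U x -> 'd Phi x ('d Psi (Phi x) v) = v.
  move=> Ux; have [Vy Ey] := UV x Ux.
  have := diff_compE v (dPsi _ Vy); rewrite Ey => /(_ _ _ (dPhi x Ux)) <-.
  have [_ ->] : differentiable (fun y => Phi (Psi y)) (Phi x) /\ ('d (fun y => Phi (Psi y))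
      (Phi x) = 'd id (Phi x) :> (_ -> _)).
    apply: near_eq_diff; last exact: ex_diff.
    have : nbhs (Phi x) V by apply: open_nbhs_nbhs.
    by apply: filterS => y Vy'; rewrite PK.
  by rewrite diff_val.
have PsiPhi x v : U x -> 'd Psi (Phi x) ('d Phi x v) = v.
  move=> Ux; have [Vy Ey] := UV x Ux.
  have <- := diff_compE v (dPhi x Ux) (dPsi _ Vy).
  have [_ ->] : differentiable (fun y => Psi (Phi y)) x /\ ('d (fun y => Psi (Phi y)) x = 'd id
      x :> (_ -> _)).
    apply: near_eq_diff; last exact: ex_diff.
    have : nbhs x U by apply: open_nbhs_nbhs.
    by apply: filterS => y /UV[].
  by rewrite diff_val.
have phiE x v : U x -> 'd phi x v = 'd Phi x v 0 i0 by move=> Ux; apply: diff_coord; exact: dPhi.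
(* The gradient cannot vanish, as ['d phi] equals 1 on the image of the last basis vector under
   ['d Psi]. *)
have grad_gt0 x : U x -> 0 < dotv (gradv phi x) (gradv phi x).
  move=> Ux; rewrite lt_def dotv_ge0 andbT -sqr_enorm sqrf_eq0 enorm_eq0.
  apply/eqP => g0; have : 'd phi x ('d Psi (Phi x) (delta_mx 0 i0)) = 0.
    by rewrite -dotv_gradv g0 dotv0l.
  by rewrite phiE // PhiPsi // mxE !eqxx => /eqP; rewrite oner_eq0.
pose g x := (Num.sqrt (dotv (gradv phi x) (gradv phi x)))^-1.
have gE x : g x = (enorm (gradv phi x))^-1 by [].
have g0 x : U x -> 0 < g x by move=> Ux; rewrite invr_gt0 sqrtr_gt0 grad_gt0.
have k1 : k = k.-1.+1 by rewrite prednK // (ltn_trans _ k2).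
have sgrad b : smooth1 U k.-1 (fun x => gradv phi x 0 b).
  apply: (@smooth_ext _ _ _ _ _ NC _ (fun _ x => 'd phi x (delta_mx 0 b))).
    by move=> _ x _; rewrite mxE.
  by apply: (smooth1D (j := k.-1)); rewrite -k1.
exists U, (fun x => g x *: gradv phi x); split=> //.
- move=> b; apply: (@smooth_ext _ _ _ _ _ NC _ (fun _ x => g x * gradv phi x 0 b)).
    by move=> _ x _; rewrite [in RHS]mxE.
  have sg : smooth1 U k.-1 g.
    apply: (smooth_rsqrt (fun _ => oU) (f := fun (_ : unit) x => dotv (gradv phi x) (gradv phi
        x))) => [_|].
      exact: grad_gt0.
    by apply: (smooth_sum NC) => b'; apply: (smooth_mul NC); exact: sgrad.
  exact: (smooth_mul NC sg (sgrad b)).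
- move=> x Ux; rewrite enormZ ger0_norm; last exact/ltW/g0.
  by rewrite gE mulVf // -sqrf_eq0 sqr_enorm gt_eqF // grad_gt0.
(* If [v] is orthogonal to the gradient, its image [w] under ['d Phi] has last coordinate 0, so the
   chart maps the line through [Phi xi] in direction [w] into [M]. *)
- move=> xi v Mxi Uxi /eqP; rewrite dotvZl mulf_eq0 gt_eqF ?g0 //= => /eqP.
  rewrite dotv_gradv => v0; set w := 'd Phi xi v.
  have [Vy Ey] := UV xi Uxi.
  have w0 : w 0 i0 = 0 by rewrite -phiE.
  have [rho rho0 Hr] := open_enorm oV Vy.
  (* Keeps the line within the ball of radius [rho]; the summand 1 covers [w = 0]. *)
  pose e := rho / (enorm w + 1).
  have ew : 0 < enorm w + 1 by rewrite ltr_wpDl // enorm_ge0.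
  have e0 : 0 < e by rewrite divr_gt0.
  have eV t : ball (0 : R) e t -> V (t *: w + Phi xi).
    rewrite -ball_normE /= sub0r normrN ltr_pdivlMr // => te; apply: Hr.
    rewrite addrK enormZ (le_lt_trans _ te) // ler_wpM2l // lerDl //.
  have [Cc dc] := Ck_line oV k2 CPsi eV.
  exists e, (fun t : R => Psi (t *: w + Phi xi)); split=> //.
  + by rewrite scale0r add0r.
  + move=> t te; apply/Mphi; first by apply/VU/eV.
    rewrite /phi PK; last exact: eV.
    by rewrite !mxE w0 mulr0 add0r; apply/Mphi.
  + have b0 : ball (0 : R) e 0 by exact: ballxx.
    rewrite derive1E' ?dc // ?scale0r ?add0r ?scale1r ?PsiPhi //.
    by apply: (Cc.1 [::]).
- move=> xi Mxi Uxi.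
  have [C [rho [C0 rho0 H]]] : quadratic_touch M xi (gradv phi xi).
    apply: (@level_set_touch M U) => //; first exact: smooth_leq sphi.
    by move=> x Ux /Mphi; apply.
  exists (g xi * C), rho; split=> //; first by rewrite mulr_ge0 // ltW // g0.
  move=> eta Meta er; rewrite dotvZl normrM ger0_norm; last exact/ltW/g0.
  by rewrite -mulrA ler_wpM2l ?H // ltW // g0.
Qed.

End Charts.

(** * First-order estimates along tangent vectors *)

Section FirstOrder.
Context {R : realType} {d : nat}.
Implicit Types (M : set 'rV[R]_d) (x y xi eta u v w g : 'rV[R]_d) (e s C : R).

(** The limit [e -> 0]. The restriction [e < 1] lets higher powers of [e] be absorbed into
    [C * e]. *)
Lemma small_le0 (a C : R) : (forall e, 0 < e -> e < 1 -> a <= C * e) -> a <= 0.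
Proof.
move=> H; rewrite leNgt; apply/negP => a0.
have C0 : 0 < `|C| + 1 by rewrite ltr_wpDl.
pose e := Num.min 2^-1 (a / 2 / (`|C| + 1)).
have e0 : 0 < e by rewrite lt_min invr_gt0 ltr0n !divr_gt0.
have e1 : e < 1 by rewrite gt_min; apply/orP; left; lra.
have := H e e0 e1; apply/negP; rewrite -ltNge.
apply: (@le_lt_trans _ _ ((`|C| + 1) * e)).
  by rewrite ler_wpM2r ?(ltW e0) // (le_trans (ler_norm C)) // lerDl.
apply: (@le_lt_trans _ _ (a / 2)); last by lra.
by rewrite mulrC -ler_pdivlMr // ge_min lexx orbT.
Qed.

Lemma linear_enorm_bound (L : {linear 'rV[R]_d -> 'rV[R]_d}) :
  exists2 c, 0 < c & forall v, enorm (L v) <= c * enorm v.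
Proof.
pose c := \sum_(i < d) enorm (L (delta_mx 0 i)).
have c0 : 0 <= c by apply: sumr_ge0 => i _; exact: enorm_ge0.
exists (c + 1) => [|v]; first by rewrite ltr_wpDl.
apply: (@le_trans _ _ (c * enorm v)); last first.
  by rewrite ler_wpM2r ?enorm_ge0 // lerDl.
rewrite (linear_row_delta L) mulr_suml.
rewrite (le_trans (ler_enorm_sum _)) // ler_sum // => i _.
by rewrite enormZ mulrC ler_wpM2l ?enorm_ge0 // ler_coord_enorm.
Qed.

Lemma diff_approx_enorm (f : 'rV[R]_d -> 'rV[R]_d) x : differentiable f x ->
  forall e, 0 < e -> exists2 rho, 0 < rho & forall y, enorm (y - x) < rho ->
    enorm (f y - f x - 'd f x (y - x)) <= e * enorm (y - x).
Proof.
move=> df e e0; have D0 : 0 < d.+1%:R :> R by rewrite ltr0n.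
have [rho rho0 H] := diff_approx df (divr_gt0 e0 D0).
exists rho => // y /H yx; apply: le_trans (ler_enorm_norm _) _.
by rewrite mulrC -ler_pdivlMr // mulrAC.
Qed.

Lemma differentiable_dotv (V : normedModType R) (f h : V -> 'rV[R]_d) (x : V) :
  differentiable f x -> differentiable h x ->
  differentiable (fun y : V => dotv (f y) (h y)) x /\
  forall v : V, 'd (fun y : V => dotv (f y) (h y)) x v =
            dotv ('d f x v) (h x) + dotv (f x) ('d h x v).
Proof.
move=> df dh.
have dc (k : V -> 'rV[R]_d) i : differentiable k x -> differentiable (fun y : V => k y 0 i) x.
  exact: differentiable_entry.
have E : (fun y : V => dotv (f y) (h y)) = \sum_i (fun y : V => f y 0 i * h y 0 i).
  by apply/funext => y; rewrite fct_sumE.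
have dm i : differentiable (fun y : V => f y 0 i * h y 0 i) x.
  by apply: differentiableM; apply: dc.
split=> [|v]; first by rewrite E; apply: differentiable_sum.
have := @deriveE _ _ _ _ x v (differentiable_sum dm); rewrite -E => <-.
rewrite E derive_sum; last by move=> i; exact: diff_derivable.
rewrite /dotv -big_split; apply: eq_bigr => i _.
rewrite deriveE //; apply: (etrans (diff_mulE v (dc f i df) (dc h i dh))).
rewrite addrC; congr (_ + _).
  by rewrite mulrC; congr (_ * _); apply: diff_coord.
by congr (_ * _); apply: diff_coord.
Qed.

(** The form in which tangency is used: points $\xi+tv+o(t)$ of [M] with arbitrarily small
    [t > 0]. *)
Lemma tangent_approx M xi v : tangent M xi v -> forall e s, 0 < e -> 0 < s ->
  exists t eta, [/\ 0 < t, t < s, M eta & enorm (eta - xi - t *: v) <= e * t].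
Proof.
move=> [e0 [c [e00 [dc _] c0 cM cv]]] e s e_gt0 s0.
have d0 : differentiable c 0 by apply: (dc [::]) => //; exact: ballxx.
have D0 : 0 < d.+1%:R :> R by rewrite ltr0n.
have /diff_locallyP[_ /eqaddoP/(_ _ (divr_gt0 e_gt0 D0)) /nbhs_ballP[rho /= rho0 H]] := d0.
pose t := Num.min e0 (Num.min rho s) / 2.
have m0 : 0 < Num.min e0 (Num.min rho s) by rewrite !lt_min e00 rho0.
have t0 : 0 < t by rewrite divr_gt0.
have : t < Num.min e0 (Num.min rho s) by rewrite /t; lra.
rewrite !lt_min => /andP[te /andP[tr ts]].
have bt rho' : t < rho' -> ball (0 : R) rho' t.
  by move=> tr'; rewrite -ball_normE /= sub0r normrN ger0_norm // ltW.
exists t, (c t); split=> //; first by apply: cM; exact: bt.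
apply: le_trans (ler_enorm_norm _) _.
rewrite mulrC -ler_pdivlMr // mulrAC -[t in leRHS]ger0_norm ?(ltW t0) //.
apply: le_trans (H t (bt _ tr)).
rewrite /= !fctE /= addr0 c0 -cv derive1E' // -linearZ /GRing.scale /= mulr1.
by rewrite opprD addrA.
Qed.

(** Insert [eta = xi + t *: v + w] with $w=o(t)$ and divide by [t]: the quadratic term disappears.
    Only [t > 0] occurs, so an equality takes two applications with opposite signs. *)
Lemma tangent_le0 M xi v g K : tangent M xi v -> 0 <= K ->
  (forall eta, M eta -> dotv g (eta - xi) <= K * enorm (eta - xi) ^+ 2) ->
  dotv g v <= 0.
Proof.
move=> tv K0 H; apply: (@small_le0 _ (enorm g + K * (enorm v + 1) ^+ 2)) => e e0 e1.
have [t [eta [t0 te Meta He]]] := tangent_approx tv e0 e0.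
have [w wE] : exists w, eta - xi - t *: v = w by exists (eta - xi - t *: v).
have E : eta - xi = t *: v + w by rewrite -wE subrKC.
rewrite wE in He; have := H _ Meta; rewrite E dotvDr dotvZr => H1.
have gw : `|dotv g w| <= enorm g * (e * t).
  by rewrite (le_trans (CauchySchwarz _ _)) // ler_wpM2l ?enorm_ge0.
have n1 : enorm (t *: v + w) <= t * (enorm v + 1).
  rewrite (le_trans (ler_enormD _ _)) // enormZ ger0_norm ?(ltW t0) // mulrDr lerD2l.
  by rewrite (le_trans He) // mulrC ler_wpM2l ?ltW.
have n2 : K * enorm (t *: v + w) ^+ 2 <= K * (t * (enorm v + 1)) ^+ 2.
  by rewrite ler_wpM2l //; apply: ler_wsqr; rewrite ?enorm_ge0.
have n3 : K * (t * (enorm v + 1)) ^+ 2 <= t * (K * (enorm v + 1) ^+ 2 * e).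
  have -> : K * (t * (enorm v + 1)) ^+ 2 = t * (K * (enorm v + 1) ^+ 2 * t) by ring.
  rewrite ler_wpM2l ?(ltW t0) // ler_wpM2l ?(ltW te) //.
  by rewrite mulr_ge0 ?sqr_ge0.
move: gw; rewrite ler_norml => /andP[gw _].
rewrite -(ler_pM2l t0) mulrDl mulrDr; lra.
Qed.

(** Vectors are rows and matrices act from the right, so for a unit vector [u] this matrix is the
    orthogonal projection along [u]. *)
Lemma mulmx_proj v u : v *m (1%:M - u^T *m u) = v - dotv v u *: u.
Proof.
rewrite mulmxBr mulmx1 mulmxA; congr (_ - _).
rewrite [v *m u^T]mx11_scalar mul_scalar_mx; congr (_ *: _).
by rewrite !mxE; apply: eq_bigr => i _; rewrite mxE.
Qed.

End FirstOrder.

(** * Differentiability of the nearest point map *)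

Section NearestPointDerivative.
Context {R : realType} {d : nat}.
Implicit Types (x y xi eta u v w : 'rV[R]_d) (e s : R).
Variables (M : set 'rV[R]_d) (r eps : R).
Hypotheses (M0 : M !=set0) (rM : tube M r `<=` unpp M).
Hypotheses (eps0 : 0 < eps) (epsr : eps < r).

Local Notation delta x := (setdist x M).
Local Notation p := (nearest_point M).

Let r0 : 0 < r := lt_trans eps0 epsr.

Lemma tubeW x : tube M eps x -> tube M r x.
Proof. by rewrite /tube /= => /lt_trans; apply. Qed.

(** It suffices to treat one small parameter [m], since [ray_dist] then reaches up to [r]. Points of
    [M] within [rho] of [xi] are at least [m] away from [xi + m *: u] because [2 * m * C <= 1], the
    others because [m <= rho / 2]. *)
Lemma touch_ray xi u : M xi -> enorm u = 1 -> quadratic_touch M xi u ->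
  forall s, 0 <= s -> s < r -> delta (xi + s *: u) = s.
Proof.
move=> Mxi u1 [C [rho [C0 rho0 H]]].
have C1 : 0 < C + 1 by rewrite ltr_wpDl.
pose m := Num.min (rho / 2) (Num.min (r / 2) (2^-1 / (C + 1))).
have m0 : 0 < m by rewrite !lt_min !divr_gt0 // invr_gt0.
have [m1 [m2 m3]] : m <= rho / 2 /\ m <= r / 2 /\ m <= 2^-1 / (C + 1).
  by rewrite !ge_min !lexx !orbT.
have mC : 2 * m * C <= 1.
  have : m * (C + 1) <= 2^-1 by rewrite -ler_pdivlMr.
  lra.
have dm : delta (xi + m *: u) = m.
  apply/eqP; rewrite eq_le ray_dist_le ?(ltW m0) //=; apply: setdist_lb => // eta Meta.
  have [w wE] : exists w, eta - xi = w by exists (eta - xi).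
  have E : xi + m *: u - eta = m *: u - w by rewrite -wE opprB addrCA addrA.
  have [near|far] := ltP (enorm w) rho.
    have := H eta Meta; rewrite wE => /(_ near); rewrite ler_norml => /andP[_ Hw].
    have : 2 * m * dotv u w <= 2 * m * (C * enorm w ^+ 2) by rewrite ler_wpM2l // mulr_ge0 // ltW.
    have : 2 * m * C * enorm w ^+ 2 <= 1 * enorm w ^+ 2 by rewrite ler_wpM2r ?sqr_ge0.
    rewrite mul1r => h1 h2.
    rewrite -(@ler_pXn2r _ 2) ?nnegrE ?enorm_ge0 ?(ltW m0) // E sqr_enorm.
    by rewrite !dotvE -!sqr_enorm u1 (dotvC w); lra.
  have := ler_enorm_dist w (m *: u); rewrite enormC -E enormZ u1 mulr1 ger0_norm ?(ltW m0) //.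
  lra.
by apply: (@ray_dist _ _ _ M0 r r0 rM _ _ m) => //; lra.
Qed.

Variables (j : nat) (xi0 : 'rV[R]_d) (W : set 'rV[R]_d) (nu : 'rV[R]_d -> 'rV[R]_d).
Hypotheses (j0 : (0 < j)%N) (LN : local_normal M j xi0 W nu).

Lemma normal_ray xi s : M xi -> W xi -> `|s| < r -> delta (xi + s *: nu xi) = `|s|.
Proof.
move=> Mxi Wxi sr; have n1 := normal_unit LN Wxi.
have [C [rho [C0 rho0 H]]] := normal_touch LN Mxi Wxi.
have [s0|s0] := leP 0 s.
  by rewrite ger0_norm // in sr *; apply: touch_ray => //; exists C, rho.
have -> : s *: nu xi = `|s| *: - nu xi by rewrite scalerN -scaleNr ltr0_norm ?opprK.
apply: touch_ray => //; first by rewrite enormN.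
by exists C, rho; split=> // eta Meta He; rewrite dotvNl normrN H.
Qed.

Lemma normal_curvature xi eta : M xi -> W xi -> M eta ->
  2 * eps * `|dotv (nu xi) (eta - xi)| <= enorm (eta - xi) ^+ 2.
Proof.
move=> Mxi Wxi Meta; have n1 := normal_unit LN Wxi.
have ae : `|eps| = eps by rewrite gtr0_norm.
have H1 := normal_ray Mxi Wxi (s := eps); have H2 := normal_ray Mxi Wxi (s := - eps).
rewrite normrN ae in H1 H2; rewrite scaleNr -scalerN in H2.
have := ray_curvature Mxi n1 (H1 epsr) (ltW eps0) Meta.
have n1' : enorm (- nu xi) = 1 by rewrite enormN.
have := ray_curvature Mxi n1' (H2 epsr) (ltW eps0) Meta.
by rewrite dotvNl; case: (ler0P (dotv (nu xi) _)) => _; lra.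
Qed.

Lemma tangent_normalP xi v : M xi -> W xi -> tangent M xi v <-> dotv (nu xi) v = 0.
Proof.
move=> Mxi Wxi; split=> [tv|]; last exact: (normal_tangent LN Mxi Wxi).
have K0 : 0 <= (2 * eps)^-1 by rewrite invr_ge0 mulr_ge0 // ltW.
have H eta : M eta -> `|dotv (nu xi) (eta - xi)| <= (2 * eps)^-1 * enorm (eta - xi) ^+ 2.
  by move=> Meta; rewrite mulrC ler_pdivlMr ?mulr_gt0 // mulrC normal_curvature.
apply/eqP; rewrite eq_le; apply/andP; split.
  by apply: (tangent_le0 tv K0) => eta Meta; apply: le_trans (ler_norm _) (H _ Meta).
rewrite -oppr_le0 -dotvNl; apply: (tangent_le0 tv K0) => eta Meta.
by rewrite dotvNl (le_trans _ (H _ Meta)) // -normrN ler_norm.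
Qed.

Definition normal_coord x := dotv (x - p x) (nu (p x)).

(** Federer's inequality and [tangent_le0], for [v] and [- v], make [x - p x] orthogonal to all
    tangent vectors. Its tangential part is then orthogonal to itself. *)
Lemma nearest_point_normal x : tube M eps x -> W (p x) ->
  x - p x = normal_coord x *: nu (p x).
Proof.
move=> tx Wpx; have Mpx := nearest_pointM rM (tubeW tx).
have n1 := normal_unit LN Wpx.
have K0 : 0 <= (2 * eps)^-1 * delta x.
  by rewrite mulr_ge0 ?setdist_ge0 // invr_ge0 mulr_ge0 // ltW.
have H v : dotv (nu (p x)) v = 0 -> dotv (x - p x) v <= 0.
  move=> v0; apply: (tangent_le0 (normal_tangent LN Mpx Wpx v0) K0) => eta Meta.
  rewrite -mulrA mulrC ler_pdivlMr ?mulr_gt0 // mulrC.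
  exact: (nearest_point_curvature M0 r0 rM (tubeW tx) (ltW eps0) epsr Meta).
pose v := x - p x - normal_coord x *: nu (p x).
have v0 : dotv (nu (p x)) v = 0.
  by rewrite /v dotvBr dotvZr -sqr_enorm n1 expr1n mulr1 dotvC subrr.
have xv : dotv (x - p x) v = 0.
  apply/eqP; rewrite eq_le H //= -oppr_le0 -dotvNr H //.
  by rewrite dotvNr v0 oppr0.
have : dotv v v = 0 by rewrite {1}/v [LHS]dotvBl xv dotvZl v0 mulr0 subr0.
by rewrite -sqr_enorm => /eqP; rewrite sqrf_eq0 enorm_eq0 subr_eq0 => /eqP.
Qed.

Lemma normal_coord_norm x : tube M eps x -> W (p x) -> `|normal_coord x| = delta x.
Proof.
move=> tx Wpx; rewrite -(nearest_point_dist rM (tubeW tx)) nearest_point_normal //.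
by rewrite enormZ (normal_unit LN Wpx) mulr1.
Qed.

Lemma normal_differentiable x : W x -> differentiable nu x.
Proof.
by move=> Wx; apply: differentiable_rowP => b; apply: smooth1_diff j0 (normal_smooth LN b) x Wx.
Qed.

Lemma diff_normal_orth x v : W x -> dotv ('d nu x v) (nu x) = 0.
Proof.
move=> Wx; have dn := normal_differentiable Wx.
have [dd dE] := differentiable_dotv dn dn.
have [_ H] : differentiable (fun y => dotv (nu y) (nu y)) x /\
    ('d (fun y => dotv (nu y) (nu y)) x = 'd (cst (1 : R)) x :> (_ -> _)).
  apply: near_eq_diff; last exact: differentiable_cst.
  have : nbhs x W by apply: open_nbhs_nbhs; split=> //; exact: normal_open LN.
  by apply: filterS => y Wy; rewrite -sqr_enorm (normal_unit LN Wy) expr1n.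
have := dE v; rewrite H diff_cst (dotvC (nu x)) => /esym/eqP.
by rewrite -mulr2n mulrn_eq0 => /eqP.
Qed.

Lemma near_normal x : tube M eps x -> W (p x) ->
  exists2 rho, 0 < rho & forall y, enorm (y - x) < rho -> tube M eps y /\ W (p y).
Proof.
move=> tx Wpx.
have [rho1 rho10 H1] := open_enorm (normal_open LN) Wpx.
have [rho2 rho20 H2] := nearest_point_continuous M0 r0 rM (tubeW tx) rho10.
have [rho3 rho30 H3] := open_enorm (@open_tube _ _ _ M0 eps) tx.
exists (Num.min rho2 rho3) => [|y]; rewrite lt_min ?rho20 // => /andP[y2 y3].
have ty := H3 _ y3; split=> //; apply: H1; apply: H2 => //; exact: tubeW.
Qed.

(** The matrix of $1+t\,D\nu\circ P$ with $P$ the tangential projection. Applying $P$ first discards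
    the normal derivative of [nu], which depends on how [nu] extends off [M]. *)
Definition normal_matrix (t : R) q : 'M[R]_d :=
  1%:M + t *: ((1%:M - (nu q)^T *m nu q) *m lin1_mx ('d nu q)).

Lemma mulmx_normal_matrix t q v : v *m normal_matrix t q = v + t *: 'd nu q (v - dotv v (nu q)
    *: nu q).
Proof.
by rewrite mulmxDr mulmx1 -scalemxAr mulmxA mulmx_proj mul_rV_lin1.
Qed.

Let L := (r + eps) / (r - eps).
Let re : 0 < r - eps. Proof. by rewrite subr_gt0. Qed.
Let L0 : 0 < L. Proof. by rewrite divr_gt0 // addr_gt0. Qed.

Lemma nearest_point_lip x y : tube M eps x -> tube M eps y ->
  enorm (p x - p y) <= L * enorm (x - y).
Proof.
move=> tx ty; rewrite /L mulrAC ler_pdivlMr // mulrC.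
exact: nearest_point_lipschitz r0 rM _ _ _ _ _ tx ty.
Qed.

(* p sends eta + t nu(eta) back to eta and is Lipschitz, so
   v |-> v + t Dnu(v) cannot kill a tangent vector: no focal points in the tube. *)
Lemma unitmx_normal_matrix x : tube M eps x -> W (p x) -> normal_matrix (normal_coord x) (p x)
    \in unitmx.
Proof.
move=> tx Wpx; have Mpx := nearest_pointM rM (tubeW tx).
have n1 := normal_unit LN Wpx.
have te : `|normal_coord x| < eps by rewrite normal_coord_norm.
have xE := nearest_point_normal tx Wpx.
move: te xE; set t := normal_coord x; set q := p x => te xE.
rewrite -row_free_unit; apply: inj_row_free => v; rewrite mulmx_normal_matrix => v0.
(* A kernel vector is tangent: pairing [v0] with [nu q] removes the derivative term, as [nu] has
   constant norm. *)
have vn : dotv v (nu q) = 0.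
  have := congr1 (fun z => dotv z (nu q)) v0.
  by rewrite dotvDl dotvZl diff_normal_orth // mulr0 addr0 dotv0l.
rewrite vn scale0r subr0 in v0.
have tv : tangent M q v by apply/tangent_normalP => //; rewrite dotvC.
apply/eqP; rewrite -enorm_eq0 eq_le enorm_ge0 andbT.
have [k k0 Hk] := linear_enorm_bound ('d nu q).
rewrite -(@pmulr_rle0 _ (r - eps)) //.
apply: (@small_le0 _ _ ((r + eps) * (1 + `|t| * k + `|t| * (enorm v + 1)) + (r - eps))) => e e0 e1.
have [rho1 rho10 H1] := open_enorm (normal_open LN) Wpx.
have [rho2 rho20 H2] := diff_approx_enorm (normal_differentiable Wpx) e0.
have v1 : 0 < enorm v + 1 by rewrite ltr_wpDl // enorm_ge0.
have m0 : 0 < Num.min rho1 rho2 / (enorm v + 1) by rewrite divr_gt0 // lt_min rho10.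
have [s [eta [s0 sm Meta He]]] := tangent_approx tv e0 m0.
have [w wE] : exists w, eta - q - s *: v = w by exists (eta - q - s *: v).
have E : eta - q = s *: v + w by rewrite -wE subrKC.
rewrite wE in He.
have n2 : enorm (eta - q) <= s * (enorm v + 1).
  rewrite E (le_trans (ler_enormD _ _)) // enormZ ger0_norm ?(ltW s0) // mulrDr lerD2l.
  by rewrite (le_trans He) // mulrC ler_wpM2l ?(ltW s0) ?(ltW e1).
have : enorm (eta - q) < Num.min rho1 rho2 by rewrite (le_lt_trans n2) // -ltr_pdivlMr.
rewrite lt_min => /andP[/H1 Weta /H2 He2].
set z := eta + t *: nu eta.
have dz : delta z = `|t| by apply: normal_ray => //; exact: lt_trans epsr.
have tz : tube M eps z by rewrite /tube /= dz.
have pz : p z = eta.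
  apply: nearest_point_unique => //; first exact/rM/tubeW.
  by rewrite dz /z addrC addKr enormZ (normal_unit LN Weta) mulr1.
have := nearest_point_lipschitz M0 r0 rM eps0 epsr tz tx; rewrite pz -/q.
(* The terms of order [s] cancel by [v0]. So [z] moves by $O(es)$ only, while its nearest point
   [eta] moves by at least [s * (enorm v - e)]. *)
have -> : z - x = w + t *: 'd nu q w + t *: (nu eta - nu q - 'd nu q (eta - q)).
  have -> : x = q + t *: nu q by rewrite -xE subrKC.
  have -> : 'd nu q (eta - q) = s *: 'd nu q v + 'd nu q w by rewrite E linearD linearZ.
  have [a aE] : exists a, 'd nu q v = a by exists ('d nu q v).
  have [b bE] : exists b, 'd nu q w = b by exists ('d nu q w).
  have etaE : eta = s *: v + w + q by rewrite -E subrK.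
  rewrite aE in v0; rewrite aE bE /z {1}etaE.
  apply/rowP => i; have /rowP/(_ i) := v0; rewrite !mxE => vi.
  have -> : v 0 i = - (t * a 0 i) by apply/eqP; rewrite -addr_eq0 vi.
  by ring.
move=> Hl.
have b1 : enorm (w + t *: 'd nu q w + t *: (nu eta - nu q - 'd nu q (eta - q))) <=
    s * (e * (1 + `|t| * k + `|t| * (enorm v + 1))).
  rewrite (le_trans (ler_enormD _ _)) // (le_trans (lerD (ler_enormD _ _) (lexx _))) //.
  rewrite !enormZ.
  have h1 : `|t| * enorm ('d nu q w) <= `|t| * (k * (e * s)).
    by rewrite ler_wpM2l // (le_trans (Hk _)) // ler_wpM2l // ltW.
  have h2 : `|t| * enorm (nu eta - nu q - 'd nu q (eta - q)) <= `|t| * (e * (s * (enorm v + 1))).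
    by rewrite ler_wpM2l // (le_trans He2) // ler_wpM2l // ltW.
  lra.
have b2 : s * (enorm v - e) <= enorm (eta - q).
  have := ler_enorm_dist (s *: v) (- w); rewrite opprK -E enormN enormZ ger0_norm ?(ltW s0) //.
  lra.
have b3 := le_trans (ler_wpM2l (ltW re) b2) (le_trans Hl (ler_wpM2l (ltW (addr_gt0 r0 eps0)) b1)).
rewrite mulrCA [leRHS]mulrCA ler_pM2l // in b3; lra.
Qed.

(** Subtract $x=q+t\nu(q)$ from $y=p(y)+s\nu(p(y))$ and project off $\nu(q)$: the displacement of
    the foot times [normal_matrix] is the projected $y-x$, up to errors. The Lipschitz bound on [p]
    makes these errors $o(\|y-x\|)$, so no implicit function theorem enters. *)
Lemma nearest_point_diff x : tube M eps x -> W (p x) ->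
  differentiable p x /\
  forall v, 'd p x v = (v - dotv v (nu (p x)) *: nu (p x)) *m invmx (normal_matrix
      (normal_coord x) (p x)).
Proof.
move=> tx Wpx; have Mpx := nearest_pointM rM (tubeW tx).
have n1 := normal_unit LN Wpx.
have uG := unitmx_normal_matrix tx Wpx.
have xE := nearest_point_normal tx Wpx.
have te : `|normal_coord x| < eps by rewrite normal_coord_norm.
move: te uG xE; set t := normal_coord x; set q := p x => te uG xE.
pose P : 'M[R]_d := 1%:M - (nu q)^T *m nu q.
have PE v : v *m P = v - dotv v (nu q) *: nu q by apply: mulmx_proj.
suff [dp dE] : differentiable p x /\ ('d p x = mulmxr (P *m invmx (normal_matrix t q)) :> (_ -> _)).
  by split=> // v; rewrite dE /= mulmxA PE.
apply: approx_diff => e e0.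
have [c c0 Hc] := linear_enorm_bound (mulmxr (invmx (normal_matrix t q))).
have [k k0 Hk] := linear_enorm_bound ('d nu q).
(* Multiplication by the inverse matrix costs only the factor [c], so the error is estimated before
   inverting. *)
suff [C [C0 HC]] : exists C, 0 < C /\ forall e, 0 < e -> e < 1 ->
    exists2 rho, 0 < rho & forall y, enorm (y - x) < rho ->
    enorm ((p y - q) *m normal_matrix t q - (y - x) *m P) <= C * e * enorm (y - x).
  pose e' := Num.min 2^-1 (e / (c * C)).
  have e'0 : 0 < e' by rewrite lt_min invr_gt0 ltr0n divr_gt0 // mulr_gt0.
  have e'1 : e' < 1 by rewrite gt_min; apply/orP; left; lra.
  have [rho rho0 H] := HC e' e'0 e'1; exists rho => // y /H Hy.
  apply: le_trans (ler_norm_enorm _) _.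
  have -> : p y - p x - mulmxr (P *m invmx (normal_matrix t q)) (y - x) =
      mulmxr (invmx (normal_matrix t q)) ((p y - q) *m normal_matrix t q - (y - x) *m P).
    by rewrite /= [RHS]mulmxBl -!mulmxA mulmxV // mulmx1.
  apply: le_trans (Hc _) _; apply: (@le_trans _ _ (c * (C * e' * enorm (y - x)))).
    by rewrite ler_wpM2l // ltW.
  rewrite !mulrA ler_wpM2r ?enorm_ge0 // mulrC -ler_pdivlMr ?mulr_gt0 //.
  by rewrite ge_min lexx orbT.
pose K := k + 1.
have K0 : 0 < K by rewrite addr_gt0.
(* One summand for each of the estimates [c1], [c2], [c3] below. *)
exists ((2 * eps)^-1 * L ^+ 2 * (1 + eps * k) + 2 * eps * L + (1 + L + eps * K * L) * (2 * K * L)).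
split.
  by do ?[exact: L0|apply: addr_gt0|apply: mulr_gt0|rewrite invr_gt0|apply: exprn_gt0].
move=> {}e {}e0 e1.
have [rho1 rho10 H1] := near_normal tx Wpx.
have [rho2 rho20 H2] := diff_approx_enorm (normal_differentiable Wpx) e0.
have [rho3 rho30 H3] := nearest_point_continuous M0 r0 rM (tubeW tx) rho20.
(* A radius at most [e] turns the errors quadratic in [enorm h] into [e * enorm h]. *)
exists (Num.min e (Num.min rho1 rho3)); first by rewrite !lt_min e0 rho10.
move=> y; rewrite !lt_min => /andP[ye /andP[/H1[ty Wpy] y3]].
have Mpy := nearest_pointM rM (tubeW ty).
have /H2 Hn := H3 _ y3 (tubeW ty).
have yE := nearest_point_normal ty Wpy.
have Dp := nearest_point_lip ty tx; rewrite -/q in Hn Dp.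
have n1y := normal_unit LN Wpy.
have cur := normal_curvature Mpx Wpx Mpy; rewrite -/q in cur.
have [h hE] : exists h, y - x = h by exists (y - x).
have [D DE] : exists D, p y - q = D by exists (p y - q).
have [N NE] : exists N, nu (p y) - nu q = N by exists (nu (p y) - nu q).
set s := normal_coord y in yE.
have [a aE] : exists a, 'd nu q D = a by exists ('d nu q D).
rewrite hE DE in Hn Dp ye cur *; rewrite NE aE in Hn.
have hD : h = D + t *: N + (s - t) *: nu (p y).
  have -> : h = (y - p y) - (x - q) + (p y - q).
    by rewrite -hE; apply/rowP => i; rewrite !mxE; ring.
  rewrite yE xE DE -NE; apply/rowP => i; rewrite !mxE; ring.
have ND : enorm N <= K * enorm D.
  rewrite -[N](subrK a) mulrDl mul1r addrC (le_trans (ler_enormD _ _)) // lerD -?aE ?Hk //.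
  by rewrite aE (le_trans Hn) // ler_piMl ?enorm_ge0 // ltW.
have st : `|s - t| <= (1 + L + eps * K * L) * enorm h.
  have -> : s - t = dotv (h - D) (nu (p y)) - t * dotv N (nu (p y)).
    by rewrite hD !dotvE -sqr_enorm n1y; ring.
  rewrite (le_trans (ler_normB _ _)) //.
  have h1 : `|dotv (h - D) (nu (p y))| <= enorm h + enorm D.
    by rewrite (le_trans (CauchySchwarz _ _)) // n1y mulr1 ler_enormB.
  have h2 : `|t * dotv N (nu (p y))| <= eps * (K * enorm D).
    rewrite normrM ler_pM // ?(ltW te) //.
    by rewrite (le_trans (CauchySchwarz _ _)) // n1y mulr1.
  have h3 : eps * (K * enorm D) <= eps * (K * (L * enorm h)).
    by rewrite !ler_wpM2l // ltW.
  lra.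
have Pn u : enorm (u *m P) <= 2 * enorm u.
  rewrite PE (le_trans (ler_enormB _ _)) // enormZ n1 mulr1 mulrDl mul1r lerD2l.
  by rewrite (le_trans (CauchySchwarz _ _)) // n1 mulr1.
have aP u : 'd nu q u *m P = 'd nu q u by rewrite PE diff_normal_orth // scale0r subr0.
have nP : nu (p y) *m P = N *m P.
  rewrite -NE mulmxBl [nu q *m P]PE -sqr_enorm n1 expr1n scale1r subrr subr0 //.
(* Three errors: the normal component of [D], quadratic by [normal_curvature]; the linearization
   error of [nu] at [q]; and the product of [s - t] with the projected [N], both of first order. *)
have -> : D *m normal_matrix t q - h *m P =
    dotv D (nu q) *: (nu q - t *: 'd nu q (nu q)) - t *: ((N - a) *m P) - (s - t) *: (N *m P).
  have [b bE] : exists b, 'd nu q (nu q) = b by exists ('d nu q (nu q)).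
  have -> : D *m normal_matrix t q = D + t *: (a - dotv D (nu q) *: b).
    by rewrite mulmx_normal_matrix linearB linearZ aE bE.
  have -> : h *m P = D *m P + t *: (N *m P) + (s - t) *: (N *m P).
    by rewrite hD !mulmxDl -!scalemxAl nP.
  have -> : (N - a) *m P = N *m P - a by rewrite mulmxBl -{1}aE aP aE.
  rewrite (PE D) bE; move: (N *m P) => Q.
  by apply/rowP => i; rewrite !mxE; ring.
have c1 : enorm (dotv D (nu q) *: (nu q - t *: 'd nu q (nu q))) <=
    (2 * eps)^-1 * L ^+ 2 * (1 + eps * k) * e * enorm h.
  rewrite enormZ.
  have h1 : `|dotv D (nu q)| <= (2 * eps)^-1 * (L * enorm h) ^+ 2.
    rewrite mulrC ler_pdivlMr ?mulr_gt0 // mulrC dotvC (le_trans cur) //.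
    by apply: ler_wsqr; rewrite ?enorm_ge0.
  have h2 : enorm (nu q - t *: 'd nu q (nu q)) <= 1 + eps * k.
    rewrite (le_trans (ler_enormB _ _)) // n1 lerD2l enormZ ler_pM ?enorm_ge0 ?(ltW te) //.
    by rewrite (le_trans (Hk _)) // n1 mulr1.
  apply: le_trans (ler_pM (normr_ge0 _) (enorm_ge0 _) h1 h2) _.
  have -> : (2 * eps)^-1 * (L * enorm h) ^+ 2 * (1 + eps * k) =
     ((2 * eps)^-1 * L ^+ 2 * (1 + eps * k)) * (enorm h * enorm h) by ring.
  rewrite -[leRHS]mulrA ler_wpM2l ?ler_wpM2r ?enorm_ge0 ?(ltW ye) // ltW //.
  by do ?[exact: L0|apply: addr_gt0|apply: mulr_gt0|rewrite invr_gt0|apply: exprn_gt0].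
have c2 : enorm (t *: ((N - a) *m P)) <= 2 * eps * L * e * enorm h.
  rewrite enormZ.
  have h1 : enorm ((N - a) *m P) <= 2 * (e * (L * enorm h)).
    rewrite (le_trans (Pn _)) // ler_wpM2l // (le_trans Hn) // ler_wpM2l //.
    exact: ltW.
  apply: le_trans (ler_pM (normr_ge0 _) (enorm_ge0 _) (ltW te) h1) _.
  lra.
have c3 : enorm ((s - t) *: (N *m P)) <= (1 + L + eps * K * L) * (2 * K * L) * e * enorm h.
  rewrite enormZ.
  have h1 : enorm (N *m P) <= 2 * (K * (L * enorm h)).
    rewrite (le_trans (Pn _)) // ler_wpM2l // (le_trans ND) // ler_wpM2l //.
    exact: ltW.
  apply: le_trans (ler_pM (normr_ge0 _) (enorm_ge0 _) st h1) _.
  have -> : (1 + L + eps * K * L) * enorm h * (2 * (K * (L * enorm h))) =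
    ((1 + L + eps * K * L) * (2 * K * L)) * (enorm h * enorm h) by ring.
  rewrite -[leRHS]mulrA ler_wpM2l ?ler_wpM2r ?enorm_ge0 ?(ltW ye) // ltW //.
  by do ?[exact: L0|apply: addr_gt0|apply: mulr_gt0|rewrite invr_gt0|apply: exprn_gt0].
rewrite (le_trans (ler_enormB _ _)) // (le_trans (lerD (ler_enormB _ _) (lexx _))) //.
lra.
Qed.

End NearestPointDerivative.

(** Without bounds nothing has to be uniform in [i], so the patches can be treated separately. *)
Lemma smooth_family (R : realType) (d : nat) (I : Type) (W : I -> set 'rV[R]_d) j
    (f : I -> 'rV[R]_d -> R) :
  (forall i, smooth1 (W i) j (f i)) -> smooth W (@nobound R d I) j f.
Proof.
elim: j f => [//|j IH] f sf; split=> //; split=> [i x Wx|v].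
  exact: (smooth1_diff (ltn0Sn j) (sf i) Wx).
by apply: IH => i; apply: smooth1D; exact: sf.
Qed.

(** * The normal at the foot point, and smoothness of the nearest point map *)

Section NormalFamily.
Context {R : realType} {d : nat} {I : Type}.
Implicit Types (x y xi eta u v w : 'rV[R]_d) (e s : R) (i : I) (bs : seq 'I_d).
Variables (M : set 'rV[R]_d) (r eps : R).
Hypotheses (M0 : M !=set0) (rM : tube M r `<=` unpp M).
Hypotheses (eps0 : 0 < eps) (epsr : eps < r).
Variables (m : nat) (xi0 : I -> 'rV[R]_d) (W : I -> set 'rV[R]_d) (nu : I -> 'rV[R]_d -> 'rV[R]_d).
Hypotheses (m0 : (0 < m)%N) (LN : forall i, local_normal M m (xi0 i) (W i) (nu i)).

Local Notation delta x := (setdist x M).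
Local Notation p := (nearest_point M).

Definition patch i : set 'rV[R]_d := [set x | tube M eps x /\ W i (p x)].

Lemma open_patch i : open (patch i).
Proof.
rewrite openE => x [tx Wx]; apply/nbhs_enormP.
exact: (near_normal M0 rM eps0 epsr (LN i) tx Wx).
Qed.

Let oO := open_patch.
Let NC : bound_class patch nobound := nobound_class oO.

Lemma patchM i x : patch i x -> M (p x).
Proof. by move=> [tx _]; exact: (nearest_pointM rM (tubeW epsr tx)). Qed.

Lemma patch_mem i xi : M xi -> W i xi -> patch i xi.
Proof.
move=> Mxi Wxi; split; first by rewrite /tube /= setdist_mem.
by rewrite (nearest_point_id M0 (lt_trans eps0 epsr) rM).
Qed.

Lemma patch_proj i x : patch i x -> patch i (p x).
Proof. by move=> Ox; apply: patch_mem; [exact: patchM Ox|case: Ox]. Qed.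

Lemma nearest_pointK i x : patch i x -> p (p x) = p x.
Proof. by move=> Ox; apply: (nearest_point_id M0 (lt_trans eps0 epsr) rM); exact: patchM Ox. Qed.

Lemma patch_near i x : patch i x -> nbhs x (patch i).
Proof. by move=> Ox; apply: open_nbhs_nbhs. Qed.

Definition foot_normal i x := nu i (p x).
Definition foot_coord i x := normal_coord M (nu i) x.

Lemma unit_foot_normal i x : patch i x -> enorm (foot_normal i x) = 1.
Proof. by move=> [_ Wx]; exact: (normal_unit (LN i) Wx). Qed.

Lemma patch_decomp i x : patch i x -> x - p x = foot_coord i x *: foot_normal i x.
Proof. by move=> [tx Wx]; exact: (nearest_point_normal M0 rM eps0 epsr (LN i) tx Wx). Qed.

Lemma patch_coord_le i x : patch i x -> `|foot_coord i x| <= eps.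
Proof.
move=> [tx Wx]; rewrite /foot_coord (normal_coord_norm M0 rM eps0 epsr (LN i) tx Wx).
exact: ltW.
Qed.

Lemma smooth_coord j c : smooth patch nobound j (fun (_ : I) x => x 0 c).
Proof.
case: j => // j; split=> //; split=> [i x _|v]; first exact: differentiable_coord.
apply: (@smooth_ext _ _ _ _ _ NC j (fun _ _ => v 0 c)); last exact: (smooth_cst NC).
move=> i x _; rewrite (@diff_coord _ _ _ (fun y => y)); last exact: ex_diff.
by rewrite diff_val.
Qed.

Let dp_formula i x : patch i x -> differentiable p x /\
  forall v, 'd p x v = (v - dotv v (foot_normal i x) *: foot_normal i x) *m
    invmx (normal_matrix (nu i) (foot_coord i x) (p x)).
Proof.
by move=> [tx Wx]; exact: (nearest_point_diff M0 rM eps0 epsr m0 (LN i) tx Wx).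
Qed.

Lemma foot_normal_smooth j c : (j <= m)%N ->
  (forall c, smooth patch nobound j (fun (_ : I) x => p x 0 c)) ->
  smooth patch nobound j (fun i x => foot_normal i x 0 c).
Proof.
move=> jm sp; apply: (@smooth_comp _ _ _ patch W oO j (fun i x => nu i x 0 c) (fun _ => p)) => //.
  by move=> i x [].
apply: smooth_leq jm _; apply: smooth_family => i; exact: normal_smooth (LN i) c.
Qed.

Lemma foot_coord_smooth j : (j <= m)%N ->
  (forall c, smooth patch nobound j (fun (_ : I) x => p x 0 c)) ->
  smooth patch nobound j foot_coord.
Proof.
move=> jm sp; apply: (@smooth_ext _ _ _ _ _ NC j
    (fun i x => \sum_c (x 0 c - p x 0 c) * foot_normal i x 0 c)).
  by move=> i x _; apply: eq_bigr => c _; rewrite !mxE.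
apply: (smooth_sum NC) => c; apply: (smooth_mul NC); last exact: foot_normal_smooth.
by apply: (smooth_sub NC); [exact: smooth_coord|exact: sp].
Qed.

(** Bootstrap: if [p] has order [j < m], so have the normal and the coordinate at the foot, and also
    $D\nu\circ p$, because $D\nu$ has order [m - 1]. The formula for $Dp$ then gives [p] order
    [j.+1]. *)
Lemma nearest_point_smooth c : smooth patch nobound m (fun (_ : I) x => p x 0 c).
Proof.
suff H j : (j <= m)%N -> forall c, smooth patch nobound j (fun (_ : I) x => p x 0 c).
  exact: H.
elim: j => [//|j IH] jm b; have {IH} sp := IH (ltnW jm).
have OW i x : patch i x -> W i (p x) by case.
have sn a := foot_normal_smooth a (ltnW jm) sp.
have st := foot_coord_smooth (ltnW jm) sp.
have sJ a a' : smooth patch nobound j (fun i x => lin1_mx ('d (nu i) (p x)) a a').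
  apply: (@smooth_ext _ _ _ _ _ NC j (fun i x => 'd (fun y => nu i y 0 a') (p x) (delta_mx 0 a))).
    move=> i x Ox; rewrite mxE; apply: diff_coord.
    exact: (normal_differentiable m0 (LN i) (OW i x Ox)).
  apply: (@smooth_comp _ _ _ patch W oO j (fun i y => 'd (fun y => nu i y 0 a') y (delta_mx 0
      a)) (fun _ => p)) => //.
  apply: smooth_family => i; apply: smooth1D; apply: smooth_leq jm _.
  exact: normal_smooth (LN i) a'.
pose P i x : 'M[R]_d := 1%:M - (foot_normal i x)^T *m foot_normal i x.
have sP a a' : smooth patch nobound j (fun i x => P i x a a').
  apply: (@smooth_ext _ _ _ _ _ NC j (fun i x => (1%:M : 'M[R]_d) a a' - foot_normal i x 0 a *
      foot_normal i x 0 a')).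
    by move=> i x _; rewrite /P !mxE big_ord1 !mxE.
  by apply: (smooth_sub NC); [exact: (smooth_cst NC)|exact: (smooth_mul NC)].
pose G i x : 'M[R]_d := 1%:M + foot_coord i x *: (P i x *m lin1_mx ('d (nu i) (p x))).
have sG a a' : smooth patch nobound j (fun i x => G i x a a').
  apply: (@smooth_ext _ _ _ _ _ NC j (fun i x => (1%:M : 'M[R]_d) a a' + foot_coord i x * (P i
      x *m lin1_mx ('d (nu i) (p x))) a a')).
    by move=> i x _; rewrite /G !mxE.
  apply: (smooth_add NC); first exact: (smooth_cst NC).
  by apply: (smooth_mul NC) => //; apply: (smooth_mulmx NC).
have sGi : forall a a', smooth patch nobound j (fun i x => invmx (G i x) a a').
  apply: (smooth_invmx oO) => // i x [tx Wx].
  exact: (unitmx_normal_matrix M0 rM eps0 epsr m0 (LN i) tx Wx).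
split=> //; split=> [i x Ox|v].
  by apply: differentiable_entry; have [] := dp_formula Ox.
apply: (@smooth_ext _ _ _ _ _ NC j (fun i x =>
   \sum_a (v 0 a - (\sum_c v 0 c * foot_normal i x 0 c) * foot_normal i x 0 a) * invmx (G i x)
       a b)).
  move=> i x Ox; have [dp dE] := dp_formula Ox.
  apply: esym; apply: (etrans (diff_coord _ _ dp)).
  rewrite dE mxE; apply: eq_bigr => a _; congr (_ * _).
  by rewrite !mxE.
apply: (smooth_sum NC) => a; apply: (smooth_mul NC) => //.
apply: (smooth_sub NC); first exact: (smooth_cst NC).
apply: (smooth_mul NC) => //; apply: (smooth_sum NC) => a'.
by apply: (smooth_mul NC) => //; exact: (smooth_cst NC).
Qed.

Let sp := nearest_point_smooth.

Lemma nearest_point_differentiable i x : patch i x -> differentiable p x.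
Proof. by move=> /dp_formula[]. Qed.

Lemma diff_foot_normal i x v : patch i x -> differentiable (foot_normal i) x /\
  'd (foot_normal i) x v = 'd (nu i) (p x) ('d p x v).
Proof.
move=> Ox; have dp := nearest_point_differentiable Ox.
have dn := normal_differentiable m0 (LN i) (proj2 Ox).
split; last exact: diff_compE.
exact: (@differentiable_comp _ _ _ _ p (nu i)).
Qed.

Lemma diff_foot_normal_orth i x v : patch i x -> dotv ('d (foot_normal i) x v) (foot_normal i
    x) = 0.
Proof.
move=> Ox; have [_ ->] := diff_foot_normal v Ox.
exact: (diff_normal_orth m0 (LN i) _ (proj2 Ox)).
Qed.

Lemma diff_proj_eq i x v : patch i x ->
  'd p x v + foot_coord i x *: 'd (nu i) (p x) ('d p x v - dotv ('d p x v) (foot_normal i x) *: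
      foot_normal i x) =
  v - dotv v (foot_normal i x) *: foot_normal i x.
Proof.
move=> Ox; have [_ dE] := dp_formula Ox.
rewrite -(mulmx_normal_matrix (nu i) (foot_coord i x) (p x)) [in LHS]dE mulmxKV //.
exact: (unitmx_normal_matrix M0 rM eps0 epsr m0 (LN i) (proj1 Ox) (proj2 Ox)).
Qed.

(** Pair [diff_proj_eq] with the normal: $D\nu$ takes values orthogonal to it. *)
Lemma diff_proj_orth i x v : patch i x -> dotv ('d p x v) (foot_normal i x) = 0.
Proof.
move=> Ox; have E := diff_proj_eq v Ox.
have bn := diff_normal_orth m0 (LN i) ('d p x v - dotv ('d p x v) (foot_normal i x) *:
    foot_normal i x) (proj2 Ox).
have := congr1 (fun z => dotv z (foot_normal i x)) E.
rewrite [LHS]dotvDl [X in _ + X]dotvZl bn mulr0 addr0 => ->.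
by rewrite dotvBl dotvZl -sqr_enorm unit_foot_normal // expr1n mulr1 subrr.
Qed.

(* Differentiate x = p x + t nu, with Dt = nu. *)
Lemma diff_decomp i x v : patch i x ->
  v = 'd p x v + dotv v (foot_normal i x) *: foot_normal i x + foot_coord i x *: 'd
      (foot_normal i) x v.
Proof.
move=> Ox; have E := diff_proj_eq v Ox.
have arg : 'd p x v - dotv ('d p x v) (foot_normal i x) *: foot_normal i x = 'd p x v.
  by rewrite diff_proj_orth // scale0r subr0.
have c : 'd (foot_normal i) x v = _ := etrans (diff_foot_normal v Ox).2 (esym (congr1 ('d (nu
    i) (p x)) arg)).
have key (a b n : 'rV[R]_d) t : a + t *: b = v - dotv v n *: n -> v = a + dotv v n *: n + t *: b.
  by move=> H; rewrite addrAC H subrK.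
by apply: key; exact: etrans (congr1 (fun z => _ + _ *: z) c) E.
Qed.

Lemma diff_proj_base i xi v : patch i xi -> M xi ->
  'd p xi v = v - dotv v (foot_normal i xi) *: foot_normal i xi.
Proof.
move=> Ox Mxi; have t0 : foot_coord i xi = 0.
  by rewrite /foot_coord /normal_coord (nearest_point_id M0 (lt_trans eps0 epsr) rM Mxi) subrr
      dotv0l.
by rewrite -(diff_proj_eq v Ox) t0 scale0r addr0.
Qed.

(** [foot_coord] is the signed distance, whose gradient is the normal: in the product rule for
    $(x-p(x))\cdot n$ the vectors $Dp\,v$ and $Dn\,v$ are orthogonal to $n$, and $x-p(x)$ is a
    multiple of $n$. *)
Lemma diff_foot_coord i x v : patch i x -> differentiable (foot_coord i) x /\
  'd (foot_coord i) x v = dotv (foot_normal i x) v.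
Proof.
move=> Ox; have dp := nearest_point_differentiable Ox.
have [dn _] := diff_foot_normal v Ox.
have dxp : differentiable (fun y => y - p y) x by exact: differentiableB.
have [dt dE] := differentiable_dotv dxp dn; split=> //.
have D1 : 'd (fun y => y - p y) x v = v - 'd p x v.
  have di : differentiable (id : 'rV[R]_d -> 'rV[R]_d) x by exact: ex_diff.
  by apply: (etrans (diff_subE v di dp)); congr (_ - _); rewrite diff_val.
have key (a b n : 'rV[R]_d) t : dotv a n = 0 -> dotv b n = 0 ->
    dotv (v - a) n + dotv (t *: n) b = dotv n v.
  by move=> an bn; rewrite dotvBl an subr0 dotvZl (dotvC n b) bn mulr0 addr0 dotvC.
rewrite (patch_decomp Ox) in dE.
apply: (etrans (dE v)); apply: (etrans (congr1 (fun z => dotv z _ + _) D1)).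
by apply: key; [exact: diff_proj_orth|exact: diff_foot_normal_orth].
Qed.

(* nd i [:: b1; ...; bj] x is D^j n(p x)(e_b1, ..., e_bj): since Dp = P_T on M,
   the derivative of g o p at a point of M is the tangential derivative of g. *)
Fixpoint nd i bs : 'rV[R]_d -> 'rV[R]_d :=
  if bs is b :: bs' then fun x => 'd (nd i bs') (p x) (delta_mx 0 b) else foot_normal i.

Lemma nd_proj i bs x : patch i x -> nd i bs (p x) = nd i bs x.
Proof. by move=> Ox; case: bs => [|b bs] /=; rewrite ?/foot_normal (nearest_pointK Ox). Qed.

Lemma nd_smooth bs c : (size bs <= m)%N ->
  smooth patch nobound (m - size bs) (fun i x => nd i bs x 0 c).
Proof.
elim: bs c => [|b bs IH] c sz.
  by rewrite subn0; apply: foot_normal_smooth.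
have sz' : (size bs < m)%N by [].
have Sm : (m - size bs)%N = (m - size (b :: bs)).+1 by rewrite -subSn // subSS.
have IHc := IH c (ltnW sz').
apply: (@smooth_ext _ _ _ _ _ NC _ (fun i x => 'd (fun y => nd i bs y 0 c) (p x) (delta_mx 0 b))).
  move=> i x Ox; apply: diff_coord; apply: differentiable_rowP => c'.
  have := IH c' (ltnW sz'); rewrite Sm => sc'.
  exact: (smooth_diff (ltn0Sn _) sc' (patch_proj Ox)).
apply: (@smooth_comp _ _ _ patch patch oO _ (fun i y => 'd (fun y => nd i bs y 0 c) y (delta_mx
    0 b)) (fun _ => p)).
- by move=> i x; exact: patch_proj.
- by move=> c'; apply: smooth_leq (sp c'); rewrite leq_subr.
- by apply: smoothD; rewrite -Sm.
Qed.

Lemma nd_differentiable i bs x : (size bs < m)%N -> patch i x -> differentiable (nd i bs) x.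
Proof.
move=> sz Ox; apply: differentiable_rowP => c.
have sc := nd_smooth c (ltnW sz).
by apply: (smooth_diff _ sc Ox); rewrite subn_gt0.
Qed.

(** [nd i bs] depends on [x] through [p x] only: differentiate [nd_proj]. *)
Lemma diff_nd_proj i bs x v : (size bs < m)%N -> patch i x ->
  'd (nd i bs) x v = 'd (nd i bs) (p x) ('d p x v).
Proof.
move=> sz Ox; have d1 := nd_differentiable sz Ox.
have d2 := nd_differentiable sz (patch_proj Ox).
have dp := nearest_point_differentiable Ox.
have [_ E] : differentiable (fun y => nd i bs (p y)) x /\
    ('d (fun y => nd i bs (p y)) x = 'd (nd i bs) x :> (_ -> _)).
  apply: near_eq_diff => //; have := patch_near Ox.
  by apply: filterS => y Oy; rewrite nd_proj.
exact: etrans (esym (congr1 (fun f : _ -> _ => f v) E)) (diff_compE v dp d2).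
Qed.

Lemma diff_nd i bs x v : (size bs < m)%N -> patch i x ->
  'd (nd i bs) x v = \sum_b 'd p x v 0 b *: nd i (b :: bs) x.
Proof. by move=> sz Ox; exact: etrans (diff_nd_proj v sz Ox) (linear_row_delta _ _). Qed.

End NormalFamily.

(** * Tangential derivatives of the normal and their bounds *)

Section NormalBounds.
Context {R : realType} {d : nat} {I : Type}.
Implicit Types (x y xi eta u v w : 'rV[R]_d) (e s : R) (i : I) (bs : seq 'I_d).
Variables (M : set 'rV[R]_d) (r eps : R).
Hypotheses (M0 : M !=set0) (rM : tube M r `<=` unpp M).
Hypotheses (eps0 : 0 < eps) (epsr : eps < r).
Variables (m : nat) (xi0 : I -> 'rV[R]_d) (W : I -> set 'rV[R]_d) (nu : I -> 'rV[R]_d -> 'rV[R]_d).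
Hypotheses (m0 : (0 < m)%N) (LN : forall i, local_normal M m (xi0 i) (W i) (nu i)).

Local Notation p := (nearest_point M).
Local Notation O := (patch M eps W).
Local Notation n_ := (foot_normal M nu).
Local Notation t_ := (foot_coord M nu).
Local Notation nd_ := (nd M nu).
Local Notation ei := (delta_mx 0).
Local Notation pid := (nearest_point_id M0 (lt_trans eps0 epsr) rM).

Lemma foot_normal_base i xi : M xi -> n_ i xi = nu i xi.
Proof. by move=> Mxi; rewrite /foot_normal pid. Qed.

Lemma oproj_tangent i xi v : M xi -> W i xi ->
  oproj (tangent M xi) v = v - dotv v (nu i xi) *: nu i xi.
Proof.
move=> Mxi Wxi; have n1 := normal_unit (LN i) Wxi.
have T u : tangent M xi u <-> dotv (nu i xi) u = 0.
  exact: (tangent_normalP M0 rM eps0 epsr (LN i)).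
have [w wE] : exists w, v - dotv v (nu i xi) *: nu i xi = w by exists (v - dotv v (nu i xi) *:
    nu i xi).
have Tw : dotv (nu i xi) w = 0.
  by rewrite -wE dotvBr dotvZr -sqr_enorm n1 expr1n mulr1 dotvC subrr.
have vw u : tangent M xi u -> dotv (v - w) u = 0.
  by move=> /T u0; rewrite -wE opprB subrKC dotvZl u0 mulr0.
have [/T g0 gP] : tangent M xi (oproj (tangent M xi) v) /\
    forall u, tangent M xi u -> dotv (v - oproj (tangent M xi) v) u = 0.
  apply: (@getPex _ [set w | tangent M xi w /\ forall u, tangent M xi u -> dotv (v - w) u = 0]).
  by exists w; split=> //; apply/T.
move: (oproj (tangent M xi) v) g0 gP => g g0 gP; rewrite wE.
have Tgw : tangent M xi (g - w) by apply/T; rewrite dotvBr g0 Tw subrr.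
have : dotv (g - w) (g - w) = 0.
  have -> : dotv (g - w) (g - w) = dotv (v - w) (g - w) - dotv (v - g) (g - w).
    by rewrite -dotvBl; congr (dotv _ _); apply/rowP => c; rewrite !mxE; ring.
  by rewrite vw // gP // subrr.
by rewrite -sqr_enorm => /eqP; rewrite sqrf_eq0 enorm_eq0 subr_eq0 => /eqP.
Qed.

(** [tderiv] is selected by choice, so uniqueness is needed to compute it. Both candidates factor
    through the tangential projection, and on tangent vectors they are determined by nearby points
    of [M]. *)
Lemma is_tderiv_unique i xi f (L L' : {linear 'rV[R]_d -> 'rV[R]_d}) : M xi -> W i xi ->
  is_tderiv M f xi L -> is_tderiv M f xi L' -> forall v, L v = L' v.
Proof.
move=> Mxi Wxi [L1 L2] [L1' L2'] v.
rewrite L1 L1' (oproj_tangent v Mxi Wxi).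
set u := v - _.
have Tu : tangent M xi u.
  apply/(tangent_normalP M0 rM eps0 epsr (LN i)) => //.
  by rewrite dotvBr dotvZr -sqr_enorm (normal_unit (LN i) Wxi) expr1n mulr1 dotvC subrr.
have [k k0 Hk] := linear_enorm_bound (L \- L').
apply/eqP; rewrite -subr_eq0 -enorm_eq0 eq_le enorm_ge0 andbT.
apply: (@small_le0 _ _ (k + 2 * (enorm u + 1))) => e e0 e1.
have /nbhs_enormP[rho1 rho10 H1] := L2 e e0.
have /nbhs_enormP[rho2 rho20 H2] := L2' e e0.
have v1 : 0 < enorm u + 1 by rewrite ltr_wpDl // enorm_ge0.
have m1 : 0 < Num.min rho1 rho2 / (enorm u + 1) by rewrite divr_gt0 // lt_min rho10.
have [s [eta [s0 sm Meta He]]] := tangent_approx Tu e0 m1.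
have [w wE] : exists w, eta - xi - s *: u = w by exists (eta - xi - s *: u).
have E : eta - xi = s *: u + w by rewrite -wE subrKC.
rewrite wE in He.
have n2 : enorm (eta - xi) <= s * (enorm u + 1).
  rewrite E (le_trans (ler_enormD _ _)) // enormZ ger0_norm ?(ltW s0) // mulrDr lerD2l.
  by rewrite (le_trans He) // mulrC ler_wpM2l ?(ltW s0) ?(ltW e1).
have : enorm (eta - xi) < Num.min rho1 rho2 by rewrite (le_lt_trans n2) // -ltr_pdivlMr.
rewrite lt_min => /andP[/H1/(_ Meta) h1 /H2/(_ Meta) h2].
have e3 : e * enorm (eta - xi) <= e * (s * (enorm u + 1)) by rewrite ler_wpM2l // ltW.
have h3 : enorm (L (eta - xi) - L' (eta - xi)) <= 2 * (e * (s * (enorm u + 1))).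
  have -> : L (eta - xi) - L' (eta - xi) = (f eta - f xi - L' (eta - xi)) - (f eta - f xi - L
      (eta - xi)).
    move: (L (eta - xi)) (L' (eta - xi)) (f eta) (f xi) => a b c c'.
    by apply/rowP => l; rewrite !mxE; ring.
  rewrite (le_trans (ler_enormB _ _)) //; lra.
have h4 : enorm (L w - L' w) <= k * (e * s).
  by rewrite (le_trans (Hk w)) // ler_wpM2l // ltW.
have E5 : s *: (L u - L' u) = (L (eta - xi) - L' (eta - xi)) - (L w - L' w).
  have lE (l : {linear 'rV[R]_d -> 'rV[R]_d}) : l (s *: u + w) = s *: l u + l w by rewrite
      linearD linearZ.
  rewrite E !lE; move: (L u) (L' u) (L w) (L' w) => a1 a2 a3 a4.
  by apply/rowP => c; rewrite !mxE; ring.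
have : enorm (s *: (L u - L' u)) <= s * ((k + 2 * (enorm u + 1)) * e).
  rewrite E5 (le_trans (ler_enormB _ _)) //; lra.
by rewrite enormZ ger0_norm ?(ltW s0) // ler_pM2l.
Qed.

(** Trades the derivative along [M] for the ordinary one of an extension [F]. On [M] the map
    ['d p xi] is the tangential projection, so the second condition on [F] is the factorization that
    [is_tderiv] demands. *)
Lemma tderivE i xi f (F : 'rV[R]_d -> 'rV[R]_d) v : M xi -> W i xi -> differentiable F xi ->
  (forall v, 'd F xi v = 'd F xi ('d p xi v)) ->
  (forall eta, M eta -> W i eta -> f eta = F eta) ->
  tderiv M f xi v = 'd F xi v.
Proof.
move=> Mxi Wxi dF Fp fF.
have Ox : O i xi by exact: (patch_mem M0 rM eps0 epsr).
have isF : is_tderiv M f xi ('d F xi).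
  split=> [u|e e0].
    rewrite (oproj_tangent u Mxi Wxi) (Fp u); congr ('d F xi _).
    by rewrite (diff_proj_base M0 rM eps0 epsr m0 LN u Ox Mxi) foot_normal_base.
  have [rho1 rho10 H1] := diff_approx_enorm dF e0.
  have [rho2 rho20 H2] := open_enorm (normal_open (LN i)) Wxi.
  apply/nbhs_enormP; exists (Num.min rho1 rho2) => [|y]; first by rewrite lt_min rho10.
  by rewrite lt_min => /andP[/H1 y1 /H2 Wy] My; rewrite !fF.
have := @getPex _ [set L | is_tderiv M f xi L] (ex_intro _ _ isF).
by move=> /(is_tderiv_unique Mxi Wxi); apply.
Qed.

Lemma iter_tderiv_nd i bs xi : (size bs <= m)%N -> M xi -> W i xi ->
  iter_tderiv M (nu i) (map ei bs) xi = nd_ i bs xi.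
Proof.
elim: bs xi => [|b bs IH] xi sz Mxi Wxi; first exact: esym (foot_normal_base i Mxi).
have Ox : O i xi by exact: (patch_mem M0 rM eps0 epsr).
have -> : nd_ i (b :: bs) xi = 'd (nd_ i bs) xi (ei b).
  by rewrite -[LHS]/('d (nd_ i bs) (p xi) (ei b)) pid.
apply: (tderivE (ei b) Mxi Wxi (nd_differentiable M0 rM eps0 epsr m0 LN sz Ox)) => [v|eta Meta
    Weta].
  by apply: (etrans (diff_nd_proj M0 rM eps0 epsr m0 LN v sz Ox)); rewrite pid.
by apply: IH => //; exact: ltnW.
Qed.

Let L := (r + eps) / (r - eps).
Let L0 : 0 < L.
Proof. by rewrite divr_gt0 ?subr_gt0 // addr_gt0 // (lt_trans eps0). Qed.

Lemma diff_proj_bound i x v : O i x -> enorm ('d p x v) <= L * enorm v.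
Proof.
move=> Ox; have dp := nearest_point_differentiable M0 rM eps0 epsr m0 LN Ox.
rewrite -subr_le0; apply: (@small_le0 _ _ (enorm v)) => e e0 e1.
have [rho1 rho10 H1] := diff_approx_enorm dp e0.
have [rho2 rho20 H2] := open_enorm (open_patch M0 rM eps0 epsr LN (i := i)) Ox.
have v1 : 0 < enorm v + 1 by rewrite ltr_wpDl // enorm_ge0.
pose h := Num.min rho1 rho2 / (enorm v + 1) .
have h0 : 0 < h by rewrite divr_gt0 // lt_min rho10.
have hv : enorm (x + h *: v - x) = h * enorm v.
  by rewrite addrC addKr enormZ ger0_norm // ltW.
have : enorm (x + h *: v - x) < Num.min rho1 rho2.
  by rewrite hv /h mulrAC ltr_pdivrMr // ltr_pM2l ?lt_min ?rho10 // ltrDl.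
rewrite lt_min => /andP[/H1 y1 /H2 [ty _]].
have := nearest_point_lip M0 rM eps0 epsr ty (proj1 Ox); rewrite -/L hv => y2.
rewrite hv in y1.
have E : 'd p x (x + h *: v - x) = h *: 'd p x v by rewrite addrC addKr linearZ.
rewrite E in y1.
have : enorm (h *: 'd p x v) <= e * (h * enorm v) + L * (h * enorm v).
  have -> : h *: 'd p x v = (p (x + h *: v) - p x) - (p (x + h *: v) - p x - h *: 'd p x v).
    by rewrite opprB addrC subrK.
  by rewrite (le_trans (ler_enormB _ _)) // addrC lerD.
rewrite enormZ ger0_norm ?(ltW h0) // => y3.
rewrite -(ler_pM2l h0); lra.
Qed.

(* nu(eta) - nu(xi) tested against zeta - xi splits into three terms
   nu . (difference of points of M), each quadratically small. *)
Lemma second_form_bound i xi v w : O i xi -> M xi -> enorm v <= 1 -> enorm w <= 1 ->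
  eps * dotv ('d (n_ i) xi v) ('d p xi w) <= 3 * L ^+ 2.
Proof.
move=> Ox Mxi v1 w1.
have dp := nearest_point_differentiable M0 rM eps0 epsr m0 LN Ox.
have [dn _] := diff_foot_normal M0 rM eps0 epsr m0 LN v Ox.
have [a aE] : exists a, 'd (n_ i) xi v = a by exists ('d (n_ i) xi v).
have [b bE] : exists b, 'd p xi w = b by exists ('d p xi w).
suff : eps * dotv a b <= 3 * L ^+ 2 by rewrite -aE -bE.
rewrite -subr_le0.
apply: (@small_le0 _ _ (eps * (enorm a + enorm b + 1))) => e e0 e1.
have [rho1 rho10 H1] := diff_approx_enorm dp e0.
have [rho2 rho20 H2] := diff_approx_enorm dn e0.
have [rho3 rho30 H3] := open_enorm (open_patch M0 rM eps0 epsr LN (i := i)) Ox.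
pose m' := Num.min rho1 (Num.min rho2 rho3).
have m'0 : 0 < m' by rewrite !lt_min rho10 rho20.
pose h := m' / 2; have h0 : 0 < h by rewrite divr_gt0.
have : h < m' by rewrite /h; lra.
rewrite !lt_min => /andP[h1 /andP[h2 h3]].
have hu u : enorm u <= 1 -> enorm (xi + h *: u - xi) <= h.
  move=> u1; rewrite addrC addKr enormZ ger0_norm ?(ltW h0) //.
  by rewrite ler_piMr // ltW.
have Ov := H3 _ (le_lt_trans (hu v v1) h3).
have Ow := H3 _ (le_lt_trans (hu w w1) h3).
have An := H2 _ (le_lt_trans (hu v v1) h2).
have Bn := H1 _ (le_lt_trans (hu w w1) h1).
have Ev : 'd (n_ i) xi (xi + h *: v - xi) = h *: a by rewrite addrC addKr linearZ aE.
have Ew : 'd p xi (xi + h *: w - xi) = h *: b by rewrite addrC addKr linearZ bE.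
rewrite Ev in An; rewrite Ew (pid Mxi) in Bn.
have lv := hu v v1; have lw := hu w w1.
have evh : e * enorm (xi + h *: v - xi) <= e * h by rewrite ler_wpM2l // ltW.
have ewh : e * enorm (xi + h *: w - xi) <= e * h by rewrite ler_wpM2l // ltW.
have Meta := patchM rM epsr Ov; have Mzeta := patchM rM epsr Ow.
have c1 := normal_curvature M0 rM eps0 epsr (LN i) Meta (proj2 Ov) Mzeta.
have c2 := normal_curvature M0 rM eps0 epsr (LN i) Meta (proj2 Ov) Mxi.
have Wxi : W i xi by have := proj2 Ox; rewrite pid.
have c3 := normal_curvature M0 rM eps0 epsr (LN i) Mxi Wxi Mzeta.
have nE : n_ i (xi + h *: v) = nu i (p (xi + h *: v)) by [].
have nxi : n_ i xi = nu i xi by rewrite foot_normal_base.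
rewrite nE nxi in An.
have dvw : enorm (xi + h *: w - (xi + h *: v)) <= 2 * h.
  have := enorm_tri xi (xi + h *: w) (xi + h *: v).
  by rewrite (enormC xi); lra.
have l1 := nearest_point_lip M0 rM eps0 epsr (proj1 Ow) (proj1 Ov).
have l2 := nearest_point_lip M0 rM eps0 epsr (proj1 Ov) (proj1 Ox).
have l3 := nearest_point_lip M0 rM eps0 epsr (proj1 Ow) (proj1 Ox).
rewrite -/L (pid Mxi) in l1 l2 l3.
move: (p (xi + h *: v)) (p (xi + h *: w)) Meta Mzeta An Bn c1 c2 c3 l1 l2 l3 {nE}
  => eta zeta Meta Mzeta An Bn c1 c2 c3 l1 l2 l3.
(* The three squared distances add up to at most $6L^2h^2$; dividing by $2h^2$ leaves the constant
   $3L^2$. *)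
have k1 : enorm (zeta - eta) ^+ 2 <= (2 * L * h) ^+ 2.
  apply: ler_wsqr; first exact: enorm_ge0.
  have : L * enorm (xi + h *: w - (xi + h *: v)) <= L * (2 * h) by rewrite ler_wpM2l // ltW.
  lra.
have k2 : enorm (xi - eta) ^+ 2 <= (L * h) ^+ 2.
  apply: ler_wsqr; first exact: enorm_ge0.
  by rewrite enormC; apply: le_trans l2 _; rewrite ler_wpM2l // ltW.
have k3 : enorm (zeta - xi) ^+ 2 <= (L * h) ^+ 2.
  apply: ler_wsqr; first exact: enorm_ge0.
  by apply: le_trans l3 _; rewrite ler_wpM2l // ltW.
move: (nu i eta) (nu i xi) An c1 c2 c3 => N N' An c1 c2 c3.
have [al alE] : exists al, N - N' - h *: a = al by exists (N - N' - h *: a).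
have [be beE] : exists be, zeta - xi - h *: b = be by exists (zeta - xi - h *: b).
rewrite alE in An; rewrite beE in Bn.
have E1 : N - N' = h *: a + al by rewrite -alE subrKC.
have E2 : zeta - xi = h *: b + be by rewrite -beE subrKC.
have D1 : dotv (N - N') (zeta - xi) = dotv N (zeta - eta) - dotv N (xi - eta) - dotv N' (zeta - xi).
  by rewrite !dotvE; ring.
have D2 : dotv (N - N') (zeta - xi) =
    h ^+ 2 * dotv a b + h * dotv a be + h * dotv al b + dotv al be.
  by rewrite E1 E2 !dotvE; ring.
have {}An : enorm al <= e * h by lra.
have {}Bn : enorm be <= e * h by lra.
have q1 : `|dotv a be| <= enorm a * (e * h).
  by rewrite (le_trans (CauchySchwarz _ _)) // ler_wpM2l ?enorm_ge0.
have q2 : `|dotv al b| <= (e * h) * enorm b.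
  by rewrite (le_trans (CauchySchwarz _ _)) // ler_wpM2r ?enorm_ge0.
have q3 : `|dotv al be| <= (e * h) * (1 * h).
  rewrite (le_trans (CauchySchwarz _ _)) // ler_pM ?enorm_ge0 //.
  by rewrite (le_trans Bn) // ler_wpM2r // ltW.
move: q1 q2 q3; rewrite !ler_norml => /andP[q1 _] /andP[q2 _] /andP[q3 _].
have q1' : h * - (enorm a * (e * h)) <= h * dotv a be by rewrite ler_pM2l.
have q2' : h * - (e * h * enorm b) <= h * dotv al b by rewrite ler_pM2l.
have s1 : h ^+ 2 * dotv a b <= dotv (N - N') (zeta - xi) + h ^+ 2 * (e * (enorm a + enorm b + 1)).
  by rewrite D2; lra.
have a1 := ler_norm (dotv N (zeta - eta)).
have a2 := ler_norm (- dotv N (xi - eta)); rewrite normrN in a2.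
have a3 := ler_norm (- dotv N' (zeta - xi)); rewrite normrN in a3.
have s2 : 2 * eps * dotv (N - N') (zeta - xi) <= 2 * eps * (`|dotv N (zeta - eta)| + `|dotv N
    (xi - eta)| + `|dotv N' (zeta - xi)|).
  by rewrite ler_wpM2l ?mulr_ge0 ?(ltW eps0) //; lra.
have s3 : eps * (h ^+ 2 * dotv a b) <= eps * (dotv (N - N') (zeta - xi) + h ^+ 2 * (e * (enorm
    a + enorm b + 1))).
  by rewrite ler_wpM2l // ltW.
have hh : 0 < h ^+ 2 by rewrite exprn_gt0.
rewrite -(ler_pM2l hh); lra.
Qed.

(** The order that the hypothesis on $D^jn$ leaves out. Test [second_form_bound] with the direction
    of $Dn(e_b)$ itself; as $Dn(e_b)$ is orthogonal to the normal, the projection ['d p] does not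
    change the pairing. *)
Lemma nd1_bound i b x : O i x -> eps * enorm (nd_ i [:: b] x) <= 3 * L ^+ 2.
Proof.
move=> Ox; have Mp := patchM rM epsr Ox.
have Op := patch_proj M0 rM eps0 epsr Ox.
have [a aE] : exists a, 'd (n_ i) (p x) (ei b) = a by exists ('d (n_ i) (p x) (ei b)).
have an : dotv a (n_ i (p x)) = 0.
  by rewrite -aE; exact: (diff_foot_normal_orth M0 rM eps0 epsr m0 LN (ei b) Op).
have H u : enorm u <= 1 -> eps * dotv a ('d p (p x) u) <= 3 * L ^+ 2.
  by move=> u1; rewrite -aE; apply: second_form_bound => //; rewrite enorm_delta.
have -> : nd_ i [:: b] x = a by exact: aE.
have [->|a0] := eqVneq a 0.
  by rewrite enorm0 mulr0 mulr_ge0 // exprn_ge0 // ltW.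
have [u u1 auE] := enorm_polar a0.
have := H u; rewrite u1 => /(_ (lexx _)).
have -> : 'd p (p x) u = u - dotv u (n_ i (p x)) *: n_ i (p x).
  exact: (diff_proj_base M0 rM eps0 epsr m0 LN u Op Mp).
have au : dotv a u = enorm a by rewrite {1}auE dotvZl -sqr_enorm u1 expr1n mulr1.
by rewrite dotvBr dotvZr an mulr0 subr0 au.
Qed.

Lemma local_unit_normal_field i : unit_normal_field M (M `&` W i) (nu i).
Proof.
split.
- by exists (W i) => //; exact: (normal_open (LN i)).
- apply: continuous_in_subspaceT => x; rewrite inE => -[_ Wx].
  by apply: differentiable_continuous; exact: (normal_differentiable m0 (LN i) Wx).
- by move=> eta [_ Weta]; exact: (normal_unit (LN i) Weta).
- by move=> eta [Meta Weta] v /(tangent_normalP M0 rM eps0 epsr (LN i)); apply.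
Qed.

(** At the foot of [x] this is an iterated tangential derivative of an admissible field on basis
    vectors, hence one of the values under the suprema. *)
Lemma nd_bound K i bs x : O i x -> (size bs <= m)%N ->
  (sup_normal_deriv M (size bs) <= K%:E)%E -> enorm (nd_ i bs x) <= K.
Proof.
move=> Ox sz HK; have Mp := patchM rM epsr Ox.
rewrite -(nd_proj M0 rM eps0 epsr nu bs Ox) -(iter_tderiv_nd sz Mp (proj2 Ox)).
rewrite -lee_fin; apply: le_trans HK.
pose op := opnorm (fun vs : (size bs).-tuple 'rV[R]_d => iter_tderiv M (nu i) vs (p x)).
apply: (@le_trans _ _ op).
  apply: ereal_sup_ubound; have szb : size (map ei bs : seq 'rV[R]_d) == size bs by apply/eqP;
      exact: size_map.
  exists (Tuple szb) => //= c.
  by have /mapP[b _ ->] := mem_tnth c (Tuple szb); rewrite enorm_delta.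
apply: ereal_sup_ubound; exists (p x), (M `&` W i), (nu i); split=> //.
- exact: local_unit_normal_field.
- by split=> //; exact: proj2 Ox.
Qed.

End NormalBounds.

Lemma diff_lincombE (R : realType) (V W : normedModType R) n (a : 'I_n -> R)
    (F : 'I_n -> V -> W) x v : (forall b, differentiable (F b) x) ->
  differentiable (fun y => \sum_b a b *: F b y) x /\
  'd (fun y => \sum_b a b *: F b y) x v = \sum_b a b *: 'd (F b) x v.
Proof.
move=> dF; have E : (fun y => \sum_b a b *: F b y) = \sum_b (a b *: F b).
  by apply/funext => y; rewrite fct_sumE.
have dZ b : differentiable (a b *: F b) x by apply: differentiableZ.
have dS : differentiable (\sum_b (a b *: F b)) x by apply: differentiable_sum.
rewrite E; split=> //; rewrite -deriveE // derive_sum; last by move=> b; exact: diff_derivable.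
apply: eq_bigr => b _; rewrite deriveZ; last exact: diff_derivable.
by rewrite deriveE.
Qed.

Lemma diff_sumE (R : realType) (V W : normedModType R) n (F : 'I_n -> V -> W) x v :
  (forall b, differentiable (F b) x) ->
  differentiable (fun y => \sum_b F b y) x /\
  'd (fun y => \sum_b F b y) x v = \sum_b 'd (F b) x v.
Proof.
move=> dF; have E : (fun y => \sum_b F b y) = \sum_b F b.
  by apply/funext => y; rewrite fct_sumE.
have dS : differentiable (\sum_b F b) x by apply: differentiable_sum.
rewrite E; split=> //; rewrite -deriveE // derive_sum; last by move=> b; exact: diff_derivable.
by apply: eq_bigr => b _; rewrite deriveE.
Qed.

(** * From basis vectors to operator norms of iterated derivatives *)

Section IteratedDerivatives.
Context {R : realType} {d : nat} {I : Type}.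
Implicit Types (x u v w : 'rV[R]_d) (f g : 'rV[R]_d -> 'rV[R]_d) (bs : seq 'I_d) (vs : seq
    'rV[R]_d).
Variables (O : I -> set 'rV[R]_d) (B : (I -> 'rV[R]_d -> R) -> Prop).
Hypothesis BC : bound_class O B.

Definition smoothv j f := forall c, smooth O B j (fun _ x => f x 0 c).

Lemma smoothv_diff j f i x : (0 < j)%N -> smoothv j f -> O i x -> differentiable f x.
Proof.
by move=> j0 sf Ox; apply: differentiable_rowP => c; exact: (smooth_diff j0 (sf c) Ox).
Qed.

Lemma smoothvD j f v : smoothv j.+1 f -> smoothv j (fun x => 'd f x v).
Proof.
move=> sf c; apply: (smooth_ext BC _ (smoothD v (sf c))) => i x Ox.
by apply: diff_coord; exact: smoothv_diff (ltn0Sn j) sf Ox.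
Qed.

Lemma smoothv_iterD j f vs : (size vs <= j)%N -> smoothv j f ->
  smoothv (j - size vs) (iterD f vs).
Proof.
elim/last_ind: vs j f => [|vs v IH] j f; first by rewrite subn0.
rewrite size_rcons iterD_rcons; case: j => // j; rewrite ltnS subSS => sz sf.
by apply: IH => //; exact: smoothvD.
Qed.

Lemma iterD_lincomb n (a : 'I_n -> R) (g : 'I_n -> 'rV[R]_d -> 'rV[R]_d) h j vs i x :
  (forall b, smoothv j (g b)) -> (size vs <= j)%N ->
  (forall y, O i y -> h y = \sum_b a b *: g b y) -> O i x ->
  iterD h vs x = \sum_b a b *: iterD (g b) vs x.
Proof.
move=> sg; elim: vs x => [|v vs IH] x sz hE Ox; first exact: hE.
have sz' : (size vs < j)%N by [].
have dg b : differentiable (iterD (g b) vs) x.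
  by apply: (smoothv_diff _ (smoothv_iterD (ltnW sz') (sg b)) Ox); rewrite subn_gt0.
have [dS dE] := diff_lincombE a v dg.
have [_ E] : differentiable (iterD h vs) x /\
   ('d (iterD h vs) x = 'd (fun y => \sum_b a b *: iterD (g b) vs y) x :> (_ -> _)).
  apply: near_eq_diff => //.
  have : nbhs x (O i) by apply: open_nbhs_nbhs; split=> //; exact: bound_open BC i.
  by apply: filterS => y Oy; rewrite IH // ltnW.
exact: etrans (congr1 (fun F : _ -> _ => F v) E) dE.
Qed.

(** Multilinearity: a vector of norm at most 1 has coordinates at most 1 in absolute value, so each
    slot costs a factor [d]. *)
Lemma iterD_expand j f K i x : smoothv j f -> O i x ->
  (forall bs, size bs = j -> enorm (iterD f (map (delta_mx 0) bs) x) <= K) ->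
  forall vs, size vs = j -> (forall v, v \in vs -> enorm v <= 1) ->
  enorm (iterD f vs x) <= d%:R ^+ j * K.
Proof.
move=> + Ox; elim: j f => [|j IH] f sf HK vs szvs vs1.
  by rewrite expr0 mul1r (size0nil szvs); exact: (HK [::]).
case/lastP: vs szvs vs1 => // vs v; rewrite size_rcons iterD_rcons => -[szvs] vs1.
have v1 : enorm v <= 1 by apply: vs1; rewrite mem_rcons mem_head.
have dE y : O i y -> 'd f y v = \sum_b v 0 b *: 'd f y (delta_mx 0 b).
  by move=> _; exact: linear_row_delta.
have sD b : smoothv j (fun y => 'd f y (delta_mx 0 b)) by exact: smoothvD.
rewrite (iterD_lincomb sD _ dE Ox) ?szvs //.
apply: le_trans (ler_enorm_sum _) _.
apply: (@le_trans _ _ (\sum_(b < d) d%:R ^+ j * K)); last first.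
  by rewrite sumr_const card_ord exprS -mulrA mulr_natl.
apply: ler_sum => b _; rewrite enormZ.
have := IH _ (sD b) _ vs szvs => /(_ _ _) Hb.
apply: (@le_trans _ _ (1 * enorm (iterD (fun y => 'd f y (delta_mx 0 b)) vs x))).
  rewrite ler_wpM2r ?enorm_ge0 // (le_trans (ler_coord_enorm v b)) //.
rewrite mul1r; apply: Hb => [bs szbs|u uvs].
  have := HK (rcons bs b); rewrite size_rcons szbs map_rcons iterD_rcons; exact.
by apply: vs1; rewrite mem_rcons inE uvs orbT.
Qed.

End IteratedDerivatives.

(** * Bounds uniform over all patches *)

Section UniformBounds.
Context {R : realType} {d : nat} {I : Type}.
Implicit Types (x y xi eta u v w : 'rV[R]_d) (e s : R) (i : I) (bs : seq 'I_d).
Variables (M : set 'rV[R]_d) (r eps : R).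
Hypotheses (M0 : M !=set0) (rM : tube M r `<=` unpp M).
Hypotheses (eps0 : 0 < eps) (epsr : eps < r).
Variables (m : nat) (xi0 : I -> 'rV[R]_d) (W : I -> set 'rV[R]_d) (nu : I -> 'rV[R]_d -> 'rV[R]_d).
Hypotheses (m1 : (1 < m)%N) (LN : forall i, local_normal M m (xi0 i) (W i) (nu i)).

Local Notation p := (nearest_point M).
Local Notation O := (patch M eps W).
Local Notation n_ := (foot_normal M nu).
Local Notation t_ := (foot_coord M nu).
Local Notation nd_ := (nd M nu).
Local Notation ei := (delta_mx 0).

Let m0 : (0 < m)%N := ltnW m1.
Let oO := open_patch M0 rM eps0 epsr LN.

Definition unif (f : I -> 'rV[R]_d -> R) := exists C, forall i x, O i x -> `|f i x| <= C.

Lemma unif_class : bound_class O unif.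
Proof.
split=> //.
- by move=> f g fg [C HC]; exists C => i x Ox; rewrite -fg // HC.
- by move=> c; exists `|c|.
- move=> f g [C HC] [C' HC']; exists (C + C') => i x Ox.
  by rewrite (le_trans (ler_normD _ _)) // lerD ?HC ?HC'.
- move=> f g [C HC] [C' HC']; exists (C * C') => i x Ox.
  by rewrite normrM ler_pM ?HC ?HC'.
Qed.

Let UC := unif_class.
Let NC : bound_class O nobound := nobound_class oO.

Lemma diff_proj_smooth v : smoothv O nobound m.-1 (fun x => 'd p x v).
Proof.
apply: (smoothvD NC) => c; rewrite prednK //.
exact: (nearest_point_smooth M0 rM eps0 epsr m0 LN c).
Qed.

Lemma diff_proj_differentiable v i x : O i x -> differentiable (fun x => 'd p x v) x.
Proof.
move=> Ox; apply: (smoothv_diff _ (diff_proj_smooth v) Ox).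
by rewrite -ltnS prednK.
Qed.

Lemma nd_sum i x (z : 'rV[R]_d) : O i x -> \sum_b z 0 b *: nd_ i [:: b] x = 'd (n_ i) (p x) z.
Proof. by move=> _; exact: esym (linear_row_delta _ _). Qed.

Lemma diff_foot_normal_nd i x v : O i x -> 'd (n_ i) x v = \sum_b 'd p x v 0 b *: nd_ i [:: b] x.
Proof. exact: (diff_nd M0 rM eps0 epsr m0 LN v (bs := [::]) m0). Qed.

(** The normal at the foot is constant along normal rays: it factors through [p], and $Dp$ kills the
    normal at points of [M]. *)
Lemma nd_normal0 i x : O i x -> 'd (n_ i) (p x) (n_ i x) = 0.
Proof.
move=> Ox; have Op := patch_proj M0 rM eps0 epsr Ox.
have nE : n_ i (p x) = n_ i x by exact: (nd_proj M0 rM eps0 epsr nu [::] Ox).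
have n1 : enorm (n_ i x) = 1 by exact: (unit_foot_normal LN Ox).
have [z zE] : exists z, 'd p (p x) (n_ i x) = z by exists ('d p (p x) (n_ i x)).
have z0 : z = 0.
  rewrite -zE; apply: (etrans (diff_proj_base M0 rM eps0 epsr m0 LN _ Op (patchM rM epsr Ox))).
  by rewrite nE -sqr_enorm n1 expr1n scale1r subrr.
have pp : p (p x) = p x by exact: (nearest_pointK M0 rM eps0 epsr Ox).
apply: (etrans (diff_nd_proj M0 rM eps0 epsr m0 LN (n_ i x) (bs := [::]) m0 Op)).
apply: (etrans (congr1 ('d (nd_ i [::]) (p (p x))) (etrans zE z0))).
exact: linear0.
Qed.

(* Dp + nu^T nu inverts 1 + t A, where A is the derivative of the normal. *)
Lemma shape_inverse i x (X Q : 'rV[R]_d) : O i x ->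
  X + t_ i x *: (\sum_b X 0 b *: nd_ i [:: b] x) = Q ->
  X = 'd p x Q + dotv Q (n_ i x) *: n_ i x.
Proof.
move=> Ox XQ.
pose JA : 'M[R]_d := \matrix_(b, c) nd_ i [:: b] x 0 c.
pose Jp : 'M[R]_d := lin1_mx ('d p x).
have JAE u : u *m JA = \sum_b u 0 b *: nd_ i [:: b] x.
  by apply/rowP => c; rewrite mxE summxE; apply: eq_bigr => b _; rewrite !mxE.
have nnE u : u *m ((n_ i x)^T *m n_ i x) = dotv u (n_ i x) *: n_ i x.
  rewrite mulmxA [u *m _^T]mx11_scalar mul_scalar_mx; congr (_ *: _).
  by rewrite !mxE; apply: eq_bigr => b _; rewrite mxE.
have JpE u : u *m Jp = 'd p x u by rewrite mul_rV_lin1.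
have inv1 : (Jp + (n_ i x)^T *m n_ i x) *m (1%:M + t_ i x *: JA) = 1%:M.
  apply/row_matrixP => a; rewrite !rowE mulmx1; move: (ei a : 'rV[R]_d) => u.
  rewrite mulmxA [u *m (Jp + _)]mulmxDr JpE nnE.
  rewrite mulmxDr mulmx1 -scalemxAr JAE.
  have lin (l : {linear 'rV[R]_d -> 'rV[R]_d}) z z' k : l (z + k *: z') = l z + k *: l z'.
    by rewrite linearD linearZ.
  have S1 : \sum_b ('d p x u + dotv u (n_ i x) *: n_ i x) 0 b *: nd_ i [:: b] x = 'd (n_ i) x u.
    apply: (etrans (nd_sum _ Ox)); apply: (etrans (lin _ _ _ _)).
    apply: (etrans (congr1 (fun z => _ + _ *: z) (nd_normal0 Ox))).
    rewrite scaler0 addr0; apply: (etrans (esym (nd_sum _ Ox))).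
    exact: esym (diff_foot_normal_nd u Ox).
  apply: (etrans (congr1 (fun z => _ + _ *: z) S1)).
  exact: esym (diff_decomp M0 rM eps0 epsr m0 LN u Ox).
(* [diff_decomp] yields the product in one order; solving for [X] takes the other. *)
have inv2 := mulmx1C inv1.
have XE : X *m (1%:M + t_ i x *: JA) = Q by rewrite mulmxDr mulmx1 -scalemxAr JAE.
have EX : X = Q *m (Jp + (n_ i x)^T *m n_ i x) by rewrite -XE -mulmxA inv2 mulmx1.
by apply: (etrans EX); rewrite mulmxDr JpE nnE.
Qed.

(* What differentiating v = Dp v + <nu, v> nu + t A (Dp v) in the direction w
   leaves besides D^2 p(v, w) + t A (D^2 p(v, w)). *)
Definition second_rhs v w i x :=
  dotv ('d (n_ i) x w) v *: n_ i x + dotv (n_ i x) v *: 'd (n_ i) x w +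
  (dotv (n_ i x) w *: (\sum_b 'd p x v 0 b *: nd_ i [:: b] x) +
   t_ i x *: \sum_b 'd p x v 0 b *: 'd (nd_ i [:: b]) x w).

(** Differentiating [diff_decomp] with [v] fixed gives an equation $X+tAX=Q$ for $X=D^2p(v,w)$, and
    [shape_inverse] solves it. The result contains no inverse matrix, so sums and products suffice
    to bound it. *)
Lemma second_derivative_proj v w i x : O i x ->
  'd (fun y => 'd p y v) x w =
  'd p x (- second_rhs v w i x) + dotv (- second_rhs v w i x) (n_ i x) *: n_ i x.
Proof.
move=> Ox; apply: (shape_inverse Ox).
have dP := diff_proj_differentiable v Ox.
have [dn _] := diff_foot_normal M0 rM eps0 epsr m0 LN w Ox.
have [dt dtE] := diff_foot_coord M0 rM eps0 epsr m0 LN w Ox.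
have dnd b : differentiable (nd_ i [:: b]) x by exact: (nd_differentiable M0 rM eps0 epsr m0 LN).
have dc (f : 'rV[R]_d -> 'rV[R]_d) c : differentiable f x -> differentiable (fun y => f y 0 c) x.
  exact: differentiable_entry.
have [dB dBE] := differentiable_dotv dn (differentiable_cst v x).
have [X XE] : exists X, 'd (fun y => 'd p y v) x w = X by exists ('d (fun y => 'd p y v) x w).
have [N NE] : exists N, 'd (n_ i) x w = N by exists ('d (n_ i) x w).
have [P PE] : exists P, 'd p x v = P by exists ('d p x v).
have [D DE] : exists D : 'I_d -> 'rV[R]_d, (fun b => 'd (nd_ i [:: b]) x w) = D.
  by exists (fun b => 'd (nd_ i [:: b]) x w).
suff G : X + t_ i x *: (\sum_b X 0 b *: nd_ i [:: b] x) =
    - (dotv N v *: n_ i x + dotv (n_ i x) v *: N +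
      (dotv (n_ i x) w *: (\sum_b P 0 b *: nd_ i [:: b] x) + t_ i x *: \sum_b P 0 b *: D b)).
  by subst X N P D; exact: G.
apply/rowP => c.
pose A y := 'd p y v 0 c.
pose Bf y := dotv (n_ i y) v * n_ i y 0 c.
pose S y := \sum_b 'd p y v 0 b * nd_ i [:: b] y 0 c.
have dA : differentiable A x by exact: (dc (fun y => 'd p y v)).
have dBf : differentiable Bf x by apply: differentiableM => //; exact: dc.
have dSb b : differentiable (fun y => 'd p y v 0 b * nd_ i [:: b] y 0 c) x.
  by apply: differentiableM; [exact: (dc (fun y => 'd p y v))|exact: dc].
have [dS dSE] := diff_sumE w dSb.
have dTS : differentiable (fun y => t_ i y * S y) x by apply: differentiableM.
have dTS' : differentiable (fun y => Bf y + t_ i y * S y) x by apply: differentiableD.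
(* By coordinate [c] of [diff_decomp] this function is constant, equal to [v 0 c], near [x]. *)
have dcst0 : 'd (fun y => A y + (Bf y + t_ i y * S y)) x w = 0.
  have [_ E] : differentiable (fun y => A y + (Bf y + t_ i y * S y)) x /\
      ('d (fun y => A y + (Bf y + t_ i y * S y)) x = 'd (cst (v 0 c)) x :> (_ -> _)).
    apply: near_eq_diff; last exact: differentiable_cst.
    have : nbhs x (O i) by apply: open_nbhs_nbhs.
    apply: filterS => y Oy; rewrite /cst.
    have vE := diff_decomp M0 rM eps0 epsr m0 LN v Oy.
    have nE := diff_foot_normal_nd v Oy.
    have {}vE := etrans vE (congr1 (fun z => _ + _ *: z) nE).
    have := congr1 (fun z : 'rV[R]_d => z 0 c) vE; rewrite !mxE => ->.
    rewrite /A /Bf /S -addrA (dotvC v) summxE; congr (_ + (_ + _ * _)).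
    by apply: eq_bigr => b _; rewrite mxE.
  by apply: (etrans (congr1 (fun F : _ -> _ => F w) E)); rewrite diff_cst.
have X0 := etrans (esym (diff_addE w dA dTS')) dcst0.
have XB := diff_addE w dBf dTS.
have XBf : 'd Bf x w = dotv (n_ i x) v * N 0 c + n_ i x 0 c * dotv N v.
  apply: (etrans (diff_mulE w dB (dc _ c dn))); congr (_ * _ + _ * _).
    exact: (etrans (diff_coord w c dn) (congr1 (fun z : 'rV[R]_d => z 0 c) NE)).
  have c0 : 'd (cst v) x w = 0 by rewrite diff_cst.
  apply: (etrans (dBE w)); apply: (etrans (congr1 (fun z => _ + dotv _ z) c0)).
  rewrite dotv0r addr0; exact: (congr1 (fun z => dotv z v) NE).
have XS : 'd S x w = \sum_b (P 0 b * D b 0 c + nd_ i [:: b] x 0 c * X 0 b).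
  apply: (etrans dSE); apply: eq_bigr => b _.
  apply: (etrans (diff_mulE w (dc (fun y => 'd p y v) b dP) (dc _ c (dnd b)))).
  congr (_ * _ + _ * _).
  - exact: (congr1 (fun z : 'rV[R]_d => z 0 b) PE).
  - exact: (etrans (diff_coord w c (dnd b)) (congr1 (fun F : 'I_d -> 'rV[R]_d => F b 0 c) DE)).
  - exact: (etrans (diff_coord w b dP) (congr1 (fun z : 'rV[R]_d => z 0 b) XE)).
have SE : S x = \sum_b P 0 b * nd_ i [:: b] x 0 c.
  by apply: eq_bigr => b _; congr (_ * _); exact: (congr1 (fun z : 'rV[R]_d => z 0 b) PE).
have XTS : 'd (fun y => t_ i y * S y) x w = t_ i x * 'd S x w + S x * dotv (n_ i x) w.
  by apply: (etrans (diff_mulE w dt dS)); congr (_ + _ * _).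
have XA : 'd A x w = X 0 c := etrans (diff_coord w c dP) (congr1 (fun z : 'rV[R]_d => z 0 c) XE).
have XTS' := etrans XTS (f_equal2 (fun z z' => t_ i x * z + z' * dotv (n_ i x) w) XS SE).
have F := etrans (esym (f_equal2 +%R XA (etrans XB (f_equal2 +%R XBf XTS')))) X0.
rewrite !(mxE, summxE); move: F; rewrite big_split /=.
have -> : \sum_b (P 0 b *: nd_ i [:: b] x) 0 c = \sum_b P 0 b * nd_ i [:: b] x 0 c.
  by apply: eq_bigr => b _; rewrite mxE.
have -> : \sum_b (P 0 b *: D b) 0 c = \sum_b P 0 b * D b 0 c.
  by apply: eq_bigr => b _; rewrite mxE.
have -> : \sum_b (X 0 b *: nd_ i [:: b] x) 0 c = \sum_b nd_ i [:: b] x 0 c * X 0 b.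
  by apply: eq_bigr => b _; rewrite mxE mulrC.
by move=> F; apply/eqP; rewrite -addr_eq0; apply/eqP; rewrite -[RHS]F; ring.
Qed.

Lemma smooth_unifS j f (g : 'rV[R]_d -> I -> 'rV[R]_d -> R) : unif f ->
  (forall i x, O i x -> differentiable (f i) x) ->
  (forall w, smooth O unif j (g w)) ->
  (forall w i x, O i x -> 'd (f i) x w = g w i x) -> smooth O unif j.+1 f.
Proof.
move=> uf df sg fg; split=> //; split=> // w.
by apply: (smooth_ext UC _ (sg w)) => i x Ox; exact: esym (fg w i x Ox).
Qed.

Lemma smooth_dotv B j (f g : I -> 'rV[R]_d -> 'rV[R]_d) : bound_class O B ->
  (forall c, smooth O B j (fun i x => f i x 0 c)) ->
  (forall c, smooth O B j (fun i x => g i x 0 c)) ->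
  smooth O B j (fun i x => dotv (f i x) (g i x)).
Proof. by move=> BC sf sg; apply: (smooth_sum BC) => c; apply: (smooth_mul BC). Qed.

Hypothesis nd_bounded : exists C, forall i bs x, O i x -> (0 < size bs <= m)%N ->
  enorm (nd_ i bs x) <= C.

(** The four claims go by one induction, because the derivative of each quantity is a polynomial in
    all of them. The step to [j.+1] for $Dp$ uses second derivatives of $n$ to order [j];
    [j.+1 <= m.-1] is exactly the condition [2 + j <= m] for these. *)
Lemma smooth_unif j : (j <= m.-1)%N -> [/\
  forall v c, smooth O unif j (fun _ x => 'd p x v 0 c),
  forall c, smooth O unif j (fun i x => n_ i x 0 c),
  smooth O unif j t_ &
  forall bs c, (0 < size bs)%N -> (size bs + j <= m)%N ->
    smooth O unif j (fun i x => nd_ i bs x 0 c)].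
Proof.
have uP v c : unif (fun _ x => 'd p x v 0 c).
  exists ((r + eps) / (r - eps) * enorm v) => i x Ox.
  apply: le_trans (ler_coord_enorm _ _) _.
  exact: (diff_proj_bound M0 rM eps0 epsr m0 LN v Ox).
have un c : unif (fun i x => n_ i x 0 c).
  exists 1 => i x Ox; apply: le_trans (ler_coord_enorm _ _) _.
  by rewrite (unit_foot_normal LN Ox).
have ut : unif t_.
  by exists eps => i x Ox; exact: (patch_coord_le M0 rM eps0 epsr LN Ox).
have und bs c : (0 < size bs <= m)%N -> unif (fun i x => nd_ i bs x 0 c).
  have [C HC] := nd_bounded; move=> sz; exists C => i x Ox.
  by apply: le_trans (ler_coord_enorm _ _) _; exact: HC.
elim: j => [|j IH] jm.
  split=> [v c|c||bs c bs0 sz]; split=> //.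
  by apply: und; rewrite bs0 -[size bs]addn0.
have [sP sn st snd] := IH (ltnW jm).
have jm1 : (j.+1 < m)%N by rewrite -(ltn_predK m0) ltnS.
have snd1 b c : smooth O unif j (fun i x => nd_ i [:: b] x 0 c).
  by apply: snd => //; rewrite add1n ltnW.
have sDnd bs c w : (size bs < m)%N -> (size bs + j < m)%N ->
    smooth O unif j (fun i x => 'd (nd_ i bs) x w 0 c).
  move=> sz szj; apply: (@smooth_ext _ _ _ _ _ UC j (fun i x => \sum_b 'd p x w 0 b * nd_ i (b
      :: bs) x 0 c)).
    move=> i x Ox; apply: esym.
    apply: (etrans (congr1 (fun z : 'rV[R]_d => z 0 c) (diff_nd M0 rM eps0 epsr m0 LN w sz Ox))).
    by rewrite summxE; apply: eq_bigr => b _; rewrite mxE.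
  by apply: (smooth_sum UC) => b; apply: (smooth_mul UC) => //; apply: snd.
have sDn c w : smooth O unif j (fun i x => 'd (n_ i) x w 0 c).
  by apply: (sDnd [::]) => //; rewrite add0n ltnW.
have snv v : smooth O unif j (fun i x => dotv (n_ i x) v).
  by apply: smooth_dotv => // c; exact: (smooth_cst UC).
have sQ v w c : smooth O unif j (fun i x => second_rhs v w i x 0 c).
  apply: (@smooth_ext _ _ _ _ _ UC j (fun i x =>
    dotv ('d (n_ i) x w) v * n_ i x 0 c + dotv (n_ i x) v * 'd (n_ i) x w 0 c +
    (dotv (n_ i x) w * (\sum_b 'd p x v 0 b * nd_ i [:: b] x 0 c) +
     t_ i x * \sum_b 'd p x v 0 b * 'd (nd_ i [:: b]) x w 0 c))).
    move=> i x Ox; rewrite /second_rhs.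
    have [D DE] : exists D : 'I_d -> 'rV[R]_d, (fun b => 'd (nd_ i [:: b]) x w) = D.
      by exists (fun b => 'd (nd_ i [:: b]) x w).
    have [N NE] : exists N, 'd (n_ i) x w = N by exists ('d (n_ i) x w).
    have [P PE] : exists P, 'd p x v = P by exists ('d p x v).
    suff G : dotv N v * n_ i x 0 c + dotv (n_ i x) v * N 0 c +
       (dotv (n_ i x) w * (\sum_b P 0 b * nd_ i [:: b] x 0 c) + t_ i x * \sum_b P 0 b * D b 0 c) =
       (dotv N v *: n_ i x + dotv (n_ i x) v *: N +
        (dotv (n_ i x) w *: (\sum_b P 0 b *: nd_ i [:: b] x) + t_ i x *: \sum_b P 0 b *: D b)) 0 c.
      by subst N P D; exact: G.
    rewrite !(mxE, summxE); congr (_ + (_ * _ + _ * _)); apply: eq_bigr => b _; by rewrite mxE.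
  have sDv : smooth O unif j (fun i x => dotv ('d (n_ i) x w) v).
    by apply: (smooth_dotv UC) => [c'|c']; [exact: sDn|exact: (smooth_cst UC)].
  have s1 : smooth O unif j (fun i x => \sum_b 'd p x v 0 b * nd_ i [:: b] x 0 c).
    by apply: (smooth_sum UC) => b; apply: (smooth_mul UC); [exact: sP|exact: snd1].
  have s2 : smooth O unif j (fun i x => \sum_b 'd p x v 0 b * 'd (nd_ i [:: b]) x w 0 c).
    apply: (smooth_sum UC) => b; apply: (smooth_mul UC); first exact: sP.
    by apply: sDnd => //; rewrite add1n.
  exact: (smooth_add UC
    (smooth_add UC (smooth_mul UC sDv (sn c)) (smooth_mul UC (snv v) (sDn c w)))
    (smooth_add UC (smooth_mul UC (snv w) s1) (smooth_mul UC st s2))).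
split.
- move=> v c; apply: (smooth_unifS (g := fun w i x =>
    \sum_b - second_rhs v w i x 0 b * 'd p x (ei b) 0 c +
    (\sum_b - second_rhs v w i x 0 b * n_ i x 0 b) * n_ i x 0 c)) => //.
  + move=> i x Ox; apply: (@differentiable_entry _ _ _ (fun y => 'd p y v)).
    exact: (diff_proj_differentiable v Ox).
  + move=> w; have sQ' c' : smooth O unif j (fun i x => - second_rhs v w i x 0 c').
      by apply: (smooth_opp UC); exact: sQ.
    apply: (smooth_add UC); first by apply: (smooth_sum UC) => b; apply: (smooth_mul UC).
    by apply: (smooth_mul UC) => //; apply: (smooth_sum UC) => b; apply: (smooth_mul UC).
  + move=> w i x Ox.
    have dP := diff_proj_differentiable v Ox.
    apply: (etrans (diff_coord w c dP)).
    apply: (etrans (congr1 (fun z : 'rV[R]_d => z 0 c) (second_derivative_proj v w Ox))).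
    move: (second_rhs v w i x) => Q.
    have E := linear_row_delta ('d p x) (- Q).
    have {}E := congr1 (fun z : 'rV[R]_d => (z + dotv (- Q) (n_ i x) *: n_ i x) 0 c) E.
    apply: (etrans E); rewrite mxE summxE mxE; congr (_ + _ * _).
      by apply: eq_bigr => b _; rewrite !mxE.
    by apply: eq_bigr => b _; rewrite mxE.
- move=> c; apply: (smooth_unifS (g := fun w i x => 'd (n_ i) x w 0 c)).
  + exact: un.
  + move=> i x Ox; apply: (@differentiable_entry _ _ _ (n_ i)).
    by have [] := diff_foot_normal M0 rM eps0 epsr m0 LN 0 Ox.
  + by move=> w; exact: sDn.
  + move=> w i x Ox; apply: diff_coord.
    by have [] := diff_foot_normal M0 rM eps0 epsr m0 LN 0 Ox.
- apply: (smooth_unifS (g := fun w i x => dotv (n_ i x) w)).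
  + exact: ut.
  + by move=> i x Ox; have [] := diff_foot_coord M0 rM eps0 epsr m0 LN 0 Ox.
  + by move=> w; exact: snv.
  + by move=> w i x Ox; have [] := diff_foot_coord M0 rM eps0 epsr m0 LN w Ox.
- move=> bs c bs0; rewrite addnS => szj.
  have sz : (size bs < m)%N by apply: leq_ltn_trans szj; rewrite leq_addr.
  apply: (smooth_unifS (g := fun w i x => 'd (nd_ i bs) x w 0 c)).
  + by apply: und; rewrite bs0 ltnW.
  + move=> i x Ox; apply: (@differentiable_entry _ _ _ (nd_ i bs)).
    exact: (nd_differentiable M0 rM eps0 epsr m0 LN sz Ox).
  + by move=> w; apply: sDnd.
  + move=> w i x Ox; apply: diff_coord.
    exact: (nd_differentiable M0 rM eps0 epsr m0 LN sz Ox).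
Qed.

Lemma bounded_deriv_nearest_point j : (forall x, tube M eps x -> exists i, O i x) ->
  (0 < j <= m)%N -> bounded_deriv j (tube M eps) p.
Proof.
move=> cover /andP[j0 jm].
have sp : smoothv O nobound m p.
  by move=> c; exact: (nearest_point_smooth M0 rM eps0 epsr m0 LN c).
split=> [vs szvs x /cover[i Ox]|].
  have szm := leq_trans szvs jm.
  by apply: (smoothv_diff _ (smoothv_iterD NC (ltnW szm) sp) Ox); rewrite subn_gt0.
have [sP _ _ _] := smooth_unif (leqnn m.-1).
(* [p] is unbounded if [M] is, so the bounds start at $Dp$: the first derivative is split off and
   the other [j.-1] are taken of $Dp(e_b)$. *)
have bd bs : size bs = j -> exists C, forall i x, O i x -> enorm (iterD p (map ei bs) x) <= C.
  case/lastP: bs => [|bs b]; first by move=> j0'; rewrite -j0' in j0.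
  rewrite size_rcons map_rcons => szj.
  have szb : (size (map ei bs : seq 'rV[R]_d) <= m.-1)%N.
    by rewrite size_map -ltnS szj prednK.
  have s1 : smoothv O unif m.-1 (fun x => 'd p x (ei b)) by exact: sP.
  have /fin_all_exists[C HC] c := smooth_bound (smoothv_iterD UC szb s1 c).
  exists (d.+1%:R * \sum_c `|C c|) => i x Ox; rewrite iterD_rcons.
  apply: le_trans (ler_enorm_norm _) _; rewrite ler_wpM2l //.
  rewrite /Num.Def.normr /= mx_normrE; apply: bigmax_le.
    by apply: sumr_ge0 => c _; exact: normr_ge0.
  move=> [a c] _ /=; rewrite ord1; apply: le_trans (HC c i x Ox) _.
  rewrite (bigD1 c) //= (le_trans (ler_norm _)) // lerDl.
  by apply: sumr_ge0 => c' _; exact: normr_ge0.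
(* There are finitely many tuples of basis vectors, so the sum of their constants serves for all. *)
have [K HK] : exists K, forall bs i x, size bs = j -> O i x -> enorm (iterD p (map ei bs) x) <= K.
  have /fin_all_exists[C HC] (bs : j.-tuple 'I_d) := bd bs (size_tuple bs).
  exists (\sum_bs `|C bs|) => bs i x /eqP szb Ox.
  apply: le_trans (HC (Tuple szb) i x Ox) _.
  rewrite (bigD1 (Tuple szb)) //= (le_trans (ler_norm _)) // lerDl.
  by apply: sumr_ge0 => bs' _; exact: normr_ge0.
exists (d%:R ^+ j * K) => x /cover[i Ox].
apply: ge_ereal_sup => _ [vs vs1 <-]; rewrite lee_fin.
apply: (iterD_expand NC _ Ox).
- by move=> c; apply: smooth_leq jm _; exact: sp.
- by move=> bs szb; exact: HK szb Ox.
- exact: size_tuple.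
- by move=> v /tnthP[c ->]; exact: vs1.
Qed.

End UniformBounds.

Theorem corollary4 (R : realType) (d k : nat) (M : set 'rV[R]_d)
    (hk : (2 <= k)%N) (hM : hypersurface k M)
    (hreach : (0 < reach M)%E)
    (eps : R) (heps0 : 0 < eps) (heps : (eps%:E < reach M)%E)
    (hn : exists K : R, 0 < K /\
       forall j : nat, (2 <= j <= k.-1)%N -> (sup_normal_deriv M j <= K%:E)%E) :
  forall j : nat, (2 <= j <= k.-1)%N ->
    bounded_deriv j (tube M eps) (nearest_point M).
Proof.
move=> j /andP[j2 jk].
(* The existence of an admissible [j] forces [k >= 3], so the normal has two derivatives. *)
have m1 : (1 < k.-1)%N := leq_trans j2 jk.
have M0 : M !=set0 by have [_ []] := hM.
(* [eps] lies below a supremum; the extra element 0 cannot be the one exceeding it, since [eps] is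
   positive. *)
have [r epsr rM] : exists2 r, eps < r & tube M r `<=` unpp M.
  have [_ [->|[r [r0 rM] <-]]] := ereal_sup_gt heps.
    by rewrite lte_fin ltNge ltW.
  by rewrite lte_fin => er; exists r.
(* One patch per point of the tube, with a normal chosen around its foot, so that the patches cover
   the tube. *)
pose I := {x : 'rV[R]_d | tube M eps x}.
have Mp (i : I) : M (nearest_point M (sval i)).
  exact: (nearest_pointM rM (tubeW epsr (svalP i))).
have /choice[W /choice[nu LN]] : forall i : I, exists W, exists nu,
    local_normal M k.-1 (nearest_point M (sval i)) W nu.
  by move=> i; exact: (hypersurface_local_normal hk hM (Mp i)).
have m0 := ltnW m1.
apply: (bounded_deriv_nearest_point M0 rM heps0 epsr m1 LN).
- have [K [K0 HK]] := hn.
  (* [K] bounds the orders from 2 on; the other constant is the bound at order 1 that follows from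
     the reach. *)
  exists (Num.max K (3 * ((r + eps) / (r - eps)) ^+ 2 / eps)) => i bs x Ox /andP[sz0 szm].
  rewrite le_max; case: bs sz0 szm => [//|b [|b' bs]] _ szm; apply/orP; [right|left].
    rewrite ler_pdivlMr // mulrC.
    exact: (nd1_bound M0 rM heps0 epsr m0 LN b Ox).
  by apply: (nd_bound M0 rM heps0 epsr m0 LN Ox szm); exact: HK.
- move=> x tx; pose i : I := exist _ x tx.
  by exists i; split=> //; exact: (normal_mem (LN i)).
- by rewrite (leq_trans _ j2).
Qed.
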